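(* Let $n$ be a positive integer. The finitely subdirectly irreducible members of $\mathbb{V}(\mathbf{F}_n(\mathbb{Z}))$ are exactly the non-trivial $n$-periodic $\ell$-pregroups with a totally ordered abelian group skeleton. In particular, each finitely subdirectly irreducible member of $\mathbb{V}(\mathbf{F}_n(\mathbb{Z}))$ that is not an $\ell$-group is subdirectly irreducible. So the finitely subdirectly irreducible members of $\mathbb{V}(\mathbf{F}_n(\mathbb{Z}))$ are exactly the subdirectly irreducible members of $\mathbb{V}(\mathbf{F}_n(\mathbb{Z}))$ together with the non-trivial totally ordered abelian $\ell$-groups.
   Context: An $\ell$-pregroup is an algebra $(A,\wedge,\vee,\cdot,1,{}^{\ell},{}^{r})$ such that $(A,\wedge,\vee)$ is a lattice, $(A,\cdot,1)$ is a monoid, multiplication is order-preserving in both arguments, and $a^{\ell}a\le 1\le aa^{\ell}$ and $aa^{r}\le 1\le a^{r}a$ for all $a\in A$. Write $x^{\ell^k}$, $x^{r^k}$ for the $k$-fold application of ${}^\ell$, ${}^r$. An $\ell$-pregroup is $n$-periodic if it satisfies $x^{\ell^n}\approx x^{r^n}$. The $\ell$-pregroups satisfying $x^\ell\approx x^r$ are exactly the $\ell$-groups (with $x^\ell=x^r=x^{-1}$). The group skeleton of an $\ell$-pregroup $\mathbf{L}$ is the subalgebra $\mathbf{L}_g$ with universe $\{a\in L: a^\ell=a^r\}$; it is an $\ell$-group consisting of the invertible elements of $\mathbf{L}$. A non-trivial algebra is subdirectly irreducible if its trivial congruence is completely meet-irreducible in its congruence lattice, and finitely subdirectly irreducible if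 its trivial congruence is meet-irreducible (trivial, i.e. one-element, algebras are neither). $\mathbf{F}(\mathbb{Z})$ is the $\ell$-pregroup of all order-preserving maps $f\colon\mathbb{Z}\to\mathbb{Z}$ such that $f^{-1}[\{x\}]$ is finite for every $x\in\mathbb{Z}$, with composition as multiplication, the identity map as $1$, the pointwise order, and $f^{\ell}(q)=\min\{p: q\le f(p)\}$, $f^{r}(q)=\max\{p: f(p)\le q\}$. $\mathbf{F}_n(\mathbb{Z})$ is the subalgebra of all $f$ with $f^{\ell^n}=f^{r^n}$; equivalently, all $f\in \mathbf{F}(\mathbb{Z})$ with $f(x+n)=f(x)+n$ for all $x\in\mathbb{Z}$. $\mathbb{V}(\mathcal{K})$ denotes the variety generated by $\mathcal{K}$. *)

(* Defs.v *)
From Stdlib Require Import ZArith Lia List Bool Relations RelationClasses.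
From Stdlib Require Import ClassicalEpsilon FunctionalExtensionality ProofIrrelevance.

Set Implicit Arguments.
Unset Strict Implicit.

Record algebra : Type := Algebra {
  carrier :> Type;
  meet : carrier -> carrier -> carrier;
  join : carrier -> carrier -> carrier;
  mul  : carrier -> carrier -> carrier;
  one  : carrier;
  linv : carrier -> carrier;
  rinv : carrier -> carrier
}.

Arguments meet {a} _ _.
Arguments join {a} _ _.
Arguments mul {a} _ _.
Arguments one {a}.
Arguments linv {a} _.
Arguments rinv {a} _.

Definition le (A : algebra) (x y : A) : Prop := meet x y = x.

Record is_lpregroup (A : algebra) : Prop := {
  meet_comm : forall x y : A, meet x y = meet y x;
  join_comm : forall x y : A, join x y = join y x;
  meet_assoc : forall x y z : A, meet x (meet y z) = meet (meet x y) z;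
  join_assoc : forall x y z : A, join x (join y z) = join (join x y) z;
  meet_absorb : forall x y : A, meet x (join x y) = x;
  join_absorb : forall x y : A, join x (meet x y) = x;
  mul_assoc : forall x y z : A, mul x (mul y z) = mul (mul x y) z;
  mul_one_l : forall x : A, mul one x = x;
  mul_one_r : forall x : A, mul x one = x;
  mul_mono_l : forall x y z : A, le x y -> le (mul x z) (mul y z);
  mul_mono_r : forall x y z : A, le x y -> le (mul z x) (mul z y);
  linv_contract : forall x : A, le (mul (linv x) x) one;
  linv_expand : forall x : A, le one (mul x (linv x));
  rinv_contract : forall x : A, le (mul x (rinv x)) one;
  rinv_expand : forall x : A, le one (mul (rinv x) x)
}.

Definition periodic_elt (A : algebra) (n : nat) (x : A) : Prop :=
  Nat.iter n linv x = Nat.iter n rinv x.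

Definition periodic (n : nat) (A : algebra) : Prop :=
  forall x : A, periodic_elt n x.

(* An l-group is an l-pregroup in which both inverses coincide; they are then
   the group inverse. *)
Definition is_lgroup (A : algebra) : Prop :=
  is_lpregroup A /\ forall x : A, linv x = rinv x.

Definition totally_ordered (A : algebra) : Prop :=
  forall x y : A, le x y \/ le y x.

Definition abelian (A : algebra) : Prop :=
  forall x y : A, mul x y = mul y x.

Definition nontrivial (A : algebra) : Prop := exists x y : A, x <> y.

Record congruence (A : algebra) (R : relation A) : Prop := {
  congr_equiv : Equivalence R;
  congr_meet : forall x x' y y', R x x' -> R y y' -> R (meet x y) (meet x' y');
  congr_join : forall x x' y y', R x x' -> R y y' -> R (join x y) (join x' y');
  congr_mul : forall x x' y y', R x x' -> R y y' -> R (mul x y) (mul x' y');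
  congr_linv : forall x x', R x x' -> R (linv x) (linv x');
  congr_rinv : forall x x', R x x' -> R (rinv x) (rinv x')
}.

(* Meets in the congruence lattice are intersections; congruences are compared
   up to extensional equality.  [K] may be empty, so the full congruence is
   not completely meet-irreducible. *)
Definition completely_meet_irreducible (A : algebra) (R : relation A) : Prop :=
  forall K : relation A -> Prop,
    (forall S, K S -> congruence S) ->
    same_relation A R (fun x y => forall S, K S -> S x y) ->
    exists S, K S /\ same_relation A R S.

Definition meet_irreducible (A : algebra) (R : relation A) : Prop :=
  forall S T : relation A,
    congruence S -> congruence T ->
    same_relation A R (fun x y => S x y /\ T x y) ->
    same_relation A R S \/ same_relation A R T.

Definition subdirectly_irreducible (A : algebra) : Prop :=
  nontrivial A /\ completely_meet_irreducible (@eq A).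

Definition finitely_subdirectly_irreducible (A : algebra) : Prop :=
  nontrivial A /\ meet_irreducible (@eq A).

Inductive term : Type :=
| Var (i : nat)
| Meet (s t : term)
| Join (s t : term)
| Mul (s t : term)
| One
| Linv (t : term)
| Rinv (t : term).

Fixpoint eval (A : algebra) (v : nat -> A) (t : term) : A :=
  match t with
  | Var i => v i
  | Meet s t => meet (eval v s) (eval v t)
  | Join s t => join (eval v s) (eval v t)
  | Mul s t => mul (eval v s) (eval v t)
  | One => one
  | Linv t => linv (eval v t)
  | Rinv t => rinv (eval v t)
  end.

Definition satisfies (A : algebra) (e : term * term) : Prop :=
  forall v : nat -> A, eval v (fst e) = eval v (snd e).

(* Varieties are taken to be equational classes, so that no product over an
   index type is needed. *)
Definition variety (V : algebra -> Prop) : Prop :=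
  exists E : term * term -> Prop,
    forall A, V A <-> (forall e, E e -> satisfies A e).

Definition generated_variety (K : algebra -> Prop) (A : algebra) : Prop :=
  forall V, variety V -> (forall B, K B -> V B) -> V A.

Record subuniverse (A : algebra) (P : A -> Prop) : Prop := {
  sub_meet : forall x y, P x -> P y -> P (meet x y);
  sub_join : forall x y, P x -> P y -> P (join x y);
  sub_mul : forall x y, P x -> P y -> P (mul x y);
  sub_one : P one;
  sub_linv : forall x, P x -> P (linv x);
  sub_rinv : forall x, P x -> P (rinv x)
}.

Arguments subuniverse A P : clear implicits.

Definition subalgebra (A : algebra) (P : A -> Prop) (H : subuniverse A P) :
  algebra := {|
  carrier := {x : A | P x};
  meet x y := exist P _ (sub_meet H (proj2_sig x) (proj2_sig y));
  join x y := exist P _ (sub_join H (proj2_sig x) (proj2_sig y));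
  mul x y := exist P _ (sub_mul H (proj2_sig x) (proj2_sig y));
  one := exist P _ (sub_one H);
  linv x := exist P _ (sub_linv H (proj2_sig x));
  rinv x := exist P _ (sub_rinv H (proj2_sig x))
|}.

Section LPregroup.

Variables (A : algebra) (HA : is_lpregroup A).
Implicit Types x y z : A.

Lemma meet_idem x : meet x x = x.
Proof.
  rewrite <- (join_absorb HA x x) at 2. apply (meet_absorb HA).
Qed.

Lemma le_refl x : le x x.
Proof. exact (meet_idem x). Qed.

Lemma le_trans x y z : le x y -> le y z -> le x z.
Proof.
  unfold le; intros H1 H2.
  rewrite <- H1, <- (meet_assoc HA), H2. reflexivity.
Qed.

Lemma le_antisym x y : le x y -> le y x -> x = y.
Proof.
  unfold le; intros H1 H2.
  rewrite <- H1, (meet_comm HA). exact H2.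
Qed.

Lemma meet_le_l x y : le (meet x y) x.
Proof.
  unfold le.
  rewrite (meet_comm HA (meet x y)), (meet_assoc HA), meet_idem. reflexivity.
Qed.

Lemma meet_le_r x y : le (meet x y) y.
Proof. rewrite (meet_comm HA). apply meet_le_l. Qed.

Lemma meet_glb x y z : le z x -> le z y -> le z (meet x y).
Proof.
  unfold le; intros H1 H2. rewrite (meet_assoc HA), H1. exact H2.
Qed.

Lemma le_join_l x y : le x (join x y).
Proof. exact (meet_absorb HA x y). Qed.

Lemma le_join_r x y : le y (join x y).
Proof. rewrite (join_comm HA). apply le_join_l. Qed.

Lemma le_join_eq x y : le x y -> join x y = y.
Proof.
  unfold le; intros H.
  rewrite <- H, (join_comm HA), (meet_comm HA). apply (join_absorb HA).
Qed.

Lemma join_lub x y z : le x z -> le y z -> le (join x y) z.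
Proof.
  intros H1 H2. apply le_join_eq in H1. apply le_join_eq in H2.
  rewrite <- H1, <- H2, (join_assoc HA). apply le_join_l.
Qed.

Lemma linv_unique x y : le (mul y x) one -> le one (mul x y) -> y = linv x.
Proof.
  intros H1 H2; apply le_antisym.
  - apply le_trans with (mul y (mul x (linv x))).
    + rewrite <- (mul_one_r HA y) at 1.
      apply (mul_mono_r HA), (linv_expand HA).
    + rewrite (mul_assoc HA); rewrite <- (mul_one_l HA (linv x)) at 2.
      apply (mul_mono_l HA), H1.
  - apply le_trans with (mul (linv x) (mul x y)).
    + rewrite <- (mul_one_r HA (linv x)) at 1. apply (mul_mono_r HA), H2.
    + rewrite (mul_assoc HA); rewrite <- (mul_one_l HA y) at 2.
      apply (mul_mono_l HA), (linv_contract HA).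
Qed.

Lemma rinv_unique x y : le (mul x y) one -> le one (mul y x) -> y = rinv x.
Proof.
  intros H1 H2; apply le_antisym.
  - apply le_trans with (mul (mul (rinv x) x) y).
    + rewrite <- (mul_one_l HA y) at 1.
      apply (mul_mono_l HA), (rinv_expand HA).
    + rewrite <- (mul_assoc HA); rewrite <- (mul_one_r HA (rinv x)) at 2.
      apply (mul_mono_r HA), H1.
  - apply le_trans with (mul (mul y x) (rinv x)).
    + rewrite <- (mul_one_l HA (rinv x)) at 1. apply (mul_mono_l HA), H2.
    + rewrite <- (mul_assoc HA); rewrite <- (mul_one_r HA y) at 2.
      apply (mul_mono_r HA), (rinv_contract HA).
Qed.

Lemma rinvK x : linv (rinv x) = x.
Proof.
  symmetry; apply linv_unique; [apply (rinv_contract HA) | apply (rinv_expand HA)].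
Qed.

Lemma linvK x : rinv (linv x) = x.
Proof.
  symmetry; apply rinv_unique; [apply (linv_contract HA) | apply (linv_expand HA)].
Qed.

Lemma linv_one : linv (one : A) = one.
Proof.
  symmetry; apply linv_unique; rewrite (mul_one_l HA); apply le_refl.
Qed.

Lemma rinv_one : rinv (one : A) = one.
Proof.
  symmetry; apply rinv_unique; rewrite (mul_one_l HA); apply le_refl.
Qed.

Lemma linv_mul x y : linv (mul x y) = mul (linv y) (linv x).
Proof.
  symmetry; apply linv_unique.
  - apply le_trans with (mul (linv y) y); [|apply (linv_contract HA)].
    rewrite <- (mul_assoc HA). apply (mul_mono_r HA).
    rewrite (mul_assoc HA). rewrite <- (mul_one_l HA y) at 2.
    apply (mul_mono_l HA), (linv_contract HA).
  - apply le_trans with (mul x (linv x)); [apply (linv_expand HA)|].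
    rewrite <- (mul_assoc HA). apply (mul_mono_r HA).
    rewrite (mul_assoc HA). rewrite <- (mul_one_l HA (linv x)) at 1.
    apply (mul_mono_l HA), (linv_expand HA).
Qed.

Lemma rinv_mul x y : rinv (mul x y) = mul (rinv y) (rinv x).
Proof.
  rewrite <- (rinvK x) at 1. rewrite <- (rinvK y) at 1.
  rewrite <- linv_mul. apply linvK.
Qed.

Lemma linv_anti x y : le x y -> le (linv y) (linv x).
Proof.
  intros H. apply le_trans with (mul (linv y) (mul x (linv x))).
  - rewrite <- (mul_one_r HA (linv y)) at 1.
    apply (mul_mono_r HA), (linv_expand HA).
  - apply le_trans with (mul (linv y) (mul y (linv x))).
    + apply (mul_mono_r HA), (mul_mono_l HA), H.
    + rewrite (mul_assoc HA); rewrite <- (mul_one_l HA (linv x)) at 2.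
      apply (mul_mono_l HA), (linv_contract HA).
Qed.

Lemma rinv_anti x y : le x y -> le (rinv y) (rinv x).
Proof.
  intros H. apply le_trans with (mul (mul (rinv x) x) (rinv y)).
  - rewrite <- (mul_one_l HA (rinv y)) at 1.
    apply (mul_mono_l HA), (rinv_expand HA).
  - apply le_trans with (mul (mul (rinv x) y) (rinv y)).
    + apply (mul_mono_l HA), (mul_mono_r HA), H.
    + rewrite <- (mul_assoc HA); rewrite <- (mul_one_r HA (rinv x)) at 2.
      apply (mul_mono_r HA), (rinv_contract HA).
Qed.

Lemma linv_meet x y : linv (meet x y) = join (linv x) (linv y).
Proof.
  apply le_antisym.
  - rewrite <- (rinvK (join (linv x) (linv y))).
    apply linv_anti, meet_glb.
    + rewrite <- (linvK x) at 2. apply rinv_anti, le_join_l.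
    + rewrite <- (linvK y) at 2. apply rinv_anti, le_join_r.
  - apply join_lub; apply linv_anti; [apply meet_le_l | apply meet_le_r].
Qed.

Lemma rinv_meet x y : rinv (meet x y) = join (rinv x) (rinv y).
Proof.
  apply le_antisym.
  - rewrite <- (linvK (join (rinv x) (rinv y))).
    apply rinv_anti, meet_glb.
    + rewrite <- (rinvK x) at 2. apply linv_anti, le_join_l.
    + rewrite <- (rinvK y) at 2. apply linv_anti, le_join_r.
  - apply join_lub; apply rinv_anti; [apply meet_le_l | apply meet_le_r].
Qed.

Lemma linv_join x y : linv (join x y) = meet (linv x) (linv y).
Proof.
  rewrite <- (linvK x) at 1. rewrite <- (linvK y) at 1.
  rewrite <- rinv_meet. apply rinvK.
Qed.

Lemma rinv_join x y : rinv (join x y) = meet (rinv x) (rinv y).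
Proof.
  rewrite <- (rinvK x) at 1. rewrite <- (rinvK y) at 1.
  rewrite <- linv_meet. apply linvK.
Qed.

Lemma iter_anti (f : A -> A) :
  (forall x y, f (meet x y) = join (f x) (f y)) ->
  (forall x y, f (join x y) = meet (f x) (f y)) ->
  (forall x y, f (mul x y) = mul (f y) (f x)) ->
  f one = one ->
  forall n x y,
    Nat.iter n f (meet x y) =
      (if Nat.even n then meet else join) (Nat.iter n f x) (Nat.iter n f y) /\
    Nat.iter n f (join x y) =
      (if Nat.even n then join else meet) (Nat.iter n f x) (Nat.iter n f y) /\
    Nat.iter n f (mul x y) =
      (if Nat.even n then mul (Nat.iter n f x) (Nat.iter n f y)
       else mul (Nat.iter n f y) (Nat.iter n f x)) /\
    Nat.iter n f one = one.
Proof.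
  intros Hm Hj Hp H1; induction n as [|n IH]; intros x y.
  - repeat split.
  - destruct (IH x y) as (E1 & E2 & E3 & E4).
    rewrite Nat.even_succ, <- Nat.negb_even. simpl Nat.iter.
    rewrite E1, E2, E3, E4.
    destruct (Nat.even n); simpl; auto.
Qed.

Lemma iter_linv_comm n x : Nat.iter n linv (rinv x) = rinv (Nat.iter n linv x).
Proof.
  induction n as [|n IH]; simpl; [reflexivity|].
  rewrite IH, rinvK, linvK. reflexivity.
Qed.

Lemma iter_rinv_comm n x : Nat.iter n rinv (linv x) = linv (Nat.iter n rinv x).
Proof.
  induction n as [|n IH]; simpl; [reflexivity|].
  rewrite IH, rinvK, linvK. reflexivity.
Qed.

Lemma iter_shift (f : A -> A) n x : Nat.iter n f (f x) = f (Nat.iter n f x).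
Proof. induction n as [|n IH]; simpl; [reflexivity | now rewrite IH]. Qed.

Lemma iter_rinvK n x : Nat.iter n linv (Nat.iter n rinv x) = x.
Proof.
  revert x; induction n as [|n IH]; intros x; [reflexivity|].
  simpl; rewrite <- iter_shift, rinvK; apply IH.
Qed.

Lemma iter_linvK n x : Nat.iter n rinv (Nat.iter n linv x) = x.
Proof.
  revert x; induction n as [|n IH]; intros x; [reflexivity|].
  simpl; rewrite <- iter_shift, linvK; apply IH.
Qed.

Lemma periodic_subuniverse n : subuniverse A (periodic_elt n).
Proof.
  pose proof (iter_anti linv_meet linv_join linv_mul linv_one n) as L.
  pose proof (iter_anti rinv_meet rinv_join rinv_mul rinv_one n) as R.
  split; unfold periodic_elt.
  - intros x y Hx Hy.
    destruct (L x y) as [-> _], (R x y) as [-> _]. now rewrite Hx, Hy.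
  - intros x y Hx Hy.
    destruct (L x y) as (_ & -> & _), (R x y) as (_ & -> & _).
    now rewrite Hx, Hy.
  - intros x y Hx Hy.
    destruct (L x y) as (_ & _ & -> & _), (R x y) as (_ & _ & -> & _).
    now rewrite Hx, Hy.
  - destruct (L one one) as (_ & _ & _ & ->), (R one one) as (_ & _ & _ & ->).
    reflexivity.
  - intros x Hx. now rewrite iter_shift, iter_rinv_comm, Hx.
  - intros x Hx. now rewrite iter_shift, iter_linv_comm, Hx.
Qed.

Definition periodic_subalgebra (n : nat) : algebra :=
  subalgebra (periodic_subuniverse n).

Lemma skeleton_subuniverse : subuniverse A (fun x => linv x = rinv x).
Proof. exact (periodic_subuniverse 1). Qed.

Definition skeleton : algebra := subalgebra skeleton_subuniverse.

End LPregroup.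

Local Open Scope Z_scope.

(* [Zleast P] and [Zgreatest P] are meaningful only when the minimum, resp.
   maximum, exists. *)
Definition Zleast (P : Z -> Prop) : Z :=
  epsilon (inhabits 0) (fun p => P p /\ forall p', P p' -> p <= p').

Definition Zgreatest (P : Z -> Prop) : Z :=
  epsilon (inhabits 0) (fun p => P p /\ forall p', P p' -> p' <= p).

Record inFZ (f : Z -> Z) : Prop := {
  FZ_mono : forall x y, x <= y -> f x <= f y;
  FZ_fibers : forall y, exists s : list Z, forall x, f x = y -> In x s
}.

Arguments FZ_mono {f} _ x y _.

Definition FZ_linv (f : Z -> Z) (q : Z) : Z := Zleast (fun p => q <= f p).
Definition FZ_rinv (f : Z -> Z) (q : Z) : Z := Zgreatest (fun p => f p <= q).

Lemma list_bounded (s : list Z) : exists M, forall x, In x s -> - M <= x <= M.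
Proof.
  induction s as [|a s [M HM]].
  - exists 0; intros x [].
  - exists (Z.max (Z.abs a) M); intros x [<- | Hx]; [|apply HM in Hx]; lia.
Qed.

Lemma FZ_unbounded f : inFZ f ->
  (forall y, exists x, y <= f x) /\ (forall y, exists x, f x <= y).
Proof.
  intros [mono fib].
  assert (up : forall k : nat, exists x, f 0 + Z.of_nat k <= f x).
  { induction k as [|k [x Hx]]; [exists 0; lia|].
    destruct (fib (f x)) as [s Hs], (list_bounded s) as [M HM].
    exists (Z.max x M + 1).
    pose proof (mono x (Z.max x M + 1) ltac:(lia)).
    destruct (Z.eq_dec (f (Z.max x M + 1)) (f x)) as [E|]; [|lia].
    apply Hs, HM in E; lia. }
  assert (dn : forall k : nat, exists x, f x <= f 0 - Z.of_nat k).
  { induction k as [|k [x Hx]]; [exists 0; lia|].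
    destruct (fib (f x)) as [s Hs], (list_bounded s) as [M HM].
    exists (Z.min x (- M) - 1).
    pose proof (mono (Z.min x (- M) - 1) x ltac:(lia)).
    destruct (Z.eq_dec (f (Z.min x (- M) - 1)) (f x)) as [E|]; [|lia].
    apply Hs, HM in E; lia. }
  split; intros y.
  - destruct (up (Z.to_nat (y - f 0))) as [x Hx]; exists x; lia.
  - destruct (dn (Z.to_nat (f 0 - y))) as [x Hx]; exists x; lia.
Qed.

Lemma inFZ_intro f :
  (forall x y, x <= y -> f x <= f y) ->
  (forall y, exists x, y <= f x) -> (forall y, exists x, f x <= y) ->
  inFZ f.
Proof.
  intros mono up dn; split; [exact mono|]; intros y.
  destruct (dn (y - 1)) as [a Ha], (up (y + 1)) as [b Hb].
  exists (map (fun k => a + Z.of_nat k) (seq 0 (Z.to_nat (b - a)))).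
  intros x Hx; apply in_map_iff; exists (Z.to_nat (x - a)).
  assert (a < x) by (apply Z.nle_gt; intros C; apply mono in C; lia).
  assert (x < b) by (apply Z.nle_gt; intros C; apply mono in C; lia).
  split; [lia | apply in_seq; lia].
Qed.

Lemma Zleast_spec (P : Z -> Prop) (a b : Z) :
  P b -> (forall p, P p -> a <= p) ->
  P (Zleast P) /\ forall p, P p -> Zleast P <= p.
Proof.
  intros Hb Ha.
  refine (epsilon_spec (inhabits 0) (fun p => P p /\ forall p', P p' -> p <= p') _).
  assert (H : forall k : nat, forall c, P c -> c - a <= Z.of_nat k ->
    exists p, P p /\ forall p', P p' -> p <= p').
  { induction k as [|k IH]; intros c Hc Hk.
    - exists c; split; [exact Hc|]; intros p' Hp'; apply Ha in Hp'; lia.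
    - destruct (classic (exists p, P p /\ p < c)) as [(p & Hp & Hlt)|N].
      + apply (IH p Hp); lia.
      + exists c; split; [exact Hc|]; intros p' Hp'.
        apply Z.nlt_ge; intros C; apply N; eauto. }
  apply (H (Z.to_nat (b - a)) b Hb); lia.
Qed.

Lemma Zgreatest_spec (P : Z -> Prop) (a b : Z) :
  P b -> (forall p, P p -> p <= a) ->
  P (Zgreatest P) /\ forall p, P p -> p <= Zgreatest P.
Proof.
  intros Hb Ha.
  refine (epsilon_spec (inhabits 0) (fun p => P p /\ forall p', P p' -> p' <= p) _).
  destruct (@Zleast_spec (fun p => P (- p)) (- a) (- b)) as [H1 H2].
  - now rewrite Z.opp_involutive.
  - intros p Hp; apply Ha in Hp; lia.
  - exists (- Zleast (fun p => P (- p))); split; [exact H1|].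
    intros p' Hp'; specialize (H2 (- p')); rewrite Z.opp_involutive in H2.
    apply H2 in Hp'; lia.
Qed.

Lemma FZ_linv_galois f : inFZ f -> forall p q, FZ_linv f p <= q <-> p <= f q.
Proof.
  intros Hf p q. destruct (FZ_unbounded Hf) as [up dn].
  destruct (up p) as [b Hb], (dn (p - 1)) as [a Ha].
  destruct (@Zleast_spec (fun x => p <= f x) a b Hb) as [H1 H2].
  - intros x Hx; apply Z.nlt_ge; intros C.
    pose proof (FZ_mono Hf x a ltac:(lia)); lia.
  - unfold FZ_linv; split; intros H.
    + pose proof (FZ_mono Hf _ _ H); lia.
    + now apply H2.
Qed.

Lemma FZ_rinv_galois f : inFZ f -> forall p q, q <= FZ_rinv f p <-> f q <= p.
Proof.
  intros Hf p q. destruct (FZ_unbounded Hf) as [up dn].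
  destruct (dn p) as [b Hb], (up (p + 1)) as [a Ha].
  destruct (@Zgreatest_spec (fun x => f x <= p) a b Hb) as [H1 H2].
  - intros x Hx; apply Z.nlt_ge; intros C.
    pose proof (FZ_mono Hf a x ltac:(lia)); lia.
  - unfold FZ_rinv; split; intros H.
    + pose proof (FZ_mono Hf _ _ H); lia.
    + now apply H2.
Qed.

Lemma inFZ_min f g : inFZ f -> inFZ g -> inFZ (fun x => Z.min (f x) (g x)).
Proof.
  intros Hf Hg; destruct (FZ_unbounded Hf) as [uf df], (FZ_unbounded Hg) as [ug dg].
  apply inFZ_intro.
  - intros x y H; pose proof (FZ_mono Hf _ _ H); pose proof (FZ_mono Hg _ _ H); lia.
  - intros y; destruct (uf y) as [a Ha], (ug y) as [b Hb]; exists (Z.max a b).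
    pose proof (FZ_mono Hf a (Z.max a b) ltac:(lia)).
    pose proof (FZ_mono Hg b (Z.max a b) ltac:(lia)); lia.
  - intros y; destruct (df y) as [a Ha]; exists a; lia.
Qed.

Lemma inFZ_max f g : inFZ f -> inFZ g -> inFZ (fun x => Z.max (f x) (g x)).
Proof.
  intros Hf Hg; destruct (FZ_unbounded Hf) as [uf df], (FZ_unbounded Hg) as [ug dg].
  apply inFZ_intro.
  - intros x y H; pose proof (FZ_mono Hf _ _ H); pose proof (FZ_mono Hg _ _ H); lia.
  - intros y; destruct (uf y) as [a Ha]; exists a; lia.
  - intros y; destruct (df y) as [a Ha], (dg y) as [b Hb]; exists (Z.min a b).
    pose proof (FZ_mono Hf (Z.min a b) a ltac:(lia)).
    pose proof (FZ_mono Hg (Z.min a b) b ltac:(lia)); lia.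
Qed.

Lemma inFZ_comp f g : inFZ f -> inFZ g -> inFZ (fun x => f (g x)).
Proof.
  intros Hf Hg; destruct (FZ_unbounded Hf) as [uf df], (FZ_unbounded Hg) as [ug dg].
  apply inFZ_intro.
  - intros x y H; now apply (FZ_mono Hf), (FZ_mono Hg).
  - intros y; destruct (uf y) as [a Ha], (ug a) as [b Hb]; exists b.
    pose proof (FZ_mono Hf _ _ Hb); lia.
  - intros y; destruct (df y) as [a Ha], (dg a) as [b Hb]; exists b.
    pose proof (FZ_mono Hf _ _ Hb); lia.
Qed.

Lemma inFZ_id : inFZ (fun x => x).
Proof. apply inFZ_intro; eauto using Z.le_refl. Qed.

Lemma inFZ_linv f : inFZ f -> inFZ (FZ_linv f).
Proof.
  intros Hf; pose proof (FZ_linv_galois Hf) as G; apply inFZ_intro.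
  - intros x y H; apply G. pose proof (proj1 (G y _) (Z.le_refl _)); lia.
  - intros y; exists (f (y - 1) + 1).
    apply Z.nlt_ge; intros C.
    assert (H : FZ_linv f (f (y - 1) + 1) <= y - 1) by lia.
    apply G in H; lia.
  - intros y; exists (f y); apply G; lia.
Qed.

Lemma inFZ_rinv f : inFZ f -> inFZ (FZ_rinv f).
Proof.
  intros Hf; pose proof (FZ_rinv_galois Hf) as G; apply inFZ_intro.
  - intros x y H; apply G. pose proof (proj1 (G x _) (Z.le_refl _)); lia.
  - intros y; exists (f y); apply G; lia.
  - intros y; exists (f (y + 1) - 1).
    apply Z.nlt_ge; intros C.
    assert (H : y + 1 <= FZ_rinv f (f (y + 1) - 1)) by lia.
    apply G in H; lia.
Qed.

(* Pointwise min and max are the lattice operations of the pointwise order. *)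
Definition FZ : algebra := {|
  carrier := {f : Z -> Z | inFZ f};
  meet f g := exist inFZ _ (inFZ_min (proj2_sig f) (proj2_sig g));
  join f g := exist inFZ _ (inFZ_max (proj2_sig f) (proj2_sig g));
  mul f g := exist inFZ _ (inFZ_comp (proj2_sig f) (proj2_sig g));
  one := exist inFZ _ inFZ_id;
  linv f := exist inFZ _ (inFZ_linv (proj2_sig f));
  rinv f := exist inFZ _ (inFZ_rinv (proj2_sig f))
|}.

Lemma FZ_ext (f g : FZ) : (forall x, proj1_sig f x = proj1_sig g x) -> f = g.
Proof.
  intros H.
  destruct f as [f Hf], g as [g Hg]; simpl in H.
  apply subset_eq_compat, functional_extensionality, H.
Qed.

Lemma FZ_leP (f g : FZ) :
  le f g <-> forall x, proj1_sig f x <= proj1_sig g x.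
Proof.
  split; intros H.
  - intros x; apply (f_equal (fun h : FZ => proj1_sig h x)) in H; simpl in H; lia.
  - apply FZ_ext; intros x; specialize (H x); simpl; lia.
Qed.

Lemma FZ_lpregroup : is_lpregroup FZ.
Proof.
  split.
  1-9: intros; apply FZ_ext; intros; simpl; lia.
  - intros f g h H; apply FZ_leP; intros x; simpl.
    apply FZ_leP with (x := proj1_sig h x) in H; exact H.
  - intros f g h H; apply FZ_leP; intros x; simpl.
    apply (FZ_mono (proj2_sig h)); revert x; now apply FZ_leP.
  - intros [f Hf]; apply FZ_leP; intros x; simpl.
    apply FZ_linv_galois; auto; lia.
  - intros [f Hf]; apply FZ_leP; intros x; simpl.
    apply FZ_linv_galois; auto; lia.
  - intros [f Hf]; apply FZ_leP; intros x; simpl.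
    apply FZ_rinv_galois; auto; lia.
  - intros [f Hf]; apply FZ_leP; intros x; simpl.
    apply FZ_rinv_galois; auto; lia.
Qed.

Definition FnZ (n : nat) : algebra := periodic_subalgebra FZ_lpregroup n.

Lemma FZ_linv2 (f : FZ) x :
  proj1_sig (linv (linv f)) x = proj1_sig f (x - 1) + 1.
Proof.
  destruct f as [f Hf]; simpl.
  pose proof (FZ_linv_galois Hf) as G.
  pose proof (FZ_linv_galois (inFZ_linv Hf)) as G2.
  apply Z.le_antisymm.
  - apply G2, Z.nlt_ge; intros C.
    assert (H : FZ_linv f (f (x - 1) + 1) <= x - 1) by lia.
    apply G in H; lia.
  - apply Z.nlt_ge; intros C.
    assert (H : FZ_linv (FZ_linv f) x <= f (x - 1)) by lia.
    apply G2 in H. pose proof (proj2 (G (f (x - 1)) (x - 1)) (Z.le_refl _)); lia.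
Qed.

Lemma FnZ_translation (n : nat) (f : FZ) :
  periodic_elt n f <->
  forall x, proj1_sig f (x + Z.of_nat n) = proj1_sig f x + Z.of_nat n.
Proof.
  assert (D : forall k (g : FZ) x,
    proj1_sig (Nat.iter k linv (Nat.iter k linv g)) x
      = proj1_sig g (x - Z.of_nat k) + Z.of_nat k).
  { induction k as [|k IH]; intros g x.
    - simpl; rewrite Z.sub_0_r; lia.
    - change (proj1_sig (linv (Nat.iter k linv (linv (Nat.iter k linv g)))) x
        = proj1_sig g (x - Z.of_nat (S k)) + Z.of_nat (S k)).
      rewrite <- !iter_shift, IH, FZ_linv2.
      replace (x - Z.of_nat k - 1) with (x - Z.of_nat (S k)) by lia; lia. }
  unfold periodic_elt; split.
  - intros H x. pose proof (D n f (x + Z.of_nat n)) as E.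
    rewrite H, (iter_rinvK FZ_lpregroup) in E. rewrite E. f_equal; f_equal; lia.
  - intros H.
    rewrite <- (iter_linvK FZ_lpregroup n (Nat.iter n linv f)); f_equal.
    apply FZ_ext; intros x; rewrite D, <- H; f_equal; lia.
Qed.

Definition var_FnZ (n : nat) : algebra -> Prop := generated_variety (eq (FnZ n)).

(* Main.v *)
(* Write G for the group skeleton and call [e >= 1] a closure if [e * e = e].

   A nontrivial congruence identifies some [h > 1] of G with [1], namely the join
   of the orbit of [u^l v \/ 1] under [x |-> x^ll], where [u < v] are identified.
   Hence a total order on G makes any two nontrivial congruences meet
   nontrivially. Conversely, in the variety [g^n] is central for [g] in G, so
   disjoint elements of G give congruences with trivial intersection.

   Let now A be n-periodic with G abelian and totally ordered. If A is not a
   group, some closure [e > 1] is an atom of the cone above [1]; the join [u] of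
   its orbit is the least element of G above [1]. A product of the members of the
   orbit of [e] is a closure [p] with [e p = u p], and with [P = p^r] every
   [a P] equals [g P] for a unique [g] in G. So A acts on the chain G by
   [a . x = y] iff [a x P = y P]. The kernel of this action is a congruence that
   does not meet G, so the action is faithful; as [u] is the successor in G,
   [x^ll = u x u^-1], and modulo the elements commuting with [p] the group G is
   cyclic of order dividing n, generated by [u]. If A is a group it acts on its
   lexicographic product with Z instead.

   Evaluating an equation at a point of such a chain involves finitely many
   elements, and a finite part of the chain maps to Z, compatibly with addition,
   order, successor and residues: choose a basis independent modulo [u] and a
   positive functional on it. This gives a failure of the equation in F_n(Z). *)
Require Import Defs.
From Stdlib Require Import ZArith Lia List Relations.
From Stdlib Require Import QArith Lqa Ring.
From Stdlib Require Import ClassicalEpsilon FunctionalExtensionality ProofIrrelevance.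

Set Implicit Arguments.
Unset Strict Implicit.

Close Scope Q_scope.

Declare Scope alg_scope.
Delimit Scope alg_scope with alg.
Infix "*" := mul : alg_scope.
Infix "<=" := le : alg_scope.
Infix "⊓" := meet (at level 45, left associativity) : alg_scope.
Infix "⊔" := join (at level 46, left associativity) : alg_scope.
Notation "1" := one : alg_scope.

(** * Arithmetic of l-pregroups *)

Section Order.

Variables (A : algebra) (HA : is_lpregroup A).
Implicit Types x y z a b e g h : A.
Local Open Scope alg_scope.

(** Periodicity gives [phi] finite order, so meets and joins over its orbits are invertible; through
    these projections the order of the skeleton governs arbitrary elements.

    The least obvious step is that the cone above 1 has atoms. A closure disjoint from its image
    under [phi] lies below every skeleton element strictly above 1, in particular below the orbit
    join of any smaller proper closure. Once shrinking creates no further disjointness along the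
    orbit, this forces the smaller closure to be the larger one.

    In F_n(Z) the map [P] sends a number to the greatest member of a residue class not above it, so
    [a * P = g * P] says that [a] moves this class as the translation [g] does: elements of the
    skeleton serve as points.

    The obstacle to an embedding is rank: an order-preserving homomorphism to Z sending the
    successor to 1 exists only for a cyclic skeleton. Hence maps to Z are constrained only on the
    finite set met by an evaluation. They must also respect residues, because the action commutes
    only with translations by elements commuting with [p], while the transported maps have to be
    n-periodic. *)

Lemma mul_le x x' y y' : x <= x' -> y <= y' -> x * y <= x' * y'.
Proof.
  intros Hx Hy. apply (le_trans HA) with (x' * y).
  - now apply (mul_mono_l HA).
  - now apply (mul_mono_r HA).
Qed.

Lemma eq_le x y : x = y -> x <= y.
Proof. intros ->; apply (le_refl HA). Qed.

Lemma le_meet_trans_l x y z : x <= z -> x ⊓ y <= z.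
Proof. intros H; apply (le_trans HA) with x; [apply (meet_le_l HA) | exact H]. Qed.

Lemma le_meet_trans_r x y z : y <= z -> x ⊓ y <= z.
Proof. intros H; apply (le_trans HA) with y; [apply (meet_le_r HA) | exact H]. Qed.

Lemma le_join_trans_l x y z : z <= x -> z <= x ⊔ y.
Proof. intros H; apply (le_trans HA) with x; [exact H | apply (le_join_l HA)]. Qed.

Lemma le_join_trans_r x y z : z <= y -> z <= x ⊔ y.
Proof. intros H; apply (le_trans HA) with y; [exact H | apply (le_join_r HA)]. Qed.

Lemma meet_mono x x' y y' : x <= x' -> y <= y' -> x ⊓ y <= x' ⊓ y'.
Proof.
  intros Hx Hy; apply (meet_glb HA);
    [now apply le_meet_trans_l | now apply le_meet_trans_r].
Qed.

Lemma mul_le_l x y : x <= 1 -> x * y <= y.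
Proof.
  intros H; apply (le_trans HA) with (1 * y);
    [now apply (mul_mono_l HA) | apply eq_le, (mul_one_l HA)].
Qed.

Lemma mul_le_r x y : y <= 1 -> x * y <= x.
Proof.
  intros H; apply (le_trans HA) with (x * 1);
    [now apply (mul_mono_r HA) | apply eq_le, (mul_one_r HA)].
Qed.

Lemma le_mul_l x y : 1 <= x -> y <= x * y.
Proof.
  intros H; apply (le_trans HA) with (1 * y);
    [apply eq_le; symmetry; apply (mul_one_l HA) | now apply (mul_mono_l HA)].
Qed.

Lemma le_mul_r x y : 1 <= y -> x <= x * y.
Proof.
  intros H; apply (le_trans HA) with (x * 1);
    [apply eq_le; symmetry; apply (mul_one_r HA) | now apply (mul_mono_r HA)].
Qed.

Lemma residual_r x y z : x * y <= z <-> y <= rinv x * z.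
Proof.
  split; intros H.
  - apply (le_trans HA) with (rinv x * (x * y)); [|now apply (mul_mono_r HA)].
    rewrite (mul_assoc HA). apply le_mul_l, (rinv_expand HA).
  - apply (le_trans HA) with (x * (rinv x * z)); [now apply (mul_mono_r HA)|].
    rewrite (mul_assoc HA). apply mul_le_l, (rinv_contract HA).
Qed.

Lemma residual_l x y z : x * y <= z <-> x <= z * linv y.
Proof.
  split; intros H.
  - apply (le_trans HA) with (x * y * linv y); [|now apply (mul_mono_l HA)].
    rewrite <- (mul_assoc HA). apply le_mul_r, (linv_expand HA).
  - apply (le_trans HA) with (z * linv y * y); [now apply (mul_mono_l HA)|].
    rewrite <- (mul_assoc HA). apply mul_le_r, (linv_contract HA).
Qed.

Lemma coresidual_r x y z : linv x * y <= z <-> y <= x * z.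
Proof. rewrite residual_r, (linvK HA). reflexivity. Qed.

Lemma coresidual_l x y z : x * rinv y <= z <-> x <= z * y.
Proof. rewrite residual_l, (rinvK HA). reflexivity. Qed.

Lemma mul_meet_l x y z : z * (x ⊓ y) = z * x ⊓ z * y.
Proof.
  apply (le_antisym HA).
  - apply (meet_glb HA); apply (mul_mono_r HA);
      [apply (meet_le_l HA) | apply (meet_le_r HA)].
  - apply coresidual_r, (meet_glb HA); apply coresidual_r;
      [apply (meet_le_l HA) | apply (meet_le_r HA)].
Qed.

Lemma mul_meet_r x y z : (x ⊓ y) * z = x * z ⊓ y * z.
Proof.
  apply (le_antisym HA).
  - apply (meet_glb HA); apply (mul_mono_l HA);
      [apply (meet_le_l HA) | apply (meet_le_r HA)].
  - apply coresidual_l, (meet_glb HA); apply coresidual_l;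
      [apply (meet_le_l HA) | apply (meet_le_r HA)].
Qed.

Lemma mul_join_l x y z : z * (x ⊔ y) = z * x ⊔ z * y.
Proof.
  apply (le_antisym HA).
  - apply residual_r, (join_lub HA); apply residual_r;
      [apply (le_join_l HA) | apply (le_join_r HA)].
  - apply (join_lub HA); apply (mul_mono_r HA);
      [apply (le_join_l HA) | apply (le_join_r HA)].
Qed.

Lemma mul_join_r x y z : (x ⊔ y) * z = x * z ⊔ y * z.
Proof.
  apply (le_antisym HA).
  - apply residual_l, (join_lub HA); apply residual_l;
      [apply (le_join_l HA) | apply (le_join_r HA)].
  - apply (join_lub HA); apply (mul_mono_l HA);
      [apply (le_join_l HA) | apply (le_join_r HA)].
Qed.

(* Both factors of the left-hand side lie below [(x ⊔ y) * a] and
   [(x ⊔ y) * b], whose meet is [(x ⊔ y) * (a ⊓ b)]. *)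
Lemma mul_cross x y a b : x * a ⊓ y * b <= x * b ⊔ y * a.
Proof.
  apply (le_trans HA) with ((x ⊔ y) * (a ⊓ b)).
  - rewrite mul_meet_l. apply meet_mono; apply (mul_mono_l HA);
      [apply (le_join_l HA) | apply (le_join_r HA)].
  - rewrite mul_join_r. apply (join_lub HA).
    + apply le_join_trans_l, (mul_mono_r HA), (meet_le_r HA).
    + apply le_join_trans_r, (mul_mono_r HA), (meet_le_l HA).
Qed.

Definition disjoint x y : Prop := x ⊓ y = 1.

Lemma disjoint_sym x y : disjoint x y -> disjoint y x.
Proof. unfold disjoint; now rewrite (meet_comm HA). Qed.

Lemma disjoint_le x y z : 1 <= z -> z <= y -> disjoint x y -> 1 <= x -> disjoint x z.
Proof.
  intros Hz Hzy D Hx; apply (le_antisym HA).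
  - rewrite <- D. apply meet_mono; [apply (le_refl HA) | exact Hzy].
  - now apply (meet_glb HA).
Qed.

Lemma disjoint_mul x y z :
  1 <= x -> 1 <= y -> 1 <= z -> disjoint x y -> disjoint x z -> disjoint x (y * z).
Proof.
  unfold disjoint; intros Hx Hy Hz Dy Dz; apply (le_antisym HA).
  - rewrite <- Dz. apply (meet_glb HA); [apply (meet_le_l HA)|].
    rewrite <- (mul_one_l HA z) at 2. rewrite <- Dy, mul_meet_r.
    apply meet_mono; [now apply le_mul_r | apply (le_refl HA)].
  - apply (meet_glb HA); [exact Hx|].
    apply (le_trans HA) with y; [exact Hy | now apply le_mul_r].
Qed.

Lemma disjoint_self x : disjoint x x -> x = 1.
Proof. unfold disjoint; now rewrite (meet_idem HA). Qed.

Lemma le_of_mul_disjoint w x y :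
  1 <= w -> x <= w * y -> disjoint x y -> x <= w.
Proof.
  intros Hw H D.
  apply (le_trans HA) with (w * (x ⊓ y)).
  - rewrite mul_meet_l. apply (meet_glb HA); [now apply le_mul_l | exact H].
  - unfold disjoint in D; rewrite D, (mul_one_r HA). apply (le_refl HA).
Qed.

(* In F(Z), conjugation by the successor map. *)
Definition phi x := linv (linv x).

Lemma phi_meet x y : phi (x ⊓ y) = phi x ⊓ phi y.
Proof. unfold phi. now rewrite (linv_meet HA), (linv_join HA). Qed.

Lemma phi_mul x y : phi (x * y) = phi x * phi y.
Proof. unfold phi. now rewrite !(linv_mul HA). Qed.

Lemma phi_one : phi (1 : A) = 1.
Proof. unfold phi. now rewrite !(linv_one HA). Qed.

Notation phin k := (Nat.iter k phi).

Lemma phin_meet k x y : phin k (x ⊓ y) = phin k x ⊓ phin k y.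
Proof. induction k as [|k IH]; simpl; [reflexivity | now rewrite IH, phi_meet]. Qed.

Lemma phin_mul k x y : phin k (x * y) = phin k x * phin k y.
Proof. induction k as [|k IH]; simpl; [reflexivity | now rewrite IH, phi_mul]. Qed.

Lemma phin_one k : phin k (1 : A) = 1.
Proof. induction k as [|k IH]; simpl; [reflexivity | now rewrite IH, phi_one]. Qed.

Lemma phin_le k x y : x <= y -> phin k x <= phin k y.
Proof. unfold le; intros H. now rewrite <- phin_meet, H. Qed.

Lemma phin_ge1 k x : 1 <= x -> 1 <= phin k x.
Proof. intros H; rewrite <- (phin_one k); now apply phin_le. Qed.

Lemma phi_inj x y : phi x = phi y -> x = y.
Proof.
  unfold phi; intros H.
  now rewrite <- (linvK HA x), <- (linvK HA (linv x)), H, !(linvK HA).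
Qed.

Lemma phin_inj k x y : phin k x = phin k y -> x = y.
Proof.
  induction k as [|k IH]; simpl; [easy|]. intros H; apply IH, phi_inj, H.
Qed.

Lemma phin_add k l x : phin (k + l) x = phin k (phin l x).
Proof. induction k as [|k IH]; simpl; [reflexivity | now rewrite IH]. Qed.

Lemma phin_linv2 k x : phin k x = Nat.iter k linv (Nat.iter k linv x).
Proof.
  revert x; induction k as [|k IH]; intros x; [reflexivity|].
  simpl Nat.iter. rewrite IH. unfold phi. now rewrite iter_shift.
Qed.

Definition invertible x : Prop := linv x = rinv x.

Lemma invertible_phi x : invertible x <-> phi x = x.
Proof.
  unfold invertible, phi; split; intros H.
  - now rewrite H, (rinvK HA).
  - rewrite <- H at 2. now rewrite (linvK HA).
Qed.

Lemma invertible_mul x y : invertible x -> invertible y -> invertible (x * y).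
Proof. exact (sub_mul (skeleton_subuniverse HA) (x := x) (y := y)). Qed.

Lemma invertible_meet x y : invertible x -> invertible y -> invertible (x ⊓ y).
Proof. exact (sub_meet (skeleton_subuniverse HA) (x := x) (y := y)). Qed.

Lemma invertible_join x y : invertible x -> invertible y -> invertible (x ⊔ y).
Proof. exact (sub_join (skeleton_subuniverse HA) (x := x) (y := y)). Qed.

Lemma invertible_linv x : invertible x -> invertible (linv x).
Proof. exact (sub_linv (skeleton_subuniverse HA) (x := x)). Qed.

Lemma invertible_one : invertible (1 : A).
Proof. exact (sub_one (skeleton_subuniverse HA)). Qed.

Lemma mulV g : invertible g -> g * linv g = 1.
Proof.
  intros H; apply (le_antisym HA); [rewrite H; apply (rinv_contract HA) | apply (linv_expand HA)].
Qed.

Lemma Vmul g : invertible g -> linv g * g = 1.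
Proof.
  intros H; apply (le_antisym HA); [apply (linv_contract HA) | rewrite H; apply (rinv_expand HA)].
Qed.

Lemma mulVK g x : invertible g -> g * (linv g * x) = x.
Proof. intros H. now rewrite (mul_assoc HA), mulV, (mul_one_l HA). Qed.

Lemma VmulK g x : invertible g -> linv g * (g * x) = x.
Proof. intros H. now rewrite (mul_assoc HA), Vmul, (mul_one_l HA). Qed.

Lemma linv_linv g : invertible g -> linv (linv g) = g.
Proof. apply invertible_phi. Qed.

Lemma le_invertible_l g x y : invertible g -> g * x <= y <-> x <= linv g * y.
Proof. intros H; rewrite residual_r, H. reflexivity. Qed.

Lemma linv_le1 x : 1 <= x -> linv x <= 1.
Proof. intros H; rewrite <- (linv_one HA); now apply (linv_anti HA). Qed.

Lemma linv_ge1 x : x <= 1 -> 1 <= linv x.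
Proof. intros H; rewrite <- (linv_one HA); now apply (linv_anti HA). Qed.

Lemma rinv_le1 x : 1 <= x -> rinv x <= 1.
Proof. intros H; rewrite <- (rinv_one HA); now apply (rinv_anti HA). Qed.

Lemma le1_of_linv x : 1 <= linv x -> x <= 1.
Proof. intros H; rewrite <- (linvK HA x). now apply rinv_le1. Qed.

Definition closure e : Prop := 1 <= e /\ e * e = e.

Lemma closure_mul_linv w : 1 <= w -> closure (w * linv w) /\ w * linv w <= w.
Proof.
  intros Hw; repeat split.
  - apply (linv_expand HA).
  - apply (le_antisym HA).
    + rewrite <- (mul_assoc HA). apply (mul_mono_r HA).
      rewrite (mul_assoc HA). apply mul_le_l, (linv_contract HA).
    + apply le_mul_l, (linv_expand HA).
  - apply mul_le_r. now apply linv_le1.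
Qed.

Lemma closure_meet e e' : closure e -> closure e' -> closure (e ⊓ e').
Proof.
  intros [H1 H2] [H1' H2'].
  assert (P : 1 <= e ⊓ e') by now apply (meet_glb HA).
  split; [exact P|]. apply (le_antisym HA); [|now apply le_mul_l].
  apply (meet_glb HA).
  - rewrite <- H2 at 3. apply mul_le; apply (meet_le_l HA).
  - rewrite <- H2' at 3. apply mul_le; apply (meet_le_r HA).
Qed.

Lemma closure_phin k e : closure e -> closure (phin k e).
Proof.
  intros [H1 H2]; split; [now apply phin_ge1 | now rewrite <- phin_mul, H2].
Qed.

Fixpoint meet_orbit k x : A :=
  match k with O => x | S k => meet_orbit k x ⊓ phin (S k) x end.

Fixpoint join_orbit k x : A :=
  match k with O => x | S k => join_orbit k x ⊔ phin (S k) x end.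

Lemma meet_orbit_le k i x : (i <= k)%nat -> meet_orbit k x <= phin i x.
Proof.
  induction k as [|k IH]; intros H; simpl meet_orbit.
  - replace i with O by lia. apply (le_refl HA).
  - destruct (Nat.eq_dec i (S k)) as [->|N].
    + apply (meet_le_r HA).
    + apply le_meet_trans_l, IH; lia.
Qed.

Lemma le_meet_orbit k x y :
  (forall i, (i <= k)%nat -> y <= phin i x) -> y <= meet_orbit k x.
Proof.
  induction k as [|k IH]; intros H; simpl meet_orbit.
  - exact (H O (le_n _)).
  - apply (meet_glb HA); [apply IH; intros; apply H; lia | now apply (H (S k))].
Qed.

Lemma le_join_orbit k i x : (i <= k)%nat -> phin i x <= join_orbit k x.
Proof.
  induction k as [|k IH]; intros H; simpl join_orbit.
  - replace i with O by lia. apply (le_refl HA).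
  - destruct (Nat.eq_dec i (S k)) as [->|N].
    + apply (le_join_r HA).
    + apply le_join_trans_l, IH; lia.
Qed.

Lemma join_orbit_le k x y :
  (forall i, (i <= k)%nat -> phin i x <= y) -> join_orbit k x <= y.
Proof.
  induction k as [|k IH]; intros H; simpl join_orbit.
  - exact (H O (le_n _)).
  - apply (join_lub HA); [apply IH; intros; apply H; lia | now apply (H (S k))].
Qed.

Lemma phin_invertible k g : invertible g -> phin k g = g.
Proof.
  intros H; induction k as [|k IH]; [reflexivity|].
  simpl; rewrite IH. now apply invertible_phi.
Qed.

(** The orbit members disjoint from [x] are multiplied into one [z], still disjoint from [x]. The
    join then lies below [w * z], and [z] cancels against [x]. *)
Lemma le_of_le_join_orbit k x y w :
  1 <= x -> 1 <= y -> 1 <= w -> x <= join_orbit k y ->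
  (forall i, (i <= k)%nat -> phin i y <= w \/ disjoint x (phin i y)) -> x <= w.
Proof.
  intros Hx Hy Hw H C.
  assert (P : exists z, 1 <= z /\ disjoint x z /\ join_orbit k y <= w * z).
  { clear H; induction k as [|k IH].
    - simpl. destruct (C O (le_n _)) as [L|L].
      + exists 1; repeat split; [apply (le_refl HA) | | now rewrite (mul_one_r HA)].
        unfold disjoint. now rewrite (meet_comm HA).
      + exists y; repeat split; auto. now apply le_mul_l.
    - destruct IH as (z & Hz & D & L); [intros; apply C; lia|].
      simpl join_orbit. destruct (C (S k) (le_n _)) as [L'|L'].
      + exists z; repeat split; auto. apply (join_lub HA); [exact L|].
        apply (le_trans HA) with w; [exact L' | now apply le_mul_r].
      + pose proof (phin_ge1 (S k) Hy) as Hy'.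
        exists (z * phin (S k) y); repeat split.
        * apply (le_trans HA) with z; [exact Hz | now apply le_mul_r].
        * now apply disjoint_mul.
        * rewrite (mul_assoc HA). apply (join_lub HA).
          -- apply (le_trans HA) with (w * z); [exact L | now apply le_mul_r].
          -- apply le_mul_l.
             apply (le_trans HA) with w; [exact Hw | now apply le_mul_r]. }
  destruct P as (z & Hz & D & L).
  apply le_of_mul_disjoint with z; auto. now apply (le_trans HA) with (join_orbit k y).
Qed.

End Order.

Arguments phi {A} x.

Notation phin k := (Nat.iter k phi).

(** * Periodic l-pregroups with totally ordered skeleton *)

Section Periodic.

Variables (A : algebra) (HA : is_lpregroup A) (n : nat).
Hypotheses (n_pos : (0 < n)%nat) (Hper : periodic n A).
Implicit Types x y z a b e g h : A.
Local Open Scope alg_scope.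

Lemma phin_period x : phin n x = x.
Proof. rewrite (phin_linv2 n x), (Hper x). apply (iter_rinvK HA). Qed.

Lemma phin_mul_period k x : phin (k * n) x = x.
Proof.
  induction k as [|k IH]; [reflexivity|].
  simpl Nat.mul. now rewrite phin_add, IH, phin_period.
Qed.

(** The descending chain [x, phi x, phi (phi x), ...] returns to [x] after [n] steps, so it is
    constant. *)
Lemma invertible_of_phi_le x : phi x <= x -> invertible x.
Proof.
  intros H; apply (invertible_phi HA), (le_antisym HA); [exact H|].
  assert (P : forall k, phin k x <= x).
  { induction k as [|k IH]; [apply (le_refl HA)|].
    apply (le_trans HA) with (phi x); [|exact H].
    exact (phin_le HA 1 IH). }
  rewrite <- (phin_period x) at 1.
  destruct n as [|k]; [lia|]. exact (phin_le HA 1 (P k)).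
Qed.

Lemma invertible_of_le_phi x : x <= phi x -> invertible x.
Proof.
  intros H; apply (invertible_phi HA), (le_antisym HA); [|exact H].
  assert (P : forall k, x <= phin k x).
  { induction k as [|k IH]; [apply (le_refl HA)|].
    apply (le_trans HA) with (phi x); [exact H|].
    exact (phin_le HA 1 IH). }
  rewrite <- (phin_period x) at 2.
  destruct n as [|k]; [lia|]. exact (phin_le HA 1 (P k)).
Qed.

(** The greatest invertible element below [x] and the least one above it: an interior and a closure
    operator onto the skeleton. *)
Definition sigma x := meet_orbit n x.
Definition tau x := join_orbit n x.

Lemma phin_pred_period i x :
  (i <= n)%nat -> exists j, (j <= n)%nat /\ phin i x = phi (phin j x).
Proof.
  intros H; destruct i as [|j].
  - exists (n - 1)%nat; split; [lia|].
    change (phi (phin (n - 1) x)) with (phin (S (n - 1)) x).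
    replace (S (n - 1)) with n by lia. now rewrite phin_period.
  - exists j; split; [lia | reflexivity].
Qed.

Lemma sigma_invertible x : invertible (sigma x).
Proof.
  apply invertible_of_phi_le, (le_meet_orbit HA); intros i Hi.
  destruct (phin_pred_period x Hi) as (j & Hj & ->).
  apply (phin_le HA 1), (meet_orbit_le HA), Hj.
Qed.

Lemma tau_invertible x : invertible (tau x).
Proof.
  apply invertible_of_le_phi, (join_orbit_le HA); intros i Hi.
  destruct (phin_pred_period x Hi) as (j & Hj & ->).
  apply (phin_le HA 1), (le_join_orbit HA), Hj.
Qed.

Lemma sigma_le x : sigma x <= x.
Proof. exact (meet_orbit_le HA (i := 0) x (Nat.le_0_l n)). Qed.

Lemma le_tau x : x <= tau x.
Proof. exact (le_join_orbit HA (i := 0) x (Nat.le_0_l n)). Qed.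

Lemma le_sigma g x : invertible g -> g <= x -> g <= sigma x.
Proof.
  intros Hg H; apply (le_meet_orbit HA); intros i _.
  rewrite <- (phin_invertible HA i Hg). now apply (phin_le HA).
Qed.

Lemma tau_le g x : invertible g -> x <= g -> tau x <= g.
Proof.
  intros Hg H; apply (join_orbit_le HA); intros i _.
  rewrite <- (phin_invertible HA i Hg). now apply (phin_le HA).
Qed.

(** [sigma e * sigma e] is invertible and below [e * e = e], hence below [sigma e]; cancelling in
    the group leaves [sigma e <= 1]. *)
Lemma closure_invertible_le e g : closure e -> invertible g -> g <= e -> g <= 1.
Proof.
  intros [H1 H2] Hg H. pose proof (sigma_invertible e) as Hs.
  apply (le_trans HA) with (sigma e); [now apply le_sigma|].
  assert (L : sigma e * sigma e <= sigma e).
  { apply le_sigma; [now apply (invertible_mul HA)|].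
    rewrite <- H2 at 3. apply (mul_le HA); apply sigma_le. }
  apply (le_invertible_l HA) in L; [|exact Hs].
  now rewrite (Vmul HA Hs) in L.
Qed.

(** If [v * linv v] were 1, then [v <= phi v], so [v] would be invertible; but invertible elements
    below a closure are at most 1. *)
Lemma closure_below e v :
  closure e -> 1 <= v -> v <= e -> v <> 1 ->
  closure (v * linv v) /\ v * linv v <> 1 /\ v * linv v <= v.
Proof.
  intros He Hv Hve N. destruct (closure_mul_linv HA Hv) as [C L].
  split; [exact C | split; [|exact L]]. intros E; apply N.
  apply (le_antisym HA); [|exact Hv].
  apply closure_invertible_le with e; auto.
  apply invertible_of_le_phi. unfold phi.
  apply (le_trans HA) with (v * (linv v * linv (linv v))).
  - apply (le_mul_r HA), (linv_expand HA).
  - rewrite (mul_assoc HA), E, (mul_one_l HA). apply (le_refl HA).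
Qed.

(** * Existence of atoms above 1 *)

Section TotalSkeleton.

Hypothesis Htot : forall g h, invertible g -> invertible h -> g <= h \/ h <= g.

(* The meet with [1] may be replaced by its interior [sigma]; in the totally
   ordered skeleton [1 ⊓ K * s <= s] with [K > 1] forces [1 <= s]. *)
Lemma ge1_of_meet_mul g h :
  invertible h -> 1 <= h -> h <> 1 -> 1 ⊓ h * g <= g -> 1 <= g.
Proof.
  intros Hh H1 N H. pose proof (sigma_invertible g) as Hs.
  assert (Hhs : invertible (h * sigma g)) by now apply (invertible_mul HA).
  assert (L : 1 ⊓ h * sigma g <= sigma g).
  { apply le_sigma; [apply (invertible_meet HA); auto; apply (invertible_one HA)|].
    apply (le_trans HA) with (1 ⊓ h * g); [|exact H].
    apply (meet_mono HA); [apply (le_refl HA)|]. apply (mul_mono_r HA), sigma_le. }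
  destruct (Htot (invertible_one HA) Hhs) as [C|C].
  - apply (le_trans HA) with (sigma g); [|apply sigma_le].
    unfold le in C; now rewrite C in L.
  - exfalso; apply N, (le_antisym HA); [|exact H1].
    rewrite (meet_comm HA) in L. unfold le in C; rewrite C in L.
    rewrite <- (mul_one_r HA h), <- (mulV HA Hs), (mul_assoc HA).
    now apply (mul_mono_l HA).
Qed.

(** Multiplication by [linv f] on the right brings the hypothesis into the form of [ge1_of_meet_mul]
    for [linv f]. *)
Lemma le1_of_meet f h :
  invertible h -> 1 <= h -> h <> 1 -> f ⊓ h <= 1 -> f <= 1.
Proof.
  intros Hh H1 N H. apply (le1_of_linv HA), (ge1_of_meet_mul Hh H1 N).
  apply (le_trans HA) with ((f ⊓ h) * linv f).
  - rewrite (mul_meet_r HA). apply (meet_mono HA); [|apply (le_refl HA)].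
    apply (linv_expand HA).
  - now apply (mul_le_l HA).
Qed.

(* Here [rinv e] and [linv e] are interior operations with join [1], so that
   an inequality [x <= 1] can be checked on [rinv e * x] and on [linv e * x]. *)
Lemma closure_le_invertible e h :
  closure e -> disjoint e (phi e) -> invertible h -> 1 <= h -> h <> 1 -> e <= h.
Proof.
  intros [E1 E2] D Hh H1 N.
  set (d := rinv e). set (q := linv e).
  assert (d1 : d <= 1) by now apply (rinv_le1 HA).
  assert (q1 : q <= 1) by now apply (linv_le1 HA).
  assert (ed : e * d <= d).
  { apply (residual_r HA). unfold d; rewrite <- (rinv_mul HA), E2. apply (le_refl HA). }
  assert (de : d * e = e).
  { apply (le_antisym HA); [now apply (mul_le_l HA)|].
    apply (residual_r HA). rewrite E2. apply (le_refl HA). }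
  assert (eq : e * q = e).
  { apply (le_antisym HA); [now apply (mul_le_r HA)|].
    apply (residual_l HA). rewrite E2. apply (le_refl HA). }
  assert (qe : q * e <= q).
  { apply (le_trans HA) with (q * (e ⊓ phi e)).
    - rewrite (mul_meet_l HA). apply (meet_glb HA); [apply (le_refl HA)|].
      apply (le_trans HA) with 1; [apply (linv_contract HA) | apply (linv_expand HA)].
    - unfold disjoint in D; rewrite D, (mul_one_r HA). apply (le_refl HA). }
  assert (dq : d ⊔ q = 1).
  { unfold disjoint in D. apply (f_equal rinv) in D.
    rewrite (rinv_meet HA), (rinv_one HA) in D. unfold phi in D.
    now rewrite (linvK HA) in D. }
  assert (L1 : e ⊓ h * (d * h) <= h).
  { rewrite <- eq. eapply (le_trans HA); [apply (mul_cross HA)|].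
    apply (join_lub HA).
    - rewrite (mul_assoc HA). apply (mul_le_l HA).
      now apply (le_trans HA) with d.
    - now apply (mul_le_r HA). }
  assert (L2 : e ⊓ h * (q * h) <= h).
  { rewrite <- de, (mul_assoc HA). eapply (le_trans HA); [apply (mul_cross HA)|].
    apply (join_lub HA).
    - now apply (mul_le_l HA).
    - rewrite <- (mul_assoc HA). apply (mul_le_r HA).
      now apply (le_trans HA) with q. }
  (* By [le1_of_meet], the bound [x <= 1] already forces [linv h * e <= 1], that is [e <= h]. *)
  set (x := linv h * e ⊓ h).
  assert (S : forall c, c <= 1 -> e ⊓ h * (c * h) <= h -> c * x <= 1).
  { intros c Hc L. apply (le_trans HA) with (linv h * (e ⊓ h * (c * h))).
    - rewrite (mul_meet_l HA), (VmulK HA _ Hh). unfold x.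
      rewrite (mul_meet_l HA). apply (meet_mono HA); [|apply (le_refl HA)].
      now apply (mul_le_l HA).
    - apply (le_trans HA) with (linv h * h); [now apply (mul_mono_r HA)|].
      apply (linv_contract HA). }
  assert (X : x <= 1).
  { apply (le_trans HA) with ((d ⊔ q) * x).
    - rewrite dq, (mul_one_l HA). apply (le_refl HA).
    - rewrite (mul_join_r HA). apply (join_lub HA); now apply S. }
  apply (le1_of_meet Hh H1 N) in X.
  apply (le_invertible_l HA) in X; [|now apply (invertible_linv HA)].
  now rewrite (linv_linv HA Hh), (mul_one_r HA) in X.
Qed.

Definition atom e : Prop :=
  closure e /\ e <> 1 /\ forall v, 1 <= v -> v <= e -> v = 1 \/ v = e.

Definition proper_closure e : Prop := closure e /\ e <> 1.

Lemma exists_noninvertible_closure a :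
  ~ invertible a -> exists e, proper_closure e.
Proof.
  intros N. exists (a * linv a). split.
  - split; [apply (linv_expand HA)|]. apply (le_antisym HA).
    + rewrite <- (mul_assoc HA). apply (mul_mono_r HA).
      rewrite (mul_assoc HA). apply (mul_le_l HA), (linv_contract HA).
    + apply (le_mul_l HA), (linv_expand HA).
  - intros E; apply N, invertible_of_le_phi. unfold phi.
    apply (le_trans HA) with (a * (linv a * linv (linv a))).
    + apply (le_mul_r HA), (linv_expand HA).
    + rewrite (mul_assoc HA), E, (mul_one_l HA). apply (le_refl HA).
Qed.

Definition never_disjoint e j : Prop :=
  forall e', proper_closure e' -> e' <= e -> ~ disjoint e' (phin j e').

(** The indices are decided one after another by shrinking the closure. Both alternatives pass to
    smaller proper closures, so earlier decisions survive. *)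
Lemma exists_decided_closure e0 k :
  proper_closure e0 ->
  exists e, proper_closure e /\
    forall j, (j < k)%nat -> disjoint e (phin j e) \/ never_disjoint e j.
Proof.
  intros H0; induction k as [|k (e & He & IH)].
  - exists e0; split; [exact H0 | intros; lia].
  - destruct (classic (never_disjoint e k)) as [Y|Y].
    + exists e; split; [exact He|]; intros j Hj.
      destruct (Nat.eq_dec j k) as [->|]; [now right | apply IH; lia].
    + apply not_all_ex_not in Y as [e' Y].
      apply imply_to_and in Y as [He' Y]. apply imply_to_and in Y as [L Y].
      apply NNPP in Y. exists e'; split; [exact He'|]; intros j Hj.
      destruct (Nat.eq_dec j k) as [->|]; [now left|].
      destruct (IH j ltac:(lia)) as [D|D].
      * left. destruct He' as [[E1 _] _].
        apply (disjoint_le HA) with (phin j e);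
          [now apply (phin_ge1 HA) | now apply (phin_le HA) | | exact E1].
        assert (P : 1 <= phin j e) by (apply (phin_ge1 HA); now apply (le_trans HA) with e').
        apply (disjoint_sym HA), (disjoint_le HA) with e; auto.
        now apply (disjoint_sym HA).
      * right; intros e'' He'' L'; apply D; [exact He''|].
        now apply (le_trans HA) with e'.
Qed.

(** In the second alternative no partial meet of the orbit of [e] is 1. The full meet would then be
    a closure that is invertible and different from 1. *)
Lemma decided_disjoint_phi e :
  proper_closure e ->
  (disjoint e (phi e) \/ never_disjoint e 1) -> disjoint e (phi e).
Proof.
  intros He [D|N]; [exact D|exfalso].
  assert (P : forall k, proper_closure (meet_orbit k e)).
  { induction k as [|k [C IH]]; [exact He|].
    split; [apply (closure_meet HA C), (closure_phin HA (S k)), He|].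
    intros E. apply (N (meet_orbit k e)); [now split | apply (meet_orbit_le HA (i := 0)); lia |].
    apply (le_antisym HA).
    - rewrite <- E. apply (meet_mono HA); [apply (le_refl HA)|].
      apply (phin_le HA 1), (meet_orbit_le HA); lia.
    - apply (meet_glb HA); [apply C | apply (phin_ge1 HA 1), C]. }
  destruct (P n) as [C E]; apply E, (le_antisym HA); [|apply C].
  apply (closure_invertible_le C); [apply sigma_invertible | apply (le_refl HA)].
Qed.

(** Meeting with one translate after another never reaches 1: since [e1 <= e'], a meet equal to 1
    would make [e1] disjoint from [phin k e1]. *)
Lemma meet_never_disjoint e e' k :
  proper_closure e' -> e' <= e ->
  exists e1, proper_closure e1 /\ e1 <= e' /\
    forall i, (i < k)%nat -> never_disjoint e i -> e1 <= phin i e'.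
Proof.
  intros He' L; induction k as [|k (e1 & [C1 N1] & L1 & IH)].
  - exists e'; repeat split; try apply He'; [apply (le_refl HA) | intros; lia].
  - destruct (classic (never_disjoint e k)) as [Y|Y].
    + exists (e1 ⊓ phin k e'); repeat split.
      * apply (closure_meet HA); [exact C1 | apply (closure_phin HA), He'].
      * apply (closure_meet HA); [exact C1 | apply (closure_phin HA), He'].
      * intros E. apply (Y e1); [now split | now apply (le_trans HA) with e' |].
        apply (disjoint_le HA) with (phin k e');
          [apply (phin_ge1 HA), C1 | now apply (phin_le HA) | exact E | apply C1].
      * now apply (le_meet_trans_l HA).
      * intros i Hi Ni. destruct (Nat.eq_dec i k) as [->|].
        -- apply (meet_le_r HA).
        -- apply (le_meet_trans_l HA), IH; [lia | exact Ni].
    + exists e1; repeat split; auto; try apply C1. intros i Hi Ni.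
      destruct (Nat.eq_dec i k) as [->|]; [contradiction | apply IH; [lia | exact Ni]].
Qed.

(** A closure decided for all indices up to [n] is minimal. Given a proper closure [e'] below it,
    choose [e1] below all the relevant translates of [e']; then [e] is below [tau e1], and every
    orbit member of [e1] is either disjoint from [e] or below [e']. *)
Lemma exists_atom a : ~ invertible a -> exists e, atom e /\ disjoint e (phi e).
Proof.
  intros Na. destruct (exists_noninvertible_closure Na) as [e0 H0].
  destruct (exists_decided_closure (S n) H0) as (e & He & Dec).
  assert (D : disjoint e (phi e)).
  { apply decided_disjoint_phi; [exact He | apply (Dec 1%nat); lia]. }
  exists e; split; [|exact D]. destruct He as [C N].
  split; [exact C | split; [exact N|]].
  assert (Min : forall e', proper_closure e' -> e' <= e -> e <= e').
  { intros e' He' L.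
    destruct (meet_never_disjoint (S n) He' L) as (e1 & [C1 N1] & L1 & P).
    assert (T1 : 1 <= tau e1) by (apply (le_trans HA) with e1; [apply C1 | apply le_tau]).
    apply (le_of_le_join_orbit HA (k := n) (y := e1)); [apply C | apply C1 | apply He' | |].
    - apply closure_le_invertible; auto using tau_invertible.
      intros E; apply N1, (le_antisym HA); [|apply C1].
      rewrite <- E; apply le_tau.
    - intros i Hi. destruct (Dec i ltac:(lia)) as [Di|Di].
      + right. apply (disjoint_le HA) with (phin i e); auto; [| |apply C].
        * apply (phin_ge1 HA), C1.
        * apply (phin_le HA). now apply (le_trans HA) with e'.
      (* [phin (n - i)] inverts [phin i], so [e1 <= phin (n - i) e'] turns into [phin i e1 <= e'];
         disjointness at [n - i] would give disjointness at [i]. *)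
      + left. destruct (Dec (n - i)%nat ltac:(lia)) as [Dj|Dj].
        * exfalso; apply (Di e); [now split | apply (le_refl HA)|].
          unfold disjoint in *. apply (f_equal (phin i)) in Dj.
          rewrite (phin_meet HA), (phin_one HA), <- phin_add in Dj.
          replace (i + (n - i))%nat with n in Dj by lia.
          rewrite phin_period in Dj. now rewrite (meet_comm HA).
        * assert (E : phin i (phin (n - i) e') = e').
          { rewrite <- phin_add. replace (i + (n - i))%nat with n by lia.
            apply phin_period. }
          rewrite <- E. apply (phin_le HA), P; [lia | exact Dj]. }
  intros v H1 Hv. destruct (classic (v = 1)) as [|Nv]; [now left | right].
  destruct (closure_below C H1 Hv Nv) as (Cv & Nv' & Lv).
  apply (le_antisym HA); [exact Hv|].
  apply (le_trans HA) with (v * linv v); [|exact Lv].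
  apply Min; [now split | now apply (le_trans HA) with v].
Qed.

End TotalSkeleton.

End Periodic.

(** * Products of atoms, and points *)

Section Atoms.

Variables (A : algebra) (HA : is_lpregroup A) (n : nat).
Hypotheses (n_pos : (0 < n)%nat) (Hper : periodic n A).
Implicit Types x y z a b e g h : A.
Local Open Scope alg_scope.

Hypothesis Htot : forall g h, invertible g -> invertible h -> g <= h \/ h <= g.

Lemma closure_mul_rinv e : closure e -> e * rinv e = rinv e.
Proof.
  intros [E1 E2]; apply (le_antisym HA); [|now apply (le_mul_l HA)].
  apply (residual_r HA). rewrite <- (rinv_mul HA), E2. apply (le_refl HA).
Qed.

Lemma closure_rinv_mul e : closure e -> rinv e * e = e.
Proof.
  intros [E1 E2]; apply (le_antisym HA).
  - apply (mul_le_l HA). now apply (rinv_le1 HA).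
  - apply (residual_r HA). rewrite E2. apply (le_refl HA).
Qed.

Lemma atom_ge1 e : atom e -> 1 <= e.
Proof. intros [[H _] _]; exact H. Qed.

Lemma atom_phin k e : atom e -> atom (phin k e).
Proof.
  intros (C & N & M). split; [now apply (closure_phin HA)|split].
  - intros E; apply N, (phin_inj HA (k := k)). now rewrite (phin_one HA).
  - intros v H1 Hv. assert (K : (k * (n - 1) + k = k * n)%nat) by nia.
    (* By periodicity [phin (k * (n - 1))] is the inverse of [phin k]; it carries elements below
       [phin k e] to elements below [e]. *)
    assert (E : forall x, phin k (phin (k * (n - 1)) x) = x).
    { intros x; rewrite <- phin_add, Nat.add_comm, K. now apply (phin_mul_period HA). }
    destruct (M (phin (k * (n - 1)) v)) as [V|V].
    + now apply (phin_ge1 HA).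
    + apply (phin_le HA (k * (n - 1))) in Hv. rewrite <- phin_add, K in Hv.
      now rewrite (phin_mul_period HA Hper) in Hv.
    + left. now rewrite <- (E v), V, (phin_one HA).
    + right. now rewrite <- (E v), V.
Qed.

Lemma atom_conj g e : invertible g -> atom e -> atom (g * e * linv g).
Proof.
  intros Hg ([C1 C2] & N & M).
  assert (Mono : forall h x y, x <= y -> h * x * linv h <= h * y * linv h).
  { intros h x y H; now apply (mul_mono_l HA), (mul_mono_r HA). }
  assert (One : forall h, invertible h -> h * 1 * linv h = 1).
  { intros h Hh; rewrite (mul_one_r HA); now apply (mulV HA). }
  assert (K : forall x, g * (linv g * x * linv (linv g)) * linv g = x).
  { intros x; rewrite (linv_linv HA Hg), <- !(mul_assoc HA), (mulV HA Hg),
      (mul_one_r HA). now apply (mulVK HA). }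
  assert (K' : forall x, linv g * (g * x * linv g) * linv (linv g) = x).
  { intros x; rewrite (linv_linv HA Hg), <- !(mul_assoc HA), (Vmul HA Hg),
      (mul_one_r HA). now apply (VmulK HA). }
  assert (Hg' : invertible (linv g)) by now apply (invertible_linv HA).
  split; [split|split].
  - rewrite <- (One g Hg). now apply Mono.
  - rewrite <- !(mul_assoc HA), (VmulK HA _ Hg), (mul_assoc HA e e), C2. reflexivity.
  - intros E; apply N. rewrite <- (K' e), E. now apply One.
  - intros v H1 Hv. destruct (M (linv g * v * linv (linv g))) as [V|V].
    + rewrite <- (One (linv g) Hg'). now apply Mono.
    + rewrite <- (K' e). now apply Mono.
    + left. rewrite <- (K v), V. now apply One.
    + right. now rewrite <- (K v), V.
Qed.

Lemma atoms_disjoint x y : atom x -> atom y -> x = y \/ disjoint x y.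
Proof.
  intros (Cx & Nx & Mx) (Cy & Ny & My).
  assert (H1 : 1 <= x ⊓ y) by (apply (meet_glb HA); [apply Cx | apply Cy]).
  destruct (Mx _ H1 (meet_le_l HA x y)) as [E|E]; [now right|].
  destruct (My _ H1 (meet_le_r HA x y)) as [E'|E']; [now right|].
  left; congruence.
Qed.

Variable e : A.
Hypotheses (He : atom e) (De : disjoint e (phi e)).

(* In F_n(Z), the successor map. *)
Definition unit_shift : A := tau n e.
Notation u := unit_shift.

Lemma invertible_u : invertible u.
Proof. exact (tau_invertible HA n_pos Hper e). Qed.

Lemma e_le_u : e <= u.
Proof. exact (le_tau HA n e). Qed.

Lemma one_le_u : 1 <= u.
Proof. apply (le_trans HA) with e; [apply (atom_ge1 He) | apply e_le_u]. Qed.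

Lemma u_neq1 : u <> 1.
Proof.
  intros E; destruct He as (_ & N & _); apply N, (le_antisym HA); [|apply (atom_ge1 He)].
  rewrite <- E. apply e_le_u.
Qed.

Lemma u_le h : invertible h -> 1 <= h -> h <> 1 -> u <= h.
Proof.
  intros Hh H1 N. apply (tau_le HA); [exact Hh|].
  apply (closure_le_invertible HA n_pos Hper Htot); auto. apply He.
Qed.

Lemma phin_e_le_u i : phin i e <= u.
Proof.
  rewrite <- (phin_invertible HA i invertible_u). apply (phin_le HA), e_le_u.
Qed.

(** An atom outside the orbit of [e] is disjoint from all its members, hence cannot lie below their
    join. *)
Lemma atom_below_u x : atom x -> x <= u -> exists i, x = phin i e.
Proof.
  intros Hx H. apply NNPP; intros N. destruct Hx as (Cx & Nx & Mx).
  apply Nx, (le_antisym HA); [|apply Cx].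
  apply (le_of_le_join_orbit HA (k := n) (y := e));
    [apply Cx | apply (atom_ge1 He) | apply (le_refl HA) | exact H |].
  intros i _; right.
  destruct (@atoms_disjoint x (phin i e)) as [E|D]; auto.
  - repeat split; auto; apply Cx.
  - now apply atom_phin.
  - exfalso; apply N; now exists i.
Qed.

(** By residuation the claim is [x <= u * linv y]. Otherwise the atom [x] is disjoint from
    [u * linv y] and from [phi y], hence from their product, which lies above [u] and so above [x].
    In F_n(Z) the excluded product [phi y * y] moves a point up by two. *)
Lemma mul_atoms_le_u x y : atom x -> atom y -> x <= u -> y <= u ->
  x <> phi y -> x * y <= u.
Proof.
  intros Hx Hy Lx Ly N.
  assert (D : disjoint x (phi y)).
  { destruct (atoms_disjoint Hx (atom_phin 1 Hy)) as [E|D]; [contradiction | exact D]. }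
  pose proof invertible_u as Hu. pose proof (atom_ge1 Hx) as Hx1.
  assert (U1 : 1 <= u * linv y).
  { rewrite <- (mulV HA Hu). apply (mul_mono_r HA). now apply (linv_anti HA). }
  assert (L : x <= u * linv y).
  { destruct Hx as (Cx & Nx & Mx).
    destruct (Mx (x ⊓ u * linv y)) as [E|E];
      [now apply (meet_glb HA) | apply (meet_le_l HA) | exfalso | rewrite <- E; apply (meet_le_r HA)].
    apply Nx. apply (disjoint_self HA), (disjoint_le HA) with (u * linv y * phi y); auto.
    - apply (le_trans HA) with u; [exact Lx|].
      rewrite <- (mul_assoc HA). apply (le_mul_r HA), (linv_expand HA).
    - apply (disjoint_mul HA); auto. now apply (phin_ge1 HA 1), atom_ge1. }
  apply (le_trans HA) with (u * linv y * y); [now apply (mul_mono_l HA)|].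
  rewrite <- (mul_assoc HA). apply (mul_le_r HA), (linv_contract HA).
Qed.

Lemma mul_atoms x y : atom x -> atom y -> x <= u -> y <= u ->
  x <> phi y -> x * y = x ⊔ y.
Proof.
  intros Hx Hy Lx Ly N. pose proof (atom_ge1 Hx) as X1. pose proof (atom_ge1 Hy) as Y1.
  apply (le_antisym HA).
  - apply (le_of_le_join_orbit HA (k := n) (y := e)).
    + apply (le_trans HA) with x; [exact X1 | now apply (le_mul_r HA)].
    + apply (atom_ge1 He).
    + now apply (le_join_trans_l HA).
    + now apply mul_atoms_le_u.
    + intros i _. pose proof (atom_phin i He) as Hi.
      destruct (atoms_disjoint Hi Hx) as [->|Dx]; [left; apply (le_join_l HA)|].
      destruct (atoms_disjoint Hi Hy) as [->|Dy]; [left; apply (le_join_r HA)|].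
      right; apply (disjoint_sym HA), (disjoint_mul HA); auto. now apply atom_ge1.
  - apply (join_lub HA); [now apply (le_mul_r HA) | now apply (le_mul_l HA)].
Qed.

Lemma exists_period : exists m, (0 < m)%nat /\ phin m e = e /\
  forall k, (0 < k < m)%nat -> phin k e <> e.
Proof.
  assert (H : forall N, (exists m, (0 < m <= N)%nat /\ phin m e = e) ->
    exists m, (0 < m)%nat /\ phin m e = e /\ forall k, (0 < k < m)%nat -> phin k e <> e).
  { induction N as [|N IH]; intros (m & Hm & E); [lia|].
    destruct (classic (exists m, (0 < m <= N)%nat /\ phin m e = e)) as [Y|Y]; [auto|].
    exists m; repeat split; [lia | exact E |].
    intros k Hk Ek; apply Y; exists k; split; [lia | exact Ek]. }
  apply (H n). exists n; split; [lia | apply (phin_period HA Hper)].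
Qed.

(** In F_n(Z), if [e] moves the class of [r], then [phin i e] moves the class of [r + i]. Since
    [phin 1 e] acts first, a point of one of these classes is carried on by all later factors; in
    the opposite order it would move by one step only. *)
Fixpoint descending_product k : A :=
  match k with O => 1 | S k => phin (S k) e * descending_product k end.

Lemma descending_product_ge1 k : 1 <= descending_product k.
Proof.
  induction k as [|k IH]; simpl; [apply (le_refl HA)|].
  apply (le_trans HA) with (descending_product k); [exact IH|].
  apply (le_mul_l HA), (phin_ge1 HA (S k)), (atom_ge1 He).
Qed.

(** The bound [k < m] keeps [phin j e] different from [phi] of the outermost factor, so the two
    multiply to their join. Distributing the join and absorbing [phin j e] into the shorter product
    leaves the product itself. *)
Lemma phin_mul_descending m : (forall k, (0 < k < m)%nat -> phin k e <> e) ->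
  forall k j, (k < m)%nat -> (0 < j <= k)%nat ->
  phin j e * descending_product k = descending_product k.
Proof.
  intros Hm; induction k as [|k IH]; intros j Hk Hj; [lia|].
  destruct (Nat.eq_dec j (S k)) as [->|N].
  - cbn [descending_product]. rewrite (mul_assoc HA). f_equal.
    apply (closure_phin HA), He.
  - change (descending_product (S k)) with (phin (S k) e * descending_product k).
    rewrite (mul_assoc HA), (mul_atoms (x := phin j e)); auto using atom_phin, phin_e_le_u.
    + rewrite (mul_join_r HA), IH by lia. apply (le_join_eq HA), (le_mul_l HA).
      apply (phin_ge1 HA (S k)), (atom_ge1 He).
    + intros E. apply (Hm (S (S k) - j)%nat); [lia|].
      change (phi (phin (S k) e)) with (phin (S (S k)) e) in E.
      replace (S (S k)) with (j + (S (S k) - j))%nat in E by lia.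
      rewrite phin_add in E. symmetry; now apply (phin_inj HA (k := j)).
Qed.

(* In F_n(Z) the atom [e] moves the points of one residue class modulo its
   period up by one, and [p] is the closure onto that class. *)
Lemma exists_point : exists p, closure p /\ e * p = u * p /\
  forall c, invertible c -> c * e = e * c -> c * p = p * c.
Proof.
  destruct exists_period as (m & m_pos & Em & Hm).
  set (p := descending_product (m - 1)).
  pose proof (phin_mul_descending Hm) as Abs.
  exists p; split; [split|split].
  - apply descending_product_ge1.
  - assert (P : forall k, (k <= m - 1)%nat -> descending_product k * p = p).
    { induction k as [|k IH]; intros Hk; [apply (mul_one_l HA)|].
      cbn [descending_product]. rewrite <- (mul_assoc HA), IH by lia.
      apply Abs; lia. }
    apply P; lia.
  (* As [u] is the join of the orbit, each member is tested separately: an index nonzero modulo [m]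
     is absorbed by [p], and an index divisible by [m] gives [e]. *)
  - apply (le_antisym HA); [apply (mul_mono_l HA), e_le_u|].
    apply (residual_l HA), (join_orbit_le HA); intros i _. apply (residual_l HA).
    assert (E : phin i e = phin (i mod m) e).
    { transitivity (phin (i mod m + i / m * m) e).
      { f_equal. pose proof (Nat.div_mod_eq i m). lia. }
      rewrite phin_add. f_equal.
      induction (i / m)%nat as [|k IH]; [reflexivity|].
      cbn [Nat.mul]. now rewrite phin_add, IH. }
    rewrite E. pose proof (Nat.mod_upper_bound i m ltac:(lia)) as B.
    destruct (i mod m) as [|j]; [apply (le_refl HA)|].
    unfold p; rewrite Abs by lia. apply (le_mul_l HA), (atom_ge1 He).
  - intros c Hc Ec. unfold p; induction (m - 1)%nat as [|k IH].
    + simpl. now rewrite (mul_one_l HA), (mul_one_r HA).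
    + cbn [descending_product]. rewrite <- (mul_assoc HA), <- IH, !(mul_assoc HA).
      f_equal. apply (f_equal (phin (S k))) in Ec.
      now rewrite !(phin_mul HA), (phin_invertible HA (S k) Hc) in Ec.
Qed.

Variable p : A.
Hypotheses (Hp : closure p) (Hep : e * p = u * p).
Notation P := (rinv p).

Lemma point_le1 : P <= 1.
Proof. apply (rinv_le1 HA), Hp. Qed.

Lemma point_idem : P * P = P.
Proof. rewrite <- (rinv_mul HA). f_equal. apply Hp. Qed.

(** Applying [linv] to [P <= linv g * h] puts an invertible element below the closure [p], hence
    below 1. *)
Lemma mul_point_le g h : invertible g -> invertible h -> g * P <= h * P -> g <= h.
Proof.
  intros Hg Hh H. pose proof (invertible_linv HA Hg) as Hg'.
  apply (le_invertible_l HA) in H; [|exact Hg]. rewrite (mul_assoc HA) in H.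
  assert (L : linv (linv g * h) <= 1).
  { apply (closure_invertible_le HA n_pos Hper) with p; [exact Hp | |].
    - now apply (invertible_linv HA), (invertible_mul HA).
    - rewrite <- (rinvK HA p). apply (linv_anti HA).
      apply (le_trans HA) with (linv g * h * P); [exact H|].
      apply (mul_le_r HA), point_le1. }
  rewrite (linv_mul HA), (linv_linv HA Hg) in L.
  apply (le_invertible_l HA) in L; [|now apply (invertible_linv HA)].
  now rewrite (linv_linv HA Hh), (mul_one_r HA) in L.
Qed.

Lemma mul_point_inj g h : invertible g -> invertible h -> g * P = h * P -> g = h.
Proof.
  intros Hg Hh H; apply (le_antisym HA); apply mul_point_le; auto;
    apply (eq_le HA); auto.
Qed.

(* An element between [P] and [u * P] is one of the two ends, because [e] is an
   atom. *)
Lemma exists_value a : exists g, invertible g /\ a * P = g * P.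
Proof.
  pose proof invertible_u as Hu. pose proof point_le1 as P1.
  (* This is the greatest invertible [g] with [g * P <= a * P]: by [p * P = P] and [P * p = p], that
     inequality amounts to [g <= a * p]. *)
  set (g := sigma n (a * p)).
  assert (Hg : invertible g) by exact (sigma_invertible HA n_pos Hper _).
  exists g; split; [exact Hg|].
  assert (pP : p * P = P) by now apply closure_mul_rinv.
  assert (Pp : P * p = p) by now apply closure_rinv_mul.
  assert (Max : forall h, invertible h -> h * P <= a * P -> h <= g).
  { intros h Hh H. apply (le_sigma HA); [exact Hh|].
    apply (le_trans HA) with (h * p); [apply (le_mul_r HA), Hp|].
    rewrite <- Pp, !(mul_assoc HA). now apply (mul_mono_l HA). }
  set (x := linv g * (a * P)).
  assert (Px : P <= x).
  { apply (le_invertible_l HA); [exact Hg|]. rewrite <- pP at 2. rewrite (mul_assoc HA).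
    apply (mul_mono_l HA), (sigma_le HA). }
  assert (xP : x * P = x).
  { unfold x. rewrite <- !(mul_assoc HA), point_idem. reflexivity. }
  assert (gx : g * x = a * P) by now apply (mulVK HA).
  assert (eP : e * P = u * P).
  { rewrite <- pP, !(mul_assoc HA), Hep. reflexivity. }
  set (y := x ⊓ u * P).
  assert (Py : P <= y).
  { apply (meet_glb HA); [exact Px | apply (le_mul_l HA), one_le_u]. }
  assert (yP : y * P = y).
  { unfold y. rewrite (mul_meet_r HA), xP, <- (mul_assoc HA), point_idem. reflexivity. }
  (* [y ⊔ 1] lies between 1 and the atom [e]. If it were [e], then [u * P <= x], and [g * u] would
     contradict the maximality of [g]. *)
  assert (y1 : y <= 1).
  { destruct He as (_ & _ & M). destruct (M (y ⊔ 1)) as [E|E].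
    - apply (le_join_r HA).
    - apply (join_lub HA); [|apply (atom_ge1 He)].
      apply (le_meet_trans_r HA). rewrite <- eP. now apply (mul_le_r HA).
    - rewrite <- E. apply (le_join_l HA).
    - exfalso. apply u_neq1, (le_antisym HA); [|apply one_le_u].
      assert (L : u * P <= x).
      { rewrite <- eP, <- E, (mul_join_r HA), yP, (mul_one_l HA).
        apply (join_lub HA); [apply (meet_le_l HA) | exact Px]. }
      assert (L' : g * u <= g).
      { apply Max; [now apply (invertible_mul HA)|].
        rewrite <- gx, <- (mul_assoc HA). now apply (mul_mono_r HA). }
      apply (le_invertible_l HA) in L'; [|exact Hg]. now rewrite (Vmul HA Hg) in L'. }
  (* Removes the truncation of [x] at [u * P]: the bound on [y] yields
     [1 ⊓ u * (P * linv x) <= P * linv x]. *)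
  assert (L : 1 <= P * linv x).
  { apply (ge1_of_meet_mul HA n_pos Hper Htot Hu one_le_u u_neq1).
    apply (le_trans HA) with (y * linv x).
    - unfold y. rewrite (mul_meet_r HA), <- (mul_assoc HA).
      apply (meet_mono HA); [apply (linv_expand HA) | apply (le_refl HA)].
    - apply (mul_mono_l HA). rewrite <- yP. now apply (mul_le_l HA). }
  assert (x1 : x <= 1).
  { apply (le1_of_linv HA), (le_trans HA) with (P * linv x); [exact L|].
    now apply (mul_le_l HA). }
  rewrite <- gx. f_equal. apply (le_antisym HA); [|exact Px].
  rewrite <- xP. now apply (mul_le_l HA).
Qed.

End Atoms.

(** * Ordered abelian groups and integer-valued maps on finite parts *)

Declare Scope grp_scope.
Delimit Scope grp_scope with grp.

Record ordered_group : Type := {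
  elt :> Type;
  add : elt -> elt -> elt;
  zero : elt;
  opp : elt -> elt;
  pos : elt -> Prop;
  addA : forall x y z, add x (add y z) = add (add x y) z;
  addC : forall x y, add x y = add y x;
  add0 : forall x, add zero x = x;
  addN : forall x, add x (opp x) = zero;
  pos_add : forall x y, pos x -> pos y -> pos (add x y);
  pos_irrefl : ~ pos zero;
  pos_total : forall x, pos x \/ x = zero \/ pos (opp x)
}.

Arguments add {o} x y.
Arguments zero {o}.
Arguments opp {o} x.
Arguments pos {o} x.

Infix "+" := add : grp_scope.
Notation "- x" := (opp x) : grp_scope.
Notation "x - y" := (add x (opp y)) : grp_scope.
Notation "0" := zero : grp_scope.

Section Module.

Variable H : ordered_group.
Implicit Types x y z h c : H.
Local Open Scope grp_scope.

Definition zmul (k : Z) x : H :=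
  match k with
  | Z0 => 0
  | Zpos p => Pos.iter (add x) 0 p
  | Zneg p => - Pos.iter (add x) 0 p
  end.

Lemma add0r x : x + 0 = x.
Proof. rewrite addC; apply add0. Qed.

Lemma opp_unique x y : x + y = 0 -> y = - x.
Proof.
  intros E. rewrite <- (add0 (- x)), <- E, (addC x y), <- addA, addN. symmetry; apply add0r.
Qed.

Lemma oppK x : - - x = x.
Proof. symmetry; apply opp_unique. rewrite addC; apply addN. Qed.

Lemma opp_add x y : - (x + y) = - x + - y.
Proof.
  symmetry; apply opp_unique.
  rewrite (addC x y), addA, <- (addA y x), addN, add0r. apply addN.
Qed.

Lemma opp0 : - (0 : H) = 0.
Proof. symmetry; apply opp_unique, add0. Qed.

Lemma zmul0 x : zmul 0 x = 0.
Proof. reflexivity. Qed.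

Lemma zmul_succ k x : zmul (Z.succ k) x = x + zmul k x.
Proof.
  destruct k as [|p|p].
  - reflexivity.
  - replace (Z.succ (Zpos p)) with (Zpos (Pos.succ p)) by lia.
    apply Pos.iter_succ.
  - destruct (Pos.eq_dec p 1) as [->|N].
    + simpl. now rewrite add0r, addN.
    + destruct (Pos.succ_pred_or p) as [->|<-]; [contradiction|].
      replace (Z.succ (Zneg (Pos.succ (Pos.pred p)))) with (Zneg (Pos.pred p)) by lia.
      simpl. now rewrite Pos.iter_succ, opp_add, addA, addN, add0.
Qed.

Lemma zmul_pred k x : zmul (Z.pred k) x = zmul k x - x.
Proof.
  rewrite <- (Z.succ_pred k) at 2. rewrite zmul_succ.
  now rewrite (addC x), <- addA, addN, add0r.
Qed.

Lemma zmul_add k l x : zmul (k + l) x = zmul k x + zmul l x.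
Proof.
  induction k as [|k IH|k IH] using Z.peano_ind.
  - now rewrite Z.add_0_l, zmul0, add0.
  - now rewrite Z.add_succ_l, !zmul_succ, IH, addA.
  - now rewrite Z.add_pred_l, !zmul_pred, IH, <- addA, (addC (zmul l x)), addA.
Qed.

Lemma zmul_opp k x : zmul (- k) x = - zmul k x.
Proof.
  apply opp_unique. rewrite <- zmul_add, Z.add_opp_diag_r. apply zmul0.
Qed.

Lemma zmul_mul k l x : zmul (k * l) x = zmul k (zmul l x).
Proof.
  induction k as [|k IH|k IH] using Z.peano_ind.
  - reflexivity.
  - now rewrite Z.mul_succ_l, zmul_add, zmul_succ, IH, addC.
  - now rewrite Z.mul_pred_l, <- Z.add_opp_r, zmul_add, zmul_opp, zmul_pred, IH.
Qed.

Lemma zmul_add_r k x y : zmul k (x + y) = zmul k x + zmul k y.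
Proof.
  induction k as [|k IH|k IH] using Z.peano_ind.
  - now rewrite !zmul0, add0.
  - rewrite !zmul_succ, IH, !addA; f_equal. now rewrite <- !addA, (addC y).
  - rewrite !zmul_pred, IH, opp_add, !addA; f_equal. now rewrite <- !addA, (addC (- x)).
Qed.

Lemma zmul_zero k : zmul k 0 = 0.
Proof.
  induction k as [|k IH|k IH] using Z.peano_ind; [reflexivity|..].
  - now rewrite zmul_succ, IH, add0.
  - now rewrite zmul_pred, IH, addN.
Qed.

Lemma zmul_opp_r k x : zmul k (- x) = - zmul k x.
Proof. apply opp_unique. now rewrite <- zmul_add_r, addN, zmul_zero. Qed.

Lemma zmul1 x : zmul 1 x = x.
Proof. apply add0r. Qed.

(* The square-zero extension of Z by the Z-module [H]; the [ring] tactic for it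
   decides the linear identities of [H]. *)
Definition ext : Type := (Z * H)%type.
Definition ext_add (a b : ext) : ext := ((fst a + fst b)%Z, snd a + snd b).
Definition ext_mul (a b : ext) : ext :=
  ((fst a * fst b)%Z, zmul (fst a) (snd b) + zmul (fst b) (snd a)).
Definition ext_opp (a : ext) : ext := ((- fst a)%Z, - snd a).
Definition ext_cst (k : Z) : ext := (k, 0).
Definition ext_inj x : ext := (0%Z, x).

Lemma ext_ring : ring_theory (ext_cst 0) (ext_cst 1) ext_add ext_mul
  (fun a b => ext_add a (ext_opp b)) ext_opp eq.
Proof.
  split; intros; repeat match goal with a : ext |- _ => destruct a as [? ?] end;
    unfold ext_add, ext_mul, ext_opp, ext_cst; cbn [fst snd];
    apply injective_projections; cbn [fst snd]; try lia.
  - apply add0.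
  - apply addC.
  - apply addA.
  - now rewrite zmul1, zmul_zero, add0r.
  - apply addC.
  - rewrite !zmul_add_r, <- !zmul_mul, addA. f_equal; [f_equal|]; f_equal; lia.
  - rewrite zmul_add, zmul_add_r, !addA; f_equal. rewrite <- !addA; f_equal. apply addC.
  - reflexivity.
  - apply addN.
Qed.

Lemma ext_inj_eq x y : ext_inj x = ext_inj y -> x = y.
Proof. intros E; now inversion E. Qed.
Lemma ext_inj_add x y : ext_inj (x + y) = ext_add (ext_inj x) (ext_inj y).
Proof. reflexivity. Qed.
Lemma ext_inj_opp x : ext_inj (- x) = ext_opp (ext_inj x).
Proof. reflexivity. Qed.
Lemma ext_inj_zero : ext_inj 0 = ext_cst 0.
Proof. reflexivity. Qed.
Lemma ext_inj_zmul k x : ext_inj (zmul k x) = ext_mul (ext_cst k) (ext_inj x).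
Proof.
  unfold ext_inj, ext_mul, ext_cst; simpl. now rewrite Z.mul_0_r, add0r.
Qed.
Lemma ext_cst_add k l : ext_cst (k + l) = ext_add (ext_cst k) (ext_cst l).
Proof. unfold ext_add, ext_cst; simpl; now rewrite add0. Qed.
Lemma ext_cst_opp k : ext_cst (- k) = ext_opp (ext_cst k).
Proof. unfold ext_opp, ext_cst; simpl; now rewrite opp0. Qed.
Lemma ext_cst_sub k l : ext_cst (k - l) = ext_add (ext_cst k) (ext_opp (ext_cst l)).
Proof. unfold Z.sub; now rewrite ext_cst_add, ext_cst_opp. Qed.
Lemma ext_cst_m1 : ext_cst (-1) = ext_opp (ext_cst 1).
Proof. exact (ext_cst_opp 1). Qed.
Lemma ext_cst_mul k l : ext_cst (k * l) = ext_mul (ext_cst k) (ext_cst l).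
Proof.
  unfold ext_mul, ext_cst; simpl. f_equal.
  change (0 = zmul k (zmul 0 0) + zmul l (zmul 0 0)).
  rewrite <- !zmul_mul, !Z.mul_0_r, !zmul0. symmetry; apply add0.
Qed.

End Module.

Ltac module := apply ext_inj_eq;
  repeat rewrite ?ext_inj_add, ?ext_inj_opp, ?ext_inj_zero, ?ext_inj_zmul,
    ?ext_cst_add, ?ext_cst_sub, ?ext_cst_m1, ?ext_cst_opp, ?ext_cst_mul; ring.

(** * Integer combinations and positive functionals *)

Section Combinations.

Variable H : ordered_group.
Implicit Types x y z h c : H.
Local Open Scope grp_scope.

Add Ring ext_ring_combinations : (ext_ring H).

Lemma pos_asym x : pos x -> ~ pos (- x).
Proof. intros P N. apply (@pos_irrefl H). rewrite <- (addN x). now apply pos_add. Qed.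

Lemma pos_zmul k x : (0 < k)%Z -> pos x -> pos (zmul k x).
Proof.
  intros Hk Hx. replace k with (Z.succ (Z.of_nat (Z.to_nat (k - 1)))) by lia.
  induction (Z.to_nat (k - 1)) as [|m IH].
  - simpl Z.succ. now rewrite zmul1.
  - rewrite zmul_succ. apply pos_add; [exact Hx|].
    now replace (Z.of_nat (S m)) with (Z.succ (Z.of_nat m)) by lia.
Qed.

Lemma zmul_eq0 k x : zmul k x = 0 -> k = 0%Z \/ x = 0.
Proof.
  intros E. destruct (Z.eq_dec k 0) as [|N]; [now left | right].
  assert (Z : forall l y, (0 < l)%Z -> zmul l y = 0 -> ~ pos y).
  { intros l y Hl Ey Py. apply (@pos_irrefl H). rewrite <- Ey. now apply pos_zmul. }
  assert (Z' : forall l y, (l <> 0)%Z -> zmul l y = 0 -> ~ pos y).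
  { intros l y Hl Ey. destruct (Z_lt_le_dec 0 l); [now apply (Z l)|].
    apply (Z (- l)%Z); [lia|]. now rewrite zmul_opp, Ey, opp0. }
  destruct (pos_total x) as [P|[E'|P]]; [|exact E'|].
  - now apply (Z' k) in P.
  - apply (Z' k) in P; [contradiction | exact N |]. now rewrite zmul_opp_r, E, opp0.
Qed.

Fixpoint lincomb (m : list Z) (b : list H) : H :=
  match m, b with
  | a :: m, h :: b => zmul a h + lincomb m b
  | _, _ => 0
  end.

Fixpoint vadd (m m' : list Z) : list Z :=
  match m, m' with
  | a :: m, a' :: m' => (a + a')%Z :: vadd m m'
  | _, _ => nil
  end.

Definition vscale (k : Z) (m : list Z) : list Z := map (Z.mul k) m.

Lemma vadd_length m m' : length m = length m' -> length (vadd m m') = length m'.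
Proof.
  revert m'; induction m as [|a m IH]; intros [|a' m'] E; simpl in *; try lia.
  now rewrite IH by lia.
Qed.

Lemma vscale_length k m : length (vscale k m) = length m.
Proof. apply length_map. Qed.

Lemma lincomb_vadd m m' b : length m = length b -> length m' = length b ->
  lincomb (vadd m m') b = lincomb m b + lincomb m' b.
Proof.
  revert m m'; induction b as [|h b IH]; intros [|a m] [|a' m'] E E'; simpl in *;
    try discriminate.
  - now rewrite add0.
  - rewrite IH by lia. module.
Qed.

Lemma lincomb_vscale k m b : lincomb (vscale k m) b = zmul k (lincomb m b).
Proof.
  revert b; induction m as [|a m IH]; intros [|h b]; simpl; rewrite ?zmul_zero; auto.
  rewrite IH. module.
Qed.

Fixpoint dot (m s : list Z) : Z :=
  match m, s with
  | a :: m, x :: s => (a * x + dot m s)%Z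
  | _, _ => 0%Z
  end.

Lemma dot_vadd m m' (s : list Z) : length m = length s -> length m' = length s ->
  dot (vadd m m') s = (dot m s + dot m' s)%Z.
Proof.
  revert m m'; induction s as [|x z IH]; intros [|a m] [|a' m'] E E'; simpl in *;
    try discriminate; [reflexivity|].
  rewrite IH by lia. ring.
Qed.

Lemma dot_vscale k m (s : list Z) : dot (vscale k m) s = (k * dot m s)%Z.
Proof.
  revert s; induction m as [|a m IH]; intros [|x s]; simpl; try lia.
  rewrite IH. ring.
Qed.

Lemma dot_scale_r k m (s : list Z) : dot m (map (Z.mul k) s) = (k * dot m s)%Z.
Proof.
  revert s; induction m as [|a m IH]; intros [|x s]; simpl; try lia.
  rewrite IH. ring.
Qed.

End Combinations.

Open Scope Q_scope.

Lemma exists_above_below (l : Q) (us : list Q) :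
  (forall u, In u us -> l < u) -> exists t, l < t /\ forall u, In u us -> t < u.
Proof.
  induction us as [|v us IH]; intros Hu.
  - exists (l + 1); split; [lra | intros u []].
  - destruct IH as (t & Ht & Htu); [intros; apply Hu; now right|].
    pose proof (Hu v (or_introl eq_refl)) as Hv.
    destruct (Qlt_le_dec t v) as [L|L].
    + exists t; split; [exact Ht|]. intros u [<-|Hin]; auto.
    + exists ((l + v) / 2)%Q.
      assert (l < (l + v) / 2 /\ (l + v) / 2 < v).
      { split; [apply Qlt_shift_div_l | apply Qlt_shift_div_r]; lra. }
      split; [lra|]. intros u [<-|Hin]; [lra|]. specialize (Htu u Hin). lra.
Qed.

Lemma exists_between (ls us : list Q) :
  (forall l u, In l ls -> In u us -> l < u) ->
  exists t, (forall l, In l ls -> l < t) /\ (forall u, In u us -> t < u).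
Proof.
  induction ls as [|l ls IH]; intros Hlu.
  - assert (H : exists l, forall u, In u us -> l < u).
    { clear. induction us as [|v us (l & Hl)]; [exists 0; intros u []|].
      destruct (Qlt_le_dec l v) as [L|L].
      - exists l. intros u [<-|Hin]; auto.
      - exists (v - 1). intros u [<-|Hin]; [lra|]. specialize (Hl u Hin). lra. }
    destruct H as (l & Hl). destruct (exists_above_below Hl) as (t & _ & Ht).
    exists t; split; [intros l' []|exact Ht].
  - destruct IH as (t & Htl & Htu); [intros; apply Hlu; auto; now right|].
    destruct (Qlt_le_dec l t) as [L|L].
    + exists t; split; [|exact Htu]. intros l' [<-|Hin]; auto.
    + destruct (exists_above_below (l := l) (us := us)) as (t' & Ht' & Htu').
      { intros u Hu; apply Hlu; [now left | exact Hu]. }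
      exists t'; split; [|exact Htu'].
      intros l' [<-|Hin]; [exact Ht'|]. specialize (Htl l' Hin). lra.
Qed.

Close Scope Q_scope.
Open Scope Z_scope.

(** A pair with [a > 0] bounds [x / K] below by [- c / a], one with [a < 0] bounds it above by
    [c / (- a)]. The second hypothesis separates these bounds, and [K] is the denominator of a
    rational between them. *)
Lemma solve_one_variable (L : list (Z * Z)) :
  (forall a c, In (a, c) L -> a = 0 -> 0 < c) ->
  (forall a c a' c', In (a, c) L -> In (a', c') L -> 0 < a -> a' < 0 ->
     0 < a * c' - a' * c) ->
  exists x K, 0 < K /\ forall a c, In (a, c) L -> 0 < a * x + K * c.
Proof.
  intros H0 H1.
  destruct (@exists_between
    (flat_map (fun p => if 0 <? fst p then Qmake (- snd p) (Z.to_pos (fst p)) :: nil else nil)%list L)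
    (flat_map (fun p => if fst p <? 0 then Qmake (snd p) (Z.to_pos (- fst p)) :: nil else nil)%list L))
    as (t & Htl & Htu).
  - intros l u Hl Hu. apply in_flat_map in Hl as ([a c] & Hin & Hl), Hu as ([a' c'] & Hin' & Hu).
    simpl in *. destruct (Z.ltb_spec 0 a); [|destruct Hl].
    destruct (Z.ltb_spec a' 0); [|destruct Hu].
    destruct Hl as [<-|[]], Hu as [<-|[]]. specialize (H1 a c a' c' Hin Hin').
    unfold Qlt; simpl. rewrite !Z2Pos.id by lia. lia.
  - exists (Qnum t), (Zpos (Qden t)). split; [lia|]. intros a c Hin.
    destruct (Z.lt_trichotomy a 0) as [L'|[E|L']].
    + assert (T : (t < c # Z.to_pos (- a))%Q).
      { apply Htu, in_flat_map. exists (a, c); split; [exact Hin|]. simpl.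
        destruct (Z.ltb_spec a 0); [now left | lia]. }
      unfold Qlt in T; simpl in T. rewrite Z2Pos.id in T by lia. lia.
    + specialize (H0 a c Hin E). subst a. lia.
    + assert (T : ((- c) # Z.to_pos a < t)%Q).
      { apply Htl, in_flat_map. exists (a, c); split; [exact Hin|]. simpl.
        destruct (Z.ltb_spec 0 a); [now left | lia]. }
      unfold Qlt in T; simpl in T. rewrite Z2Pos.id in T by lia. lia.
Qed.

(* Fourier-Motzkin elimination. *)
Lemma exists_positive_functional (H : ordered_group) (b : list H) (L : list (list Z)) :
  (forall m, In m L -> length m = length b /\ pos (lincomb m b)) ->
  exists z, length z = length b /\ forall m, In m L -> 0 < dot m z.
Proof.
  revert L; induction b as [|h b IH]; intros L HL.
  - exists nil; split; [reflexivity|]. intros m Hm. exfalso.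
    destruct (HL m Hm) as [E P]. destruct m; [|discriminate]. now apply pos_irrefl in P.
  - set (combine v w := vadd (vscale (hd 0 v) (tl w)) (vscale (- hd 0 w) (tl v))).
    set (L' := flat_map (fun v => if hd 0 v =? 0 then tl v :: nil else
      if 0 <? hd 0 v then
        flat_map (fun w => if hd 0 w <? 0 then combine v w :: nil else nil) L
      else nil)%list L).
    assert (HL' : forall m, In m L' -> length m = length b /\ pos (lincomb m b)).
    { intros m Hm. apply in_flat_map in Hm as (v & Hv & Hm).
      destruct (HL v Hv) as [Ev Pv]. destruct v as [|a v]; [discriminate|].
      simpl in Ev, Pv, Hm. destruct (Z.eqb_spec a 0) as [->|Na].
      - destruct Hm as [<-|[]]. split; [lia|]. now rewrite zmul0, add0 in Pv.
      - destruct (Z.ltb_spec 0 a) as [Ha|]; [|destruct Hm].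
        apply in_flat_map in Hm as (w & Hw & Hm).
        destruct (HL w Hw) as [Ew Pw]. destruct w as [|a' w]; [discriminate|].
        simpl in Ew, Pw, Hm. destruct (Z.ltb_spec a' 0) as [Ha'|]; [|destruct Hm].
        destruct Hm as [<-|[]]. unfold combine; cbn [hd tl].
        rewrite vadd_length, lincomb_vadd, !lincomb_vscale; rewrite ?vscale_length; try lia.
        split; [lia|].
        apply (pos_zmul (k := - a')) in Pv; [|lia]. apply (pos_zmul (k := a)) in Pw; [|lia].
        pose proof (pos_add Pw Pv) as P. rewrite !zmul_add_r, <- !zmul_mul in P.
        replace (- a' * a) with (- (a * a')) in P by lia. rewrite zmul_opp in P.
        set (X := zmul (a * a') h) in P. set (Y := zmul a (lincomb w b)) in *.
        set (Z := zmul (- a') (lincomb v b)) in *.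
        assert (E : ((X + Y) + (- X + Z) = Y + Z)%grp).
        { now rewrite (addC X Y), addA, <- (addA Y X), addN, add0r. }
        now rewrite <- E. }
    destruct (IH L' HL') as (z & Ez & Hz).
    destruct (@solve_one_variable (map (fun v => (hd 0 v, dot (tl v) z)) L)) as (x & K & HK & Hx).
    + intros a c Hin Ea. apply in_map_iff in Hin as (v & Ev & Hv). injection Ev as <- <-.
      apply Hz, in_flat_map. exists v; split; [exact Hv|]. rewrite Ea. now left.
    + intros a c a' c' Hin Hin' Ha Ha'.
      apply in_map_iff in Hin as (v & Ev & Hv), Hin' as (w & Ew & Hw).
      injection Ev as <- <-. injection Ew as <- <-.
      assert (B : In (combine v w) L').
      { apply in_flat_map. exists v; split; [exact Hv|].
        destruct (Z.eqb_spec (hd 0 v) 0); [lia|]. destruct (Z.ltb_spec 0 (hd 0 v)); [|lia].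
        apply in_flat_map. exists w; split; [exact Hw|].
        destruct (Z.ltb_spec (hd 0 w) 0); [now left | lia]. }
      apply Hz in B. destruct (HL v Hv) as [E1 _], (HL w Hw) as [E2 _].
      destruct v as [|a v], w as [|a' w]; try discriminate. simpl in *.
      unfold combine in B; cbn [hd tl] in B.
      rewrite dot_vadd, !dot_vscale in B; rewrite ?vscale_length; lia.
    (* Scaling the values on the tail by [K] is what allows an integral value [x] on [h]. *)
    + exists (x :: map (Z.mul K) z). split; [simpl; now rewrite length_map, Ez|].
      intros m Hm. specialize (Hx (hd 0 m) (dot (tl m) z)
        (in_map (fun v => (hd 0 v, dot (tl v) z)) L m Hm)).
      destruct (HL m Hm) as [Em _]. destruct m as [|a m]; [discriminate|].
      simpl in *. rewrite dot_scale_r. exact Hx.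
Qed.

(** * Discrete ordered groups and their maps to Z *)

Section Discrete.

Variables (H : ordered_group) (u : H) (Z0 : H -> Prop) (n : Z).
Implicit Types (x y h c : H) (b S : list H).
Local Open Scope grp_scope.

Add Ring ext_ring_discrete : (ext_ring H).

(** [Z0] stands for the translations commuting with an action. The last clauses say that [H / Z0] is
    cyclic, generated by the class of [u], of order dividing [n]. *)
Record discrete_with : Prop := {
  step_pos : pos u;
  step_min : forall x, pos x -> x = u \/ pos (x - u);
  sub_zero : Z0 0;
  sub_add : forall x y, Z0 x -> Z0 y -> Z0 (x + y);
  sub_opp : forall x, Z0 x -> Z0 (- x);
  period_pos : (0 < n)%Z;
  sub_period : Z0 (zmul n u);
  sub_cofinite : forall x, exists k, Z0 (x - zmul k u)
}.

Hypothesis D : discrete_with.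

Lemma sub_zmul k x : Z0 x -> Z0 (zmul k x).
Proof.
  intros Hx; induction k as [|k IH|k IH] using Z.peano_ind.
  - apply (sub_zero D).
  - rewrite zmul_succ. now apply (sub_add D).
  - rewrite zmul_pred. apply (sub_add D); [exact IH | now apply (sub_opp D)].
Qed.

Lemma between_multiple k x :
  pos x -> pos (zmul k u - x) -> exists j, x = zmul j u.
Proof.
  intros Hx Hk. assert (K : (0 < k)%Z).
  { apply Z.nle_gt; intros L. pose proof (pos_add Hx Hk) as P.
    replace (x + (zmul k u - x)) with (zmul k u) in P by module.
    destruct (Z.eq_dec k 0) as [->|N]; [now apply pos_irrefl in P|].
    apply (pos_asym P). rewrite <- zmul_opp. apply pos_zmul; [lia | apply (step_pos D)]. }
  revert x Hx Hk; replace k with (Z.of_nat (Z.to_nat k)) by lia; clear K.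
  induction (Z.to_nat k) as [|i IH]; intros x Hx Hk.
  - exfalso. apply (pos_asym Hx). now replace (- x) with (zmul (Z.of_nat 0) u - x) by module.
  - destruct (step_min D Hx) as [->|P]; [exists 1%Z; now rewrite zmul1|].
    destruct (IH (x - u)) as [j Hj]; [exact P| |].
    + replace (Z.of_nat (Datatypes.S i)) with (Z.of_nat i + 1)%Z in Hk by lia.
      now replace (zmul (Z.of_nat i) u - (x - u)) with (zmul (Z.of_nat i + 1) u - x) by module.
    + exists (j + 1)%Z. rewrite zmul_add, <- Hj. module.
Qed.

(** The multiples of [u] form a convex subgroup by [between_multiple], so the quotient by them is
    torsion-free. *)
Lemma multiple_of_zmul g k c :
  (g <> 0)%Z -> zmul g c = zmul k u -> exists j, c = zmul j u.
Proof.
  assert (P : forall g k c, (0 < g)%Z -> pos c -> zmul g c = zmul k u ->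
    exists j, c = zmul j u).
  { intros g' k' c' Hg Hc E. destruct (Z.eq_dec g' 1) as [->|N].
    - exists k'. now rewrite <- E, zmul1.
    - apply (@between_multiple k'); [exact Hc|]. rewrite <- E.
      replace (zmul g' c' - c') with (zmul (g' - 1) c') by module.
      apply pos_zmul; [lia | exact Hc]. }
  assert (P' : forall g k c, (g <> 0)%Z -> pos c -> zmul g c = zmul k u ->
    exists j, c = zmul j u).
  { intros g' k' c' Hg Hc E. destruct (Z_lt_le_dec 0 g'); [now apply (P g' k')|].
    apply (P (- g')%Z (- k')%Z); [lia | exact Hc |]. now rewrite !zmul_opp, E. }
  intros Hg E. destruct (pos_total c) as [Hc|[->|Hc]].
  - now apply (P' g k).
  - exists 0%Z. now rewrite zmul0.
  - destruct (P' g (- k)%Z (- c)) as [j Hj]; auto.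
    + now rewrite zmul_opp_r, zmul_opp, E.
    + exists (- j)%Z. now rewrite zmul_opp, <- Hj, oppK.
Qed.

Inductive span S : H -> Prop :=
| span_step : span S u
| span_in x : In x S -> span S x
| span_zero : span S 0
| span_add x y : span S x -> span S y -> span S (x + y)
| span_opp x : span S x -> span S (- x).

Lemma span_zmul S k x : span S x -> span S (zmul k x).
Proof.
  intros Hx; induction k as [|k IH|k IH] using Z.peano_ind.
  - apply span_zero.
  - rewrite zmul_succ. now apply span_add.
  - rewrite zmul_pred. apply span_add; [exact IH | now apply span_opp].
Qed.

Lemma span_trans S S' x :
  span S x -> (forall y, In y S -> span S' y) -> span S' x.
Proof.
  intros Hx HS; induction Hx; auto using span_step, span_zero, span_add, span_opp.
Qed.

Lemma span_coords b x : span b x ->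
  exists k m, length m = length b /\ x = zmul k u + lincomb m b.
Proof.
  assert (Zero : forall b, exists m, length m = length b /\ lincomb m b = 0).
  { intros b'; induction b' as [|h b' (m & E & L)]; [now exists nil|].
    exists (0%Z :: m); simpl; split; [now rewrite E | rewrite L; module]. }
  intros Hx; induction Hx as [|x Hin| |x y _ (k & m & E & ->) _ (k' & m' & E' & ->)|x _ (k & m & E & ->)].
  - destruct (Zero b) as (m & E & L). exists 1%Z, m; split; [exact E | rewrite L; module].
  - enough (P : exists m, length m = length b /\ x = lincomb m b).
    { destruct P as (m & E & ->). exists 0%Z, m; split; [exact E | module]. }
    induction b as [|h b IH]; [destruct Hin|]. destruct Hin as [->|Hin].
    + destruct (Zero b) as (m & E & L). exists (1%Z :: m); simpl; split; [now rewrite E|].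
      rewrite L; module.
    + destruct (IH Hin) as (m & E & ->). exists (0%Z :: m); simpl; split; [now rewrite E | module].
  - destruct (Zero b) as (m & E & L). exists 0%Z, m; split; [exact E | rewrite L; module].
  - exists (k + k')%Z, (vadd m m'). split; [now rewrite vadd_length; lia|].
    rewrite lincomb_vadd by lia. module.
  - exists (- k)%Z, (vscale (- 1) m). split; [now rewrite vscale_length|].
    rewrite lincomb_vscale. module.
Qed.

(* Euclid's algorithm, performed by unimodular substitutions on the pairs
   formed by [c] and the entries of [b]. *)
Lemma collect_relation b m c m0 :
  length m = length b -> (m0 <> 0)%Z -> Z0 c -> Forall Z0 b ->
  exists c' g b', (g <> 0)%Z /\ length b' = length b /\ Z0 c' /\ Forall Z0 b' /\
    zmul g c' = zmul m0 c + lincomb m b /\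
    span (c' :: b') c /\ (forall y, In y b -> span (c' :: b') y).
Proof.
  revert m c m0; induction b as [|h b IH]; intros m c m0 E N Hc Hb.
  - exists c, m0, nil. destruct m; [|discriminate]. repeat split; auto.
    + simpl; now rewrite add0r.
    + apply span_in; now left.
    + intros y [].
  - destruct m as [|a m]; [discriminate|]. simpl in E.
    apply Forall_cons_iff in Hb as [Hh Hb].
    set (d := Z.gcd m0 a).
    assert (Nd : d <> 0%Z) by (intros Ed; apply Z.gcd_eq_0_l in Ed; contradiction).
    destruct (Z.gcd_divide_l m0 a) as [p Ep], (Z.gcd_divide_r m0 a) as [q Eq].
    destruct (Z.gcd_bezout m0 a d eq_refl) as (s & t & B).
    fold d in Ep, Eq. assert (B' : (s * p + t * q = 1)%Z) by nia. clearbody d.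
    destruct (IH m (zmul p c + zmul q h) d) as (c' & g & b' & Ng & Eb & Hc' & Hb' & Eg & Sc & Sb);
      try lia; auto.
    { apply (sub_add D); now apply sub_zmul. }
    (* The pair [c], [h] is replaced by [p c + q h] and [s h - t c], a substitution of determinant
       [s p + t q = 1]. The relation then has coefficient [d] on the first entry and none on the
       second. *)
    set (h' := zmul s h - zmul t c).
    assert (W : forall y, span (c' :: b') y -> span (c' :: h' :: b') y).
    { intros y Hy; apply (span_trans Hy). intros z [<-|Hz]; apply span_in; simpl; auto. }
    assert (Wh : span (c' :: h' :: b') h') by (apply span_in; simpl; auto).
    exists c', g, (h' :: b'). repeat split; auto.
    + simpl; now rewrite Eb.
    + constructor; [|exact Hb'].
      apply (sub_add D); [now apply sub_zmul | now apply (sub_opp D), sub_zmul].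
    + rewrite Eg. simpl. rewrite Ep, Eq. module.
    + replace c with (zmul s (zmul p c + zmul q h) - zmul q h').
      * apply span_add; [now apply span_zmul, W | now apply span_opp, span_zmul].
      * unfold h'. transitivity (zmul (s * p + t * q) c); [module | now rewrite B', zmul1].
    + intros y [<-|Hy]; [|now apply W, Sb].
      replace h with (zmul t (zmul p c + zmul q h) + zmul p h').
      * apply span_add; [now apply span_zmul, W | now apply span_zmul].
      * unfold h'. transitivity (zmul (s * p + t * q) h); [module | now rewrite B', zmul1].
Qed.

Definition independent b : Prop :=
  forall k m, length m = length b -> lincomb m b = zmul k u -> Forall (eq 0%Z) m.

Lemma eliminate_relation b m k :
  length m = length b -> ~ Forall (eq 0%Z) m -> Forall Z0 b ->
  lincomb m b = zmul k u ->
  exists b', Datatypes.S (length b') = length b /\ Forall Z0 b' /\ forall y, In y b -> span b' y.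
Proof.
  revert m; induction b as [|h b IH]; intros m E N Hb R.
  - destruct m; [|discriminate]. exfalso; apply N; constructor.
  - destruct m as [|a m]; [discriminate|]. simpl in E, R.
    apply Forall_cons_iff in Hb as [Hh Hb].
    destruct (Z.eq_dec a 0) as [->|Na].
    + assert (N' : ~ Forall (eq 0%Z) m) by (intros F; apply N; now constructor).
      assert (R' : lincomb m b = zmul k u) by (rewrite <- R; module).
      destruct (IH m ltac:(lia) N' Hb R') as (b' & Eb & Hb' & Sb).
      exists (h :: b').
      split; [simpl; now rewrite Eb | split; [now constructor|]].
      intros y [<-|Hy]; [apply span_in; now left|].
      apply (span_trans (Sb y Hy)). intros z Hz; apply span_in; now right.
    + destruct (collect_relation (b := b) (m := m) (c := h) (m0 := a) ltac:(lia) Na Hh Hb)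
        as (c' & g & b' & Ng & Eb & Hc' & Hb' & Eg & Sc & Sb).
      destruct (@multiple_of_zmul g k c' Ng) as [j Hj]; [now rewrite Eg|].
      assert (W : forall y, span (c' :: b') y -> span b' y).
      { intros y Hy; apply (span_trans Hy). intros z [<-|Hz]; [|now apply span_in].
        rewrite Hj. apply span_zmul, span_step. }
      exists b'; split; [simpl; now rewrite Eb | split; [exact Hb'|]].
      intros y [<-|Hy]; auto.
Qed.

Lemma exists_basis S : Forall Z0 S ->
  exists b, Forall Z0 b /\ independent b /\ forall y, In y S -> span b y.
Proof.
  remember (length S) as N eqn:EN. revert S EN.
  induction N as [N IH] using lt_wf_ind; intros S -> HS.
  destruct (classic (independent S)) as [I|I].
  - exists S; repeat split; auto. intros; now apply span_in.
  - apply not_all_ex_not in I as [k I]. apply not_all_ex_not in I as [m I].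
    apply imply_to_and in I as [Em I]. apply imply_to_and in I as [R I].
    destruct (eliminate_relation Em I HS R) as (S' & ES & HS' & SS).
    destruct (IH (length S') ltac:(lia) S' eq_refl HS') as (b & Hb & Ib & Sb).
    exists b; repeat split; auto. intros y Hy; now apply (span_trans (SS y Hy)).
Qed.

Lemma coords_unique b k m k' m' : independent b ->
  length m = length b -> length m' = length b ->
  zmul k u + lincomb m b = zmul k' u + lincomb m' b -> k = k' /\ m = m'.
Proof.
  intros I E E' R.
  assert (F : Forall (eq 0%Z) (vadd m (vscale (- 1) m'))).
  { apply (I (k' - k)%Z).
    - rewrite vadd_length; rewrite vscale_length; lia.
    - rewrite lincomb_vadd, lincomb_vscale by (rewrite ?vscale_length; lia).
      transitivity ((zmul k u + lincomb m b) - zmul k u - lincomb m' b); [module|].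
      rewrite R; module. }
  assert (Em : m = m').
  { clear R. assert (L : length m = length m') by lia. clear E E'.
    revert m' L F; induction m as [|a m IH]; intros [|a' m'] L F; try discriminate; auto.
    cbn [vadd vscale map] in F; simpl in L. apply Forall_cons_iff in F as [Fa F]. f_equal; [lia|].
    apply IH; [lia | exact F]. }
  split; [|exact Em]. subst m'.
  assert (Zk : zmul (k - k') u = 0).
  { transitivity ((zmul k u + lincomb m b) - lincomb m b - zmul k' u); [module|].
    rewrite R; module. }
  destruct (zmul_eq0 Zk) as [|Zu]; [lia|].
  exfalso. apply (@pos_irrefl H). rewrite <- Zu. apply (step_pos D).
Qed.

Record good (F : list H) (pi : H -> Z) : Prop := {
  good_step : pi u = 1%Z;
  good_add : forall x y, In x F -> In y F -> pi (x + y) = (pi x + pi y)%Z;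
  good_pos : forall x y, In x F -> In y F -> pos (y - x) -> (pi x < pi y)%Z;
  good_mod : forall x, In x F -> Z0 (x - zmul (pi x) u)
}.

(* On the free group spanned by [u] and a basis [b] independent modulo [u],
   send [u] to 1 and [b] to a very large multiple of a positive functional. *)
Lemma exists_good F : exists pi, good F pi.
Proof.
  destruct (choice _ (sub_cofinite D)) as [kappa Hkappa].
  destruct (@exists_basis (map (fun x => x - zmul (kappa x) u) F)) as (b & Hb & Ib & Sb).
  { apply Forall_forall; intros x Hx. apply in_map_iff in Hx as (y & <- & _). apply Hkappa. }
  assert (SF : forall x, In x F -> span b x).
  { intros x Hx. replace x with ((x - zmul (kappa x) u) + zmul (kappa x) u) by module.
    apply span_add; [|apply span_zmul, span_step].
    apply Sb, in_map_iff. now exists x. }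
  destruct (choice (fun x (km : Z * list Z) =>
     span b x -> length (snd km) = length b /\ x = zmul (fst km) u + lincomb (snd km) b))
    as [co Hco].
  { intros x. destruct (classic (span b x)) as [Sx|Nx].
    - destruct (span_coords Sx) as (k & m & Em & Ex). now exists (k, m).
    - exists (0%Z, nil); contradiction. }
  set (diffs := flat_map (fun x => map (fun y => y - x) F) F).
  assert (Sd : forall d, In d diffs -> span b d).
  { intros d Hd. apply in_flat_map in Hd as (x & Hx & Hd).
    apply in_map_iff in Hd as (y & <- & Hy). apply span_add; [auto | now apply span_opp, SF]. }
  set (L := map (fun d => snd (co d))
     (filter (fun d => if excluded_middle_informative (pos (lincomb (snd (co d)) b))
                       then true else false) diffs)).
  destruct (@exists_positive_functional H b L) as (s & Es & Hs).
  { intros m Hm. apply in_map_iff in Hm as (d & <- & Hd). apply filter_In in Hd as [Hd P].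
    split; [now apply Hco, Sd|]. now destruct (excluded_middle_informative _). }
  set (M := fold_right (fun d t => (Z.abs (fst (co d)) + t)%Z) 1%Z diffs).
  assert (HM : forall d, In d diffs -> (Z.abs (fst (co d)) < M)%Z /\ (0 < M)%Z).
  { unfold M. generalize diffs. induction diffs0 as [|d ds IH]; intros d' Hd; [destruct Hd|].
    simpl. destruct Hd as [->|Hd].
    - assert (0 < fold_right (fun d t => Z.abs (fst (co d)) + t) 1 ds)%Z; [|lia].
      clear; induction ds; simpl; lia.
    - specialize (IH d' Hd). lia. }
  assert (Add : forall x y, span b x -> span b y ->
    co (x + y) = ((fst (co x) + fst (co y))%Z, vadd (snd (co x)) (snd (co y)))).
  { intros x y Sx Sy. destruct (Hco x Sx) as [Ex Rx], (Hco y Sy) as [Ey Ry].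
    destruct (Hco (x + y) (span_add Sx Sy)) as [Exy Rxy].
    destruct (@coords_unique b (fst (co (x + y))) (snd (co (x + y)))
      (fst (co x) + fst (co y))%Z (vadd (snd (co x)) (snd (co y)))) as [K V]; auto.
    - rewrite vadd_length; lia.
    - rewrite <- Rxy. rewrite lincomb_vadd by lia. rewrite Rx at 1. rewrite Ry at 1. module.
    - rewrite (surjective_pairing (co (x + y))). now rewrite K, V. }
  (* [M] exceeds the [u]-coordinate of every difference, so the functional decides the sign whenever
     it is positive. The factor [n] keeps [x - pi x u] in [Z0], where the basis already lies. *)
  set (pi x := (fst (co x) + n * M * dot (snd (co x)) s)%Z).
  assert (PiAdd : forall x y, span b x -> span b y -> pi (x + y) = (pi x + pi y)%Z).
  { intros x y Sx Sy. unfold pi. rewrite (Add x y Sx Sy). cbn [fst snd].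
    destruct (Hco x Sx) as [Ex _], (Hco y Sy) as [Ey _]. rewrite dot_vadd by lia. ring. }
  exists pi; split.
  - destruct (Hco u (span_step b)) as [Eu Ru].
    destruct (@coords_unique b 1%Z (vscale 0 (snd (co u))) (fst (co u)) (snd (co u))) as [K V]; auto.
    + now rewrite vscale_length.
    + rewrite <- Ru, lincomb_vscale. module.
    + unfold pi. rewrite <- K, <- V, dot_vscale. lia.
  - intros x y Hx Hy; auto.
  - intros x y Hx Hy P.
    assert (Hd : In (y - x) diffs).
    { apply in_flat_map. exists x; split; [exact Hx|]. apply in_map_iff. now exists y. }
    assert (E : pi y = (pi (y - x)%grp + pi x)%Z).
    { rewrite <- PiAdd by auto. f_equal. module. }
    enough (0 < pi (y - x)%grp)%Z by lia. clear E. set (d := y - x) in *. unfold pi.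
    destruct (Hco d (Sd d Hd)) as [Ed Rd]. destruct (HM d Hd) as [Md M0].
    pose proof (period_pos D) as n0.
    destruct (pos_total (lincomb (snd (co d)) b)) as [Q|[Q|Q]].
    + assert (P1 : (0 < dot (snd (co d)) s)%Z); [|set (t := dot (snd (co d)) s) in *;
        assert (M * 1 <= M * (n * t))%Z by (apply Z.mul_le_mono_nonneg_l; nia); lia]. apply Hs, in_map_iff.
      exists d; split; [reflexivity|]. apply filter_In; split; [exact Hd|].
      now destruct (excluded_middle_informative _).
    + assert (V : snd (co d) = vscale 0 (snd (co d))).
      { apply (@coords_unique b 0%Z (snd (co d)) 0%Z (vscale 0 (snd (co d)))); auto.
        - now rewrite vscale_length.
        - rewrite lincomb_vscale, Q. module. }
      rewrite V, dot_vscale. rewrite Q, add0r in Rd.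
      enough (0 < fst (co d))%Z by lia. apply Z.nle_gt; intros C. rewrite Rd in P.
      destruct (Z.eq_dec (fst (co d)) 0) as [C0|C0].
      * rewrite C0 in P. now apply pos_irrefl in P.
      * apply (pos_asym P). rewrite <- zmul_opp. apply pos_zmul; [lia | apply (step_pos D)].
    (* Here [- l] lies strictly between 0 and a multiple of [u], so it is a multiple of [u] itself;
       independence then makes all coordinates vanish. *)
    + exfalso. set (l := lincomb (snd (co d)) b) in *.
      destruct (@between_multiple (fst (co d)) (- l)) as [j Hj]; [exact Q| |].
      { rewrite oppK, <- Rd. exact P. }
      assert (Fz : Forall (eq 0%Z) (snd (co d))).
      { apply (Ib (- j)%Z); [exact Ed|]. rewrite zmul_opp, <- Hj. symmetry; apply oppK. }
      apply (@pos_irrefl H). replace (0 : H) with (- l); [exact Q|].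
      rewrite <- opp0. f_equal. unfold l. clear - Fz.
      revert b; induction Fz as [|a m <- Fz IH]; intros [|h b]; simpl; auto.
      now rewrite IH, add0.
  - intros x Hx. destruct (Hco x (SF x Hx)) as [Ex Rx]. rewrite Rx at 1.
    replace (zmul (fst (co x)) u + lincomb (snd (co x)) b - zmul (pi x) u)
      with (lincomb (snd (co x)) b + zmul (- (M * dot (snd (co x)) s)) (zmul n u)).
    + apply (sub_add D); [|apply sub_zmul, (sub_period D)].
      clear - D Hb. generalize (snd (co x)) as m. induction Hb as [|h b Hh Hb IH]; intros [|a m];
        simpl; try apply (sub_zero D). apply (sub_add D); [now apply sub_zmul | apply IH].
    + unfold pi. module.
Qed.

End Discrete.

(** * Transfer of equations to F_n(Z) *)

Section Transfer.

Definition fapp (n : nat) (g : FnZ n) : Z -> Z := proj1_sig (proj1_sig g).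

Lemma fapp_linv n (g : FnZ n) p q : fapp (linv g) p <= q <-> p <= fapp g q.
Proof. exact (FZ_linv_galois (proj2_sig (proj1_sig g)) p q). Qed.

Lemma fapp_rinv n (g : FnZ n) p q : q <= fapp (rinv g) p <-> fapp g q <= p.
Proof. exact (FZ_rinv_galois (proj2_sig (proj1_sig g)) p q). Qed.

Lemma fapp_inj n (g h : FnZ n) : (forall x, fapp g x = fapp h x) -> g = h.
Proof.
  intros E. destruct g as [g Pg], h as [h Ph]. apply subset_eq_compat, FZ_ext, E.
Qed.

Lemma exists_FnZ (n : nat) (f : Z -> Z) : (0 < n)%nat ->
  (forall m, f m <= f (m + 1)) ->
  (forall m, f (m + Z.of_nat n) = f m + Z.of_nat n) ->
  exists g : FnZ n, forall m, fapp g m = f m.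
Proof.
  intros n_pos Hm Hn.
  assert (mono : forall k : nat, forall x, f x <= f (x + Z.of_nat k)).
  { induction k as [|k IH]; intros x; [rewrite Z.add_0_r; lia|].
    specialize (IH x). specialize (Hm (x + Z.of_nat k)).
    replace (x + Z.of_nat (S k)) with (x + Z.of_nat k + 1) by lia. lia. }
  assert (mono' : forall x y, x <= y -> f x <= f y).
  { intros x y L. specialize (mono (Z.to_nat (y - x)) x).
    now replace (x + Z.of_nat (Z.to_nat (y - x))) with y in mono by lia. }
  assert (trans : forall k : nat, f (Z.of_nat k * Z.of_nat n) = f 0 + Z.of_nat k * Z.of_nat n).
  { induction k as [|k IH]; [now rewrite Z.add_0_r|].
    replace (Z.of_nat (S k) * Z.of_nat n) with (Z.of_nat k * Z.of_nat n + Z.of_nat n) by lia.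
    rewrite Hn, IH. lia. }
  assert (trans' : forall k : nat, f (- (Z.of_nat k * Z.of_nat n)) = f 0 - Z.of_nat k * Z.of_nat n).
  { induction k as [|k IH]; [simpl; lia|].
    specialize (Hn (- (Z.of_nat (S k) * Z.of_nat n))).
    replace (- (Z.of_nat (S k) * Z.of_nat n) + Z.of_nat n)
      with (- (Z.of_nat k * Z.of_nat n)) in Hn by lia. lia. }
  assert (Hf : inFZ f).
  { apply inFZ_intro; [exact mono' | |]; intros y.
    - exists (Z.of_nat (Z.to_nat (y - f 0)) * Z.of_nat n). rewrite trans. nia.
    - exists (- (Z.of_nat (Z.to_nat (f 0 - y)) * Z.of_nat n)). rewrite trans'. nia. }
  assert (P : periodic_elt n (exist inFZ f Hf : FZ)) by now apply FnZ_translation.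
  now exists (exist _ (exist inFZ f Hf : FZ) P).
Qed.

Variables (H : ordered_group) (u : H) (Z0 : H -> Prop) (n : nat).
Hypothesis D : discrete_with u Z0 (Z.of_nat n).
Variables (A : algebra) (rho : A -> H -> H).
Implicit Types (x y z c : H) (a : A).
Local Open Scope grp_scope.

Add Ring ext_ring_transfer : (ext_ring H).

Definition ole x y : Prop := x = y \/ pos (y - x).

(** The model is F_n(Z) acting on the chain Z, with the multiples of [n] as [Z0]. The two inverses
    enter only through their adjunctions. *)
Record faithful_action : Prop := {
  act_mono : forall a x y, ole x y -> ole (rho a x) (rho a y);
  act_one : forall x, rho one x = x;
  act_mul : forall a a' x, rho (mul a a') x = rho a (rho a' x);
  act_meet : forall a a' x,
    (rho (meet a a') x = rho a x /\ ole (rho a x) (rho a' x)) \/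
    (rho (meet a a') x = rho a' x /\ ole (rho a' x) (rho a x));
  act_join : forall a a' x,
    (rho (join a a') x = rho a' x /\ ole (rho a x) (rho a' x)) \/
    (rho (join a a') x = rho a x /\ ole (rho a' x) (rho a x));
  act_linv : forall a x y, ole (rho (linv a) y) x <-> ole y (rho a x);
  act_rinv : forall a x y, ole x (rho (rinv a) y) <-> ole (rho a x) y;
  act_sub : forall a c x, Z0 c -> rho a (c + x) = c + rho a x;
  act_faithful : forall a a', (forall x, rho a x = rho a' x) -> a = a'
}.

Hypothesis R : faithful_action.

Lemma ole_refl x : ole x x.
Proof. now left. Qed.

Lemma not_ole x y : ~ ole x y -> pos (x - y).
Proof.
  intros N. destruct (pos_total (x - y)) as [P|[E|P]]; [exact P|..]; exfalso; apply N.
  - left. transitivity ((x - y) + y); [module | rewrite E; module].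
  - right. now replace (y - x) with (- (x - y)) by module.
Qed.

Lemma ole_sub_step x : ~ ole x (x - u).
Proof.
  intros [E|P].
  - apply (@pos_irrefl H). replace (0 : H) with u; [apply (step_pos D)|].
    transitivity (x - (x - u)); [module | rewrite <- E; module].
  - replace (x - u - x) with (- u) in P by module. exact (pos_asym (step_pos D) P).
Qed.

(* Every use of a homomorphism to Z is local: [Ev P] leaves open the finite set
   on which additivity and order have to be preserved. *)
Definition Ev (P : (H -> Z) -> Prop) : Prop :=
  exists F, forall pi, good u Z0 F pi -> P pi.

Lemma good_app_l F F' pi : good u Z0 (F ++ F') pi -> good u Z0 F pi.
Proof. intros [G1 G2 G3 G4]; split; intros; auto using in_or_app. Qed.

Lemma good_app_r F F' pi : good u Z0 (F ++ F') pi -> good u Z0 F' pi.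
Proof. intros [G1 G2 G3 G4]; split; intros; auto using in_or_app. Qed.

Lemma Ev_and P Q : Ev P -> Ev Q -> Ev (fun pi => P pi /\ Q pi).
Proof.
  intros [F HF] [F' HF']; exists (F ++ F')%list; intros pi G; split;
    [apply HF; eapply good_app_l | apply HF'; eapply good_app_r]; eauto.
Qed.

Lemma Ev_impl (P Q : (H -> Z) -> Prop) : Ev P -> (forall pi, P pi -> Q pi) -> Ev Q.
Proof. intros [F HF] I; exists F; intros pi G; auto. Qed.

Lemma Ev_forall (P : nat -> (H -> Z) -> Prop) k :
  (forall i, (i < k)%nat -> Ev (P i)) -> Ev (fun pi => forall i, (i < k)%nat -> P i pi).
Proof.
  induction k as [|k IH]; intros HP.
  - exists nil; intros; lia.
  - apply (Ev_impl (Ev_and (IH (fun i Hi => HP i (Nat.lt_lt_succ_r _ _ Hi))) (HP k (le_n _)))).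
    intros pi [P1 P2] i Hi. destruct (Nat.eq_dec i k) as [->|]; [exact P2 | apply P1; lia].
Qed.

Lemma Ev_exists P : Ev P -> exists pi, P pi.
Proof. intros [F HF]. destruct (exists_good D F) as [pi G]. exists pi; auto. Qed.

Lemma Ev_step : Ev (fun pi => pi u = 1%Z).
Proof. exists nil; intros pi G; apply (good_step G). Qed.

Lemma Ev_add x y : Ev (fun pi => pi (x + y) = (pi x + pi y)%Z).
Proof. exists (x :: y :: nil); intros pi G; apply (good_add G); simpl; auto. Qed.

Lemma Ev_pos x y : pos (y - x) -> Ev (fun pi => (pi x < pi y)%Z).
Proof. intros P; exists (x :: y :: nil); intros pi G; apply (good_pos G); simpl; auto. Qed.

Lemma Ev_ole x y : ole x y -> Ev (fun pi => (pi x <= pi y)%Z).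
Proof.
  intros [->|P]; [exists nil; intros; lia|].
  apply (Ev_impl (Ev_pos P)); intros; lia.
Qed.

Lemma Ev_mod x : Ev (fun pi => Z0 (x - zmul (pi x) u)).
Proof. exists (x :: nil); intros pi G; apply (good_mod G); simpl; auto. Qed.

Lemma Ev_sub x y : Ev (fun pi => pi (x - y) = (pi x - pi y)%Z).
Proof.
  apply (Ev_impl (Ev_add (x - y) y)); intros pi E.
  replace (x - y + y) with x in E by module. lia.
Qed.

Lemma Ev_multiple (k : nat) : Ev (fun pi => pi (zmul (Z.of_nat k) u) = Z.of_nat k).
Proof.
  induction k as [|k IH].
  - apply (Ev_impl (Ev_add 0 0)); intros pi E. rewrite add0 in E. simpl Z.of_nat.
    rewrite zmul0. lia.
  - apply (Ev_impl (Ev_and IH (Ev_and Ev_step (Ev_add (zmul (Z.of_nat k) u) u)))).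
    intros pi (E1 & E2 & E3).
    replace (zmul (Z.of_nat (S k)) u) with (zmul (Z.of_nat k) u + u); [lia|].
    rewrite Nat2Z.inj_succ, zmul_succ. apply addC.
Qed.

Local Notation N := (Z.of_nat n).

(** Reads [rho a] at one representative per residue, [0, u, ..., (n - 1) u], and extends
    n-periodically; thus finitely many constraints on [pi] control the whole function. *)
Definition transported (pi : H -> Z) a (m : Z) : Z :=
  (pi (rho a (zmul (m mod N) u)) + (m - m mod N))%Z.

Lemma transported_at a x : Ev (fun pi => transported pi a (pi x) = pi (rho a x)).
Proof.
  (* The residue of [pi x] depends on [pi], so the additivity needed is imposed for all [n] residues
     at once. *)
  assert (E : forall i, (i < n)%nat -> Ev (fun pi =>
    pi (zmul (Z.of_nat i) u) = Z.of_nat i /\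
    pi (x - zmul (Z.of_nat i) u) = (pi x - pi (zmul (Z.of_nat i) u))%Z /\
    pi ((x - zmul (Z.of_nat i) u) + rho a (zmul (Z.of_nat i) u)) =
      (pi (x - zmul (Z.of_nat i) u)%grp + pi (rho a (zmul (Z.of_nat i) u)))%Z)).
  { intros i Hi. apply Ev_and; [apply Ev_multiple|].
    apply Ev_and; [apply Ev_sub | apply Ev_add]. }
  apply (Ev_impl (Ev_and (Ev_mod x) (Ev_forall E))); intros pi [M P].
  pose proof (period_pos D) as n_pos.
  pose proof (Z.mod_pos_bound (pi x) N n_pos) as B.
  destruct (P (Z.to_nat (pi x mod N))) as (P1 & P2 & P3); [lia|].
  rewrite Z2Nat.id in P1, P2, P3 by lia.
  unfold transported. set (r := zmul (pi x mod N) u) in *.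
  assert (C : Z0 (x - r)).
  { replace (x - r) with ((x - zmul (pi x) u) + zmul (pi x / N) (zmul N u)).
    - apply (sub_add D); [exact M|]. apply (sub_zmul D), (sub_period D).
    - unfold r. rewrite (Z.mod_eq (pi x) N) by lia. module. }
  replace (rho a x) with ((x - r) + rho a r); [lia|].
  rewrite <- (act_sub R a r C). f_equal. module.
Qed.

Lemma transported_FnZ a : Ev (fun pi => exists g : FnZ n, forall m, fapp g m = transported pi a m).
Proof.
  pose proof (period_pos D) as n_pos.
  set (y i := rho a (zmul (Z.of_nat i) u)).
  assert (Y : forall i, ole (y i) (y (S i))).
  { intros i; apply (act_mono R). right.
    replace (zmul (Z.of_nat (S i)) u - zmul (Z.of_nat i) u) with u; [apply (step_pos D)|].
    rewrite Nat2Z.inj_succ, zmul_succ. module. }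
  assert (Yn : y n = zmul N u + y O).
  { unfold y. rewrite <- (act_sub R a _ (sub_period D)). f_equal. simpl Z.of_nat.
    rewrite zmul0. now rewrite add0r. }
  apply (Ev_impl (Ev_and (Ev_and (Ev_multiple n) (Ev_add (zmul N u) (y O)))
    (Ev_forall (k := n) (fun i _ => Ev_ole (Y i))))).
  intros pi [[P1 P2] P3]. rewrite <- Yn in P2.
  apply exists_FnZ; [lia | |]; intros m; unfold transported.
  - pose proof (Z.mod_pos_bound m N n_pos) as B.
    specialize (P3 (Z.to_nat (m mod N)) ltac:(lia)). unfold y in P3.
    rewrite Nat2Z.inj_succ, Z2Nat.id in P3 by lia.
    (* At the last residue the successor wraps around to 0, and [Yn] identifies the next value with
       that at 0 shifted by [n]. *)
    destruct (Z.eq_dec (m mod N) (N - 1)) as [E|E].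
    + assert (E' : ((m + 1) mod N = 0)%Z).
      { rewrite <- Z.add_mod_idemp_l, E by lia.
        replace (N - 1 + 1)%Z with N by lia. apply Z.mod_same; lia. }
      rewrite E'. rewrite E in *. replace (Z.succ (N - 1)) with N in P3 by lia.
      unfold y in P2. simpl Z.of_nat in P2. lia.
    + assert (E' : ((m + 1) mod N = m mod N + 1)%Z).
      { rewrite <- Z.add_mod_idemp_l by lia. apply Z.mod_small. lia. }
      rewrite E'. replace (Z.succ (m mod N)) with (m mod N + 1)%Z in P3 by lia. lia.
  - replace (m + N)%Z with (m + 1 * N)%Z by lia. rewrite Z.mod_add by lia. lia.
Qed.

(** Meaningful only for those [pi] that satisfy the conclusion of [transported_FnZ]. *)
Definition transported_elt (pi : H -> Z) a : FnZ n :=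
  epsilon (inhabits one) (fun g => forall m, fapp g m = transported pi a m).

(** For [Linv] and [Rinv] the value [z] is the least, resp. greatest, point satisfying an
    inequality. As [pi] sends [u] to 1, testing that inequality at [z] and at its neighbour
    determines the value in Z; this is where discreteness of the chain enters. *)
Lemma transported_eval (v : nat -> A) t x :
  Ev (fun pi => fapp (eval (fun i => transported_elt pi (v i)) t) (pi x) = pi (rho (eval v t) x)).
Proof.
  revert x; induction t as [i|s IHs t IHt|s IHs t IHt|s IHs t IHt| |t IHt|t IHt]; intros x;
    cbn [eval].
  - apply (Ev_impl (Ev_and (transported_at (v i) x) (transported_FnZ (v i)))).
    intros pi [<- X]. exact (epsilon_spec (inhabits one) _ X (pi x)).
  - pose proof (act_meet R (eval v s) (eval v t) x) as M.
    set (w pi := fun i => transported_elt pi (v i)).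
    assert (G : forall pi, fapp (meet (eval (w pi) s) (eval (w pi) t)) (pi x) =
      Z.min (fapp (eval (w pi) s) (pi x)) (fapp (eval (w pi) t) (pi x))) by reflexivity.
    destruct M as [[-> M]|[-> M]];
      apply (Ev_impl (Ev_and (Ev_and (IHs x) (IHt x)) (Ev_ole M)));
      intros pi [[E1 E2] L]; fold (w pi) in *; rewrite G; lia.
  - pose proof (act_join R (eval v s) (eval v t) x) as M.
    set (w pi := fun i => transported_elt pi (v i)).
    assert (G : forall pi, fapp (join (eval (w pi) s) (eval (w pi) t)) (pi x) =
      Z.max (fapp (eval (w pi) s) (pi x)) (fapp (eval (w pi) t) (pi x))) by reflexivity.
    destruct M as [[-> M]|[-> M]];
      apply (Ev_impl (Ev_and (Ev_and (IHs x) (IHt x)) (Ev_ole M)));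
      intros pi [[E1 E2] L]; fold (w pi) in *; rewrite G; lia.
  - apply (Ev_impl (Ev_and (IHt x) (IHs (rho (eval v t) x)))); intros pi [E1 E2].
    rewrite (act_mul R), <- E2, <- E1. reflexivity.
  - exists nil; intros pi _. now rewrite (act_one R).
  - set (z := rho (linv (eval v t)) x).
    assert (L : ole x (rho (eval v t) z)) by apply (act_linv R), ole_refl.
    assert (L' : pos (x - rho (eval v t) (z - u))).
    { apply not_ole; intros C. apply (act_linv R) in C. exact (ole_sub_step C). }
    apply (Ev_impl (Ev_and (Ev_and (IHt z) (IHt (z - u)))
      (Ev_and (Ev_and (Ev_sub z u) Ev_step) (Ev_and (Ev_ole L) (Ev_pos L'))))).
    intros pi [[E1 E2] [[E3 E4] [E5 E6]]].
    set (g := eval (fun i => transported_elt pi (v i)) t) in *.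
    assert (B1 : (fapp (linv g) (pi x) <= pi z)%Z) by (apply fapp_linv; lia).
    assert (B2 : ~ (fapp (linv g) (pi x) <= pi (z - u)%grp)%Z) by (rewrite fapp_linv; lia).
    lia.
  - set (z := rho (rinv (eval v t)) x).
    assert (L : ole (rho (eval v t) z) x) by apply (act_rinv R), ole_refl.
    assert (L' : pos (rho (eval v t) (z + u) - x)).
    { apply not_ole; intros C. apply (act_rinv R) in C. fold z in C.
      apply (@ole_sub_step (z + u)). now replace (z + u - u) with z by module. }
    apply (Ev_impl (Ev_and (Ev_and (IHt z) (IHt (z + u)))
      (Ev_and (Ev_and (Ev_add z u) Ev_step) (Ev_and (Ev_ole L) (Ev_pos L'))))).
    intros pi [[E1 E2] [[E3 E4] [E5 E6]]].
    set (g := eval (fun i => transported_elt pi (v i)) t) in *.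
    assert (B1 : (pi z <= fapp (rinv g) (pi x))%Z) by (apply fapp_rinv; lia).
    assert (B2 : ~ (pi (z + u)%grp <= fapp (rinv g) (pi x))%Z) by (rewrite fapp_rinv; lia).
    lia.
Qed.

Lemma satisfies_of_action e : satisfies (FnZ n) e -> satisfies A e.
Proof.
  intros S v. apply (act_faithful R); intros x. apply NNPP; intros Ne.
  set (y := rho (eval v (fst e)) x) in *. set (y' := rho (eval v (snd e)) x) in *.
  assert (P : Ev (fun pi => pi y <> pi y')).
  { destruct (pos_total (y' - y)) as [P|[E|P]].
    - apply (Ev_impl (Ev_pos P)); intros; lia.
    - exfalso; apply Ne. transitivity (y' - (y' - y)); [module | rewrite E; module].
    - replace (- (y' - y)) with (y - y') in P by module.
      apply (Ev_impl (Ev_pos P)); intros; lia. }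
  destruct (Ev_exists (Ev_and P (Ev_and (transported_eval v (fst e) x)
    (transported_eval v (snd e) x)))) as (pi & Npi & E1 & E2).
  apply Npi. unfold y, y'. rewrite <- E1, <- E2, S. reflexivity.
Qed.

End Transfer.

(** * The action on the skeleton *)

Section Congruence.

Variables (A : algebra) (HA : is_lpregroup A) (n : nat).
Hypotheses (n_pos : (0 < n)%nat) (Hper : periodic n A).
Local Open Scope alg_scope.

Lemma congruence_join_orbit S k (x y : A) :
  congruence S -> S x y -> S (join_orbit k x) (join_orbit k y).
Proof.
  intros C Hxy.
  assert (P : forall i, S (phin i x) (phin i y)).
  { induction i as [|i IH]; [exact Hxy|]. simpl. now do 2 apply (congr_linv C). }
  induction k as [|k IH]; [exact Hxy|]. cbn [join_orbit].
  apply (congr_join C); [exact IH | apply P].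
Qed.

Lemma congruence_contains S : congruence S -> ~ same_relation A eq S ->
  exists h : A, invertible h /\ 1 <= h /\ h <> 1 /\ S h 1.
Proof.
  intros C N. destruct (congr_equiv C) as [Refl Sym Trans].
  assert (X : exists x y, S x y /\ x <> y).
  { apply NNPP; intros N'. apply N; split; intros x y Hxy; [subst; apply Refl|].
    apply NNPP; intros Ne; apply N'; now exists x, y. }
  destruct X as (x & y & Sxy & Nxy). set (v := x ⊓ y). set (w := x ⊔ y).
  assert (Lv : v <= w) by (apply (le_trans HA) with x; [apply (meet_le_l HA) | apply (le_join_l HA)]).
  assert (Svw : S v w).
  { apply Trans with y.
    - rewrite <- (meet_idem HA y). now apply (congr_meet C).
    - apply Sym, Trans with (y ⊔ y); [now apply (congr_join C)|].
      rewrite (le_join_eq HA (le_refl HA y)). apply Refl. }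
  assert (Nvw : ~ w <= v).
  { intros L. apply Nxy, (le_antisym HA).
    - apply (le_trans HA) with w; [apply (le_join_l HA)|].
      apply (le_trans HA) with v; [exact L | apply (meet_le_r HA)].
    - apply (le_trans HA) with w; [apply (le_join_r HA)|].
      apply (le_trans HA) with v; [exact L | apply (meet_le_l HA)]. }
  set (z := linv v * w ⊔ 1).
  assert (Sz : S z 1).
  { apply Trans with (linv v * v ⊔ 1).
    - apply (congr_join C); [|apply Refl]. apply (congr_mul C); [apply Refl | now apply Sym].
    - rewrite (le_join_eq HA (linv_contract HA v)). apply Refl. }
  exists (tau n z); split; [exact (tau_invertible HA n_pos Hper z)|].
  assert (Lz : z <= tau n z) by apply (le_tau HA).
  split; [apply (le_trans HA) with z; [apply (le_join_r HA) | exact Lz] | split].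
  - intros E. apply Nvw. rewrite <- (mul_one_r HA v). apply (coresidual_r HA).
    apply (le_trans HA) with z; [apply (le_join_l HA)|]. now rewrite <- E.
  - assert (T1 : tau n (1 : A) = 1).
    { apply (le_antisym HA); [|apply (le_tau HA)].
      apply (tau_le HA); [apply (invertible_one HA) | apply (le_refl HA)]. }
    rewrite <- T1. now apply congruence_join_orbit.
Qed.

End Congruence.

Section SkeletonGroup.

Variables (A : algebra) (HA : is_lpregroup A).
Hypotheses (Htot : forall g h : A, invertible g -> invertible h -> le g h \/ le h g)
  (Hab : forall g h : A, invertible g -> invertible h -> mul g h = mul h g).
Local Open Scope alg_scope.

Definition unit_elt : Type := {g : A | invertible g}.

Lemma unit_eq (g h : unit_elt) : proj1_sig g = proj1_sig h -> g = h.
Proof. destruct g, h; apply subset_eq_compat. Qed.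

Definition unit_add (g h : unit_elt) : unit_elt :=
  exist _ _ (invertible_mul HA (proj2_sig g) (proj2_sig h)).
Definition unit_zero : unit_elt := exist _ _ (invertible_one HA).
Definition unit_opp (g : unit_elt) : unit_elt :=
  exist _ _ (invertible_linv HA (proj2_sig g)).
Definition unit_pos (g : unit_elt) : Prop := 1 <= proj1_sig g /\ proj1_sig g <> 1.

Definition skeleton_group : ordered_group.
Proof.
  refine (@Build_ordered_group unit_elt unit_add unit_zero unit_opp unit_pos _ _ _ _ _ _ _).
  - intros x y z; apply unit_eq, (mul_assoc HA).
  - intros [x Hx] [y Hy]; apply unit_eq; simpl. now apply Hab.
  - intros x; apply unit_eq, (mul_one_l HA).
  - intros [x Hx]; apply unit_eq; simpl. now apply (mulV HA).
  - intros [x Hx] [y Hy] [Px Nx] [Py Ny]; split; simpl in *.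
    + apply (le_trans HA) with x; [exact Px | now apply (le_mul_r HA)].
    + intros E; apply Nx, (le_antisym HA); [|exact Px].
      rewrite <- E. now apply (le_mul_r HA).
  - intros [_ N]; now apply N.
  - intros [x Hx]. destruct (classic (x = 1)) as [->|N]; [right; left; now apply unit_eq|].
    destruct (Htot Hx (invertible_one HA)) as [L|L]; [right; right | left; now split].
    split; simpl; [now apply (linv_ge1 HA)|]. intros E; apply N.
    rewrite <- (linv_linv HA Hx), E. apply (linv_one HA).
Defined.

Lemma ole_skeleton (g h : skeleton_group) : ole g h <-> proj1_sig g <= proj1_sig h.
Proof.
  assert (E : forall g h : skeleton_group,
    1 <= proj1_sig (add h (opp g)) <-> proj1_sig g <= proj1_sig h).
  { intros [x Hx] [y Hy]; simpl. rewrite Hab; [|exact Hy|now apply (invertible_linv HA)].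
    rewrite <- (le_invertible_l HA _ _ Hx). now rewrite (mul_one_r HA). }
  split.
  - intros [->|[P _]]; [apply (le_refl HA) | now apply E].
  - intros L. destruct (classic (g = h)) as [->|N]; [now left | right]. split; [now apply E|].
    intros E1; apply N, unit_eq, (le_antisym HA); [exact L|]. apply E.
    assert (Z : add h (opp g) = zero) by now apply unit_eq.
    rewrite <- (oppK (add g (opp h))), opp_add, oppK, addC, Z, opp0. apply (le_refl HA).
Qed.

End SkeletonGroup.

(** * The action of an algebra that is not a group *)

Section NonGroup.

Variables (A : algebra) (HA : is_lpregroup A) (n : nat).
Hypotheses (n_pos : (0 < n)%nat) (Hper : periodic n A).
Hypotheses (Htot : forall g h : A, invertible g -> invertible h -> le g h \/ le h g)
  (Hab : forall g h : A, invertible g -> invertible h -> mul g h = mul h g).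
Local Open Scope alg_scope.

Variable e : A.
Hypotheses (He : atom e) (De : disjoint e (phi e)).
Variable p : A.
Hypotheses (Hp : closure p) (Hep : e * p = unit_shift n e * p).
Hypothesis Hcomm : forall c, invertible c -> c * e = e * c -> c * p = p * c.

Notation G := (skeleton_group HA Htot Hab).
Notation P := (rinv p).

Lemma exists_act (a : A) (x : G) : {g : G | a * proj1_sig x * P = proj1_sig g * P}.
Proof.
  apply constructive_indefinite_description.
  destruct (exists_value HA n_pos Hper Htot He Hp Hep (a * proj1_sig x)) as (g & Hg & E).
  now exists (exist _ g Hg).
Qed.

Definition act (a : A) (x : G) : G := proj1_sig (exists_act a x).

Lemma act_spec a x : a * proj1_sig x * P = proj1_sig (act a x) * P.
Proof. exact (proj2_sig (exists_act a x)). Qed.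

Lemma act_eq a x (g : G) : a * proj1_sig x * P = proj1_sig g * P -> act a x = g.
Proof.
  intros E. rewrite act_spec in E. apply unit_eq.
  apply (mul_point_inj HA n_pos Hper Hp); [apply proj2_sig.. | exact E].
Qed.

Lemma ole_point (g h : G) : ole g h <-> proj1_sig g * P <= proj1_sig h * P.
Proof.
  rewrite ole_skeleton. split.
  - apply (mul_mono_l HA).
  - apply (mul_point_le HA n_pos Hper Hp); apply proj2_sig.
Qed.

Lemma act_linv_iff a x y : ole (act (linv a) y) x <-> ole y (act a x).
Proof.
  rewrite !ole_point, <- !act_spec, <- !(mul_assoc HA). apply (coresidual_r HA).
Qed.

Lemma act_rinv_iff a x y : ole x (act (rinv a) y) <-> ole (act a x) y.
Proof.
  rewrite !ole_point, <- !act_spec, <- !(mul_assoc HA). symmetry; apply (residual_r HA).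
Qed.

Lemma ole_antisym (g h : G) : ole g h -> ole h g -> g = h.
Proof. rewrite !ole_skeleton; intros; apply unit_eq; now apply (le_antisym HA). Qed.

Lemma act_mul_eq a b x : act (a * b) x = act a (act b x).
Proof. apply act_eq. now rewrite <- act_spec, <- !(mul_assoc HA), <- act_spec, !(mul_assoc HA). Qed.

Lemma act_one_eq x : act 1 x = x.
Proof. apply act_eq. now rewrite (mul_one_l HA). Qed.

Lemma act_meet_cases a b x :
  (act (a ⊓ b) x = act a x /\ ole (act a x) (act b x)) \/
  (act (a ⊓ b) x = act b x /\ ole (act b x) (act a x)).
Proof.
  assert (E : (a ⊓ b) * proj1_sig x * P =
    proj1_sig (act a x) * P ⊓ proj1_sig (act b x) * P)
    by now rewrite !(mul_meet_r HA), !act_spec.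
  destruct (Htot (proj2_sig (act a x)) (proj2_sig (act b x))) as [L|L]; [left|right];
    (split; [|now apply ole_skeleton]); apply act_eq; rewrite E;
    apply (mul_mono_l HA) with (z := P) in L; unfold le in L; [exact L|].
  now rewrite (meet_comm HA).
Qed.

Lemma act_join_cases a b x :
  (act (a ⊔ b) x = act b x /\ ole (act a x) (act b x)) \/
  (act (a ⊔ b) x = act a x /\ ole (act b x) (act a x)).
Proof.
  assert (E : (a ⊔ b) * proj1_sig x * P =
    proj1_sig (act a x) * P ⊔ proj1_sig (act b x) * P)
    by now rewrite !(mul_join_r HA), !act_spec.
  destruct (Htot (proj2_sig (act a x)) (proj2_sig (act b x))) as [L|L]; [left|right];
    (split; [|now apply ole_skeleton]); apply act_eq; rewrite E;
    apply (mul_mono_l HA) with (z := P) in L; [now apply (le_join_eq HA)|].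
  rewrite (join_comm HA). now apply (le_join_eq HA).
Qed.

Definition same_action (a b : A) : Prop := forall x, act a x = act b x.

Lemma same_action_congruence : congruence same_action.
Proof.
  split.
  - split; [intros a x; reflexivity | intros a b E x; now symmetry|].
    intros a b c E E' x; now rewrite E.
  - intros a a' b b' Ea Eb x.
    destruct (act_meet_cases a b x) as [[-> L]|[-> L]], (act_meet_cases a' b' x) as [[-> L']|[-> L']];
      auto; rewrite Ea, Eb in L; rewrite ?Ea, ?Eb; now apply ole_antisym.
  - intros a a' b b' Ea Eb x.
    destruct (act_join_cases a b x) as [[-> L]|[-> L]], (act_join_cases a' b' x) as [[-> L']|[-> L']];
      auto; rewrite Ea, Eb in L; rewrite ?Ea, ?Eb; now apply ole_antisym.
  - intros a a' b b' Ea Eb x. now rewrite !act_mul_eq, Eb, Ea.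
  - intros a a' Ea x. apply ole_antisym; apply act_linv_iff; [rewrite Ea | rewrite <- Ea];
      apply act_linv_iff, ole_refl.
  - intros a a' Ea x. apply ole_antisym; apply act_rinv_iff; [rewrite <- Ea | rewrite Ea];
      apply act_rinv_iff, ole_refl.
Qed.

(* The kernel of the action is a congruence, and it identifies no invertible
   element with [1]. *)
Lemma same_action_eq a b : same_action a b -> a = b.
Proof.
  intros E. destruct (classic (same_relation A eq same_action)) as [[_ I]|N]; [now apply I|].
  destruct (congruence_contains HA n_pos Hper same_action_congruence N) as (h & Hh & H1 & Nh & Sh).
  exfalso; apply Nh. specialize (Sh zero). rewrite act_one_eq in Sh.
  assert (E' : act h zero = exist _ h Hh :> G) by now apply act_eq; simpl; rewrite (mul_one_r HA).
  rewrite E' in Sh. exact (f_equal (@proj1_sig _ _) Sh).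
Qed.

Definition stabilizer (c : G) : Prop := proj1_sig c * p = p * proj1_sig c.

Lemma stabilizer_point c : stabilizer c -> proj1_sig c * P = P * proj1_sig c.
Proof.
  destruct c as [c Hc]; unfold stabilizer; simpl; intros E.
  assert (E' : linv c * P = P * linv c).
  { rewrite Hc, <- !(rinv_mul HA). now f_equal. }
  transitivity (c * (P * (linv c * c))).
  - now rewrite (Vmul HA Hc), (mul_one_r HA).
  - now rewrite (mul_assoc HA P), <- E', <- (mul_assoc HA), (mulVK HA _ Hc).
Qed.

Lemma act_faithful_action : faithful_action stabilizer act.
Proof.
  split.
  - intros a x y H. rewrite ole_point, <- !act_spec, <- !(mul_assoc HA).
    apply (mul_mono_r HA). now apply ole_point.
  - exact act_one_eq.
  - exact act_mul_eq.
  - exact act_meet_cases.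
  - exact act_join_cases.
  - exact act_linv_iff.
  - exact act_rinv_iff.
  - intros a c x Hc. apply act_eq. apply stabilizer_point in Hc.
    change (a * (proj1_sig c * proj1_sig x) * P = proj1_sig c * proj1_sig (act a x) * P).
    rewrite (Hab (proj2_sig c) (proj2_sig x)), (Hab (proj2_sig c) (proj2_sig (act a x))).
    rewrite <- !(mul_assoc HA), Hc, !(mul_assoc HA), act_spec. reflexivity.
  - exact same_action_eq.
Qed.

Definition shift : G := exist _ (unit_shift n e) (invertible_u HA n_pos Hper e).

Lemma shift_pos : pos shift.
Proof. split; [apply (one_le_u HA n He) | apply (u_neq1 HA (n := n) He)]. Qed.

Lemma shift_min (x : G) : pos x -> x = shift \/ pos (add x (opp shift)).
Proof.
  intros [P1 N]. assert (L : ole shift x).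
  { apply ole_skeleton. simpl. apply (u_le HA n_pos Hper Htot He De); auto. apply proj2_sig. }
  destruct L as [E|L]; [now left | now right].
Qed.

Add Ring ext_ring_nongroup : (ext_ring G).

(** The adjunction reads [linv] only on the left of an inequality. Reversing the inequality through
    the predecessor permits its second use, as needed for [phi]. *)
Lemma ole_not_shift (x y : G) : ole x y <-> ~ ole y (add x (opp shift)).
Proof.
  split.
  - intros L L'. apply (pos_asym shift_pos).
    destruct L as [->|L].
    + destruct L' as [E|L'].
      * exfalso. apply (@pos_irrefl G). replace (zero : G) with shift; [apply shift_pos|].
        transitivity (add y (opp (add y (opp shift)))); [module | rewrite <- E; module].
      * now replace (opp shift) with (add (add y (opp shift)) (opp y)) by module.
    + destruct L' as [E|L'].
      * exfalso. apply (@pos_irrefl G). apply (pos_add shift_pos) in L.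
        now replace (zero : G) with (add shift (add y (opp x))) by (rewrite E; module).
      * replace (opp shift) with (add (add (add x (opp shift)) (opp y)) (add y (opp x))) by module.
        now apply pos_add.
  - intros N. apply not_ole in N. apply shift_min in N as [E|N].
    + left. transitivity (add y (add shift (opp (add y (opp (add x (opp shift)))))));
        [module | rewrite E; module].
    + right. now replace (add y (opp x)) with
        (add (add y (opp (add x (opp shift)))) (opp shift)) by module.
Qed.

(* Both sides act in the same way, since [shift] is the successor. *)
Lemma phi_conj a : phi a * proj1_sig shift = proj1_sig shift * a.
Proof.
  assert (S : forall g x : G, act (proj1_sig g) x = add g x).
  { intros g x. apply act_eq. reflexivity. }
  apply same_action_eq; intros x. rewrite !act_mul_eq, !S.
  assert (E : forall y z, ole (act (phi a) y) z <-> ole (add shift (act a (add y (opp shift)))) z).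
  { intros y z. unfold phi. rewrite act_linv_iff, ole_not_shift, act_linv_iff.
    rewrite (ole_not_shift (add shift _) z).
    replace (add (add shift (act a (add y (opp shift)))) (opp shift))
      with (act a (add y (opp shift))) by module. reflexivity. }
  assert (X : add (add shift x) (opp shift) = x) by module.
  apply ole_antisym.
  - apply E. rewrite X. apply ole_refl.
  - rewrite <- X at 1. apply E, ole_refl.
Qed.

Lemma phin_conj k a :
  phin k a * proj1_sig (zmul (Z.of_nat k) shift) = proj1_sig (zmul (Z.of_nat k) shift) * a.
Proof.
  induction k as [|k IH].
  - simpl. now rewrite (mul_one_r HA), (mul_one_l HA).
  - rewrite Nat2Z.inj_succ, zmul_succ.
    change (phi (phin k a) * (proj1_sig shift * proj1_sig (zmul (Z.of_nat k) shift)) =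
      proj1_sig shift * proj1_sig (zmul (Z.of_nat k) shift) * a).
    now rewrite (mul_assoc HA), phi_conj, <- !(mul_assoc HA), IH.
Qed.

Lemma stabilizer_of_commute (c : G) : proj1_sig c * e = e * proj1_sig c -> stabilizer c.
Proof. apply Hcomm, proj2_sig. Qed.

(** Conjugating [e] by [g] yields an atom below the shift, hence some [phin i e], which is also the
    conjugate of [e] by the [i]-th multiple of [shift]. The difference therefore commutes with [e],
    and so with [p]. *)
Lemma stabilizer_cofinite (g : G) : exists k, stabilizer (add g (opp (zmul k shift))).
Proof.
  set (x := proj1_sig g). assert (Hx : invertible x) by apply proj2_sig.
  assert (Ha : atom (x * e * linv x)) by now apply (atom_conj HA).
  destruct (atom_below_u HA n_pos Hper He Ha) as [i Hi].
  { apply (le_trans HA) with (x * unit_shift n e * linv x).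
    - apply (mul_mono_l HA), (mul_mono_r HA), (e_le_u HA).
    - pose proof (Hab Hx (proj2_sig shift)) as E; simpl in E; rewrite E.
      rewrite <- (mul_assoc HA), (mulV HA Hx), (mul_one_r HA). apply (le_refl HA). }
  exists (Z.of_nat i). apply stabilizer_of_commute.
  set (s := zmul (Z.of_nat i) shift). pose proof (phin_conj i e) as Es. fold s in Es.
  set (w := proj1_sig s) in *. assert (Hw : invertible w) by apply proj2_sig.
  assert (Hw' : invertible (linv w)) by now apply (invertible_linv HA).
  change (x * linv w * e = e * (x * linv w)).
  assert (Eg : x * e = phin i e * x).
  { rewrite <- Hi, <- !(mul_assoc HA), (Vmul HA Hx), (mul_one_r HA). reflexivity. }
  rewrite (Hab Hx Hw'), <- (mul_assoc HA), Eg, (mul_assoc HA), (mul_assoc HA).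
  f_equal. transitivity (linv w * (phin i e * w) * linv w).
  - now rewrite <- !(mul_assoc HA), (mulV HA Hw), (mul_one_r HA).
  - now rewrite Es, (VmulK HA _ Hw).
Qed.

Lemma skeleton_discrete : discrete_with shift stabilizer (Z.of_nat n).
Proof.
  split.
  - exact shift_pos.
  - exact shift_min.
  - unfold stabilizer; simpl. now rewrite (mul_one_r HA), (mul_one_l HA).
  - unfold stabilizer; intros x y Hx Hy; simpl.
    now rewrite <- (mul_assoc HA), Hy, (mul_assoc HA), Hx, (mul_assoc HA).
  - intros x Hx. unfold stabilizer in *. simpl.
    destruct x as [x Hinv]; simpl in *.
    transitivity (linv x * (p * x) * linv x).
    + now rewrite <- !(mul_assoc HA), (mulV HA Hinv), (mul_one_r HA).
    + now rewrite <- Hx, (VmulK HA _ Hinv).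
  - lia.
  - unfold stabilizer. now rewrite <- phin_conj, (phin_period HA Hper).
  - exact stabilizer_cofinite.
Qed.

Lemma nongroup_satisfies (eqn : term * term) : satisfies (FnZ n) eqn -> satisfies A eqn.
Proof. exact (satisfies_of_action skeleton_discrete act_faithful_action (e := eqn)). Qed.

End NonGroup.

(** * The group case, by translations *)

Definition lex_group (G : ordered_group) : ordered_group.
Proof.
  refine (@Build_ordered_group (G * Z)
    (fun x y => (add (fst x) (fst y), snd x + snd y)) (zero, 0)
    (fun x => (opp (fst x), - snd x))
    (fun x => pos (fst x) \/ fst x = zero /\ 0 < snd x) _ _ _ _ _ _ _).
  - intros x y z; simpl; f_equal; [apply addA | lia].
  - intros x y; simpl; f_equal; [apply addC | lia].
  - intros [x k]; simpl; f_equal; apply add0.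
  - intros [x k]; simpl; f_equal; [apply addN | lia].
  - intros [x k] [y l] [Px|[Ex Hk]] [Py|[Ey Hl]]; simpl in *.
    + left; now apply pos_add.
    + left; now rewrite Ey, add0r.
    + left; now rewrite Ex, add0.
    + right; rewrite Ex, Ey, add0; split; [reflexivity | lia].
  - simpl; intros [P|[_ L]]; [now apply pos_irrefl in P | lia].
  - intros [x k]; simpl. destruct (pos_total x) as [P|[->|P]]; auto.
    destruct (Z.lt_trichotomy k 0) as [L|[->|L]]; auto.
    right; right; right; split; [apply opp0 | lia].
Defined.

(** All of the group may serve as [Z0], since the intended action is by translations of an abelian
    group, which commute. *)
Lemma lex_discrete (G : ordered_group) (n : nat) : (0 < n)%nat ->
  discrete_with ((zero, 1) : lex_group G) (fun _ => True) (Z.of_nat n).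
Proof.
  intros n_pos. split; auto; try lia.
  - right; simpl; split; [reflexivity | lia].
  - intros [x k] [P|[E L]].
    + right; left. simpl in *. now rewrite opp0, add0r.
    + simpl in E, L. subst x. destruct (Z.eq_dec k 1) as [->|N]; [now left|].
      right; right. simpl. rewrite opp0, add0. split; [reflexivity | lia].
  - intros x; now exists 0.
Qed.

Section Translation.

Variable H : ordered_group.
Implicit Types x y c : H.
Local Open Scope grp_scope.
Add Ring ext_ring_translation : (ext_ring H).

Lemma ole_add_l c x y : ole (c + x) (c + y) <-> ole x y.
Proof.
  assert (S : forall c x y, ole x y -> ole (c + x) (c + y)).
  { intros c' x' y' [->|P]; [now left | right].
    now replace (c' + y' - (c' + x')) with (y' - x') by module. }
  split; [|apply S]. intros L. apply (S (- c)) in L.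
  replace (- c + (c + x)) with x in L by module.
  now replace (- c + (c + y)) with y in L by module.
Qed.

Lemma translation_action (A : algebra) (Z0 : H -> Prop) (iota : A -> H) :
  iota one = 0 ->
  (forall a b, iota (mul a b) = iota a + iota b) ->
  (forall a, iota (linv a) = - iota a) ->
  (forall a, iota (rinv a) = - iota a) ->
  (forall a b, meet a b = a /\ join a b = b /\ ole (iota a) (iota b) \/
               meet a b = b /\ join a b = a /\ ole (iota b) (iota a)) ->
  (forall a b, iota a = iota b -> a = b) ->
  faithful_action Z0 (fun a x => iota a + x).
Proof.
  intros E1 Em El Er Lat Inj.
  assert (Tr : forall a b x, ole (iota a) (iota b) -> ole (iota a + x) (iota b + x)).
  { intros a b x L. rewrite (addC _ x), (addC _ x). now apply ole_add_l. }
  split.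
  - intros; now apply ole_add_l.
  - intros x; rewrite E1; apply add0.
  - intros a b x; rewrite Em; symmetry; apply addA.
  - intros a b x. destruct (Lat a b) as [(-> & _ & L)|(-> & _ & L)]; auto.
  - intros a b x. destruct (Lat a b) as [(_ & -> & L)|(_ & -> & L)]; auto.
  - intros a x y. rewrite El, <- (ole_add_l (iota a)).
    now replace (iota a + (- iota a + y)) with y by module.
  - intros a x y. rewrite Er, <- (ole_add_l (iota a)).
    now replace (iota a + (- iota a + y)) with y by module.
  - intros a c x _. module.
  - intros a b E. apply Inj. specialize (E 0). now rewrite !add0r in E.
Qed.

End Translation.

Section Membership.

Variables (A : algebra) (HA : is_lpregroup A) (n : nat).
Hypotheses (n_pos : (0 < n)%nat) (Hper : periodic n A).
Hypotheses (Htot : forall g h : A, invertible g -> invertible h -> le g h \/ le h g)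
  (Hab : forall g h : A, invertible g -> invertible h -> mul g h = mul h g).

(* A totally ordered group acts on its lexicographic product with Z, in which
   (0, 1) is the least positive element. *)
Lemma group_satisfies (eqn : term * term) :
  (forall a : A, invertible a) -> satisfies (FnZ n) eqn -> satisfies A eqn.
Proof.
  intros Inv. set (G := skeleton_group HA Htot Hab).
  set (iota a := (exist _ a (Inv a), 0) : lex_group G).
  pose proof (lex_discrete G n_pos) as D.
  refine (satisfies_of_action D (translation_action (iota := iota) (fun _ => True)
    _ _ _ _ _ _) (e := eqn)).
  - unfold iota; simpl; f_equal. now apply unit_eq.
  - intros a b; unfold iota; simpl; f_equal. now apply unit_eq.
  - intros a; unfold iota; simpl; f_equal. now apply unit_eq.
  - intros a; unfold iota; simpl; f_equal. apply unit_eq; simpl. symmetry; apply Inv.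
  - assert (O : forall a b : A, le a b -> ole (iota a) (iota b)).
    { intros a b L. apply (ole_skeleton (HA := HA) (Htot := Htot) (Hab := Hab)
        (exist _ a (Inv a)) (exist _ b (Inv b))) in L.
      destruct L as [E|P]; [left; unfold iota; now rewrite E | right; now left]. }
    intros a b. destruct (Htot (Inv a) (Inv b)) as [L|L]; [left|right]; (split; [|split]);
      try now apply O.
    + exact L.
    + now apply (le_join_eq HA).
    + now rewrite (meet_comm HA).
    + rewrite (join_comm HA). now apply (le_join_eq HA).
  - intros a b E. now injection E.
Qed.

Lemma totally_ordered_skeleton_satisfies (eqn : term * term) :
  satisfies (FnZ n) eqn -> satisfies A eqn.
Proof.
  destruct (classic (forall a : A, invertible a)) as [I|N]; [now apply group_satisfies|].
  apply not_all_ex_not in N as [a N].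
  destruct (exists_atom HA n_pos Hper Htot N) as (e & He & De).
  destruct (exists_point HA n_pos Hper He) as (p & Hp & Hep & Hc).
  exact (nongroup_satisfies HA n_pos Hper Htot Hab He De Hp Hep Hc (eqn := eqn)).
Qed.

End Membership.

Close Scope Z_scope.
Close Scope Q_scope.

(** * Equations and congruences *)

Lemma var_FnZ_iff n A :
  var_FnZ n A <-> forall e, satisfies (FnZ n) e -> satisfies A e.
Proof.
  split.
  - intros V e S. apply (V (fun B => satisfies B e)).
    + exists (eq e). intros B; split; [now intros S' e' <- | auto].
    + now intros B <-.
  - intros S V [E HE] HV. apply HE. intros e He. apply S.
    now apply (proj1 (HE (FnZ n)) (HV _ eq_refl)).
Qed.

Lemma subalgebra_lpregroup (A : algebra) (Q : A -> Prop) (H : subuniverse A Q) :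
  is_lpregroup A -> is_lpregroup (subalgebra H).
Proof.
  intros HA.
  assert (Eq : forall x y : subalgebra H, proj1_sig x = proj1_sig y -> x = y).
  { intros [x Hx] [y Hy]; apply subset_eq_compat. }
  assert (Le : forall x y : subalgebra H, le (proj1_sig x) (proj1_sig y) -> le x y).
  { intros x y L; apply Eq, L. }
  assert (Le' : forall x y : subalgebra H, le x y -> le (proj1_sig x) (proj1_sig y)).
  { intros x y L; exact (f_equal (@proj1_sig _ _) L). }
  split; intros;
    [apply Eq; simpl; apply HA.. | | | | | |]; apply Le; simpl.
  - now apply (mul_mono_l HA), Le'.
  - now apply (mul_mono_r HA), Le'.
  - apply (linv_contract HA).
  - apply (linv_expand HA).
  - apply (rinv_contract HA).
  - apply (rinv_expand HA).
Qed.

Lemma FnZ_lpregroup n : is_lpregroup (FnZ n).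
Proof. apply subalgebra_lpregroup, FZ_lpregroup. Qed.

Section Equations.

Variables (B A : algebra) (HB : is_lpregroup B).
Hypothesis HE : forall e, satisfies B e -> satisfies A e.

Lemma lpregroup_of_equations : is_lpregroup A.
Proof.
  set (val (x y z : A) := fun i => match i with 0 => x | 1 => y | _ => z end).
  assert (Ax : forall s t, (forall v : nat -> B, eval v s = eval v t) ->
    forall x y z, eval (val x y z) s = eval (val x y z) t).
  { intros s t E x y z. exact (HE (e := (s, t)) E (val x y z)). }
  set (X := Var 0). set (Y := Var 1). set (Z := Var 2).
  split; intros x.
  - intros y. apply (fun E => Ax (Meet X Y) (Meet Y X) E x y y). intros; apply (meet_comm HB).
  - intros y. apply (fun E => Ax (Join X Y) (Join Y X) E x y y). intros; apply (join_comm HB).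
  - intros y z. apply (fun E => Ax (Meet X (Meet Y Z)) (Meet (Meet X Y) Z) E x y z).
    intros; apply (meet_assoc HB).
  - intros y z. apply (fun E => Ax (Join X (Join Y Z)) (Join (Join X Y) Z) E x y z).
    intros; apply (join_assoc HB).
  - intros y. apply (fun E => Ax (Meet X (Join X Y)) X E x y y). intros; apply (meet_absorb HB).
  - intros y. apply (fun E => Ax (Join X (Meet X Y)) X E x y y). intros; apply (join_absorb HB).
  - intros y z. apply (fun E => Ax (Mul X (Mul Y Z)) (Mul (Mul X Y) Z) E x y z).
    intros; apply (mul_assoc HB).
  - apply (fun E => Ax (Mul One X) X E x x x). intros; apply (mul_one_l HB).
  - apply (fun E => Ax (Mul X One) X E x x x). intros; apply (mul_one_r HB).
  (* Monotonicity becomes an identity when the smaller element is written as a meet with the larger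
     one. *)
  - intros y z L.
    pose proof (fun E => Ax (Meet (Mul (Meet X Y) Z) (Mul Y Z)) (Mul (Meet X Y) Z) E x y z) as E.
    simpl in E. rewrite L in E. apply E.
    intros v; simpl. apply (mul_mono_l HB), (meet_le_r HB).
  - intros y z L.
    pose proof (fun E => Ax (Meet (Mul Z (Meet X Y)) (Mul Z Y)) (Mul Z (Meet X Y)) E x y z) as E.
    simpl in E. rewrite L in E. apply E.
    intros v; simpl. apply (mul_mono_r HB), (meet_le_r HB).
  - apply (fun E => Ax (Meet (Mul (Linv X) X) One) (Mul (Linv X) X) E x x x).
    intros; apply (linv_contract HB).
  - apply (fun E => Ax (Meet One (Mul X (Linv X))) One E x x x).
    intros; apply (linv_expand HB).
  - apply (fun E => Ax (Meet (Mul X (Rinv X)) One) (Mul X (Rinv X)) E x x x).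
    intros; apply (rinv_contract HB).
  - apply (fun E => Ax (Meet One (Mul (Rinv X) X)) One E x x x).
    intros; apply (rinv_expand HB).
Qed.

Lemma eval_iter (C : algebra) (v : nat -> C) f g k t :
  (forall s, eval v (f s) = g (eval v s)) ->
  eval v (Nat.iter k f t) = Nat.iter k g (eval v t).
Proof. intros E; induction k as [|k IH]; simpl; [reflexivity | now rewrite E, IH]. Qed.

Lemma periodic_of_equations n : periodic n B -> periodic n A.
Proof.
  intros P x.
  assert (S : satisfies A (Nat.iter n Linv (Var 0), Nat.iter n Rinv (Var 0))).
  { apply HE; intros v; simpl.
    rewrite (@eval_iter B v Linv linv), (@eval_iter B v Rinv rinv) by reflexivity. apply P. }
  specialize (S (fun _ => x)); simpl in S.
  now rewrite (@eval_iter A _ Linv linv), (@eval_iter A _ Rinv rinv) in S by reflexivity.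
Qed.

Fixpoint meet_orbit_term k t : term :=
  match k with
  | O => t
  | S k => Meet (meet_orbit_term k t) (Nat.iter (S k) (fun s => Linv (Linv s)) t)
  end.

Lemma eval_meet_orbit (C : algebra) (v : nat -> C) k t :
  eval v (meet_orbit_term k t) = meet_orbit k (eval v t).
Proof.
  induction k as [|k IH]; [reflexivity|]. cbn [meet_orbit_term meet_orbit eval].
  now rewrite IH, (@eval_iter C v _ phi) by reflexivity.
Qed.

(* On invertible elements [sigma] is the identity, so that the following
   quasi-identities are equivalent to identities in which [sigma] is applied
   to the variables. *)
Lemma invertible_comm_of_equations n :
  0 < n -> periodic n A -> (forall x y : B, mul (sigma n x) (sigma n y) = mul (sigma n y) (sigma n x)) ->
  forall g h : A, invertible g -> invertible h -> mul g h = mul h g.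
Proof.
  intros n_pos Hper Q g h Hg Hh. pose proof lpregroup_of_equations as HA.
  assert (Sg : forall g : A, invertible g -> sigma n g = g).
  { intros x Hx; apply (le_antisym HA); [apply (sigma_le HA)|].
    apply (le_sigma HA); [exact Hx | apply (le_refl HA)]. }
  set (s i := meet_orbit_term n (Var i)).
  assert (S : satisfies A (Mul (s 0) (s 1), Mul (s 1) (s 0))).
  { apply HE; intros v; cbn [fst snd eval]. unfold s. rewrite !eval_meet_orbit. apply Q. }
  specialize (S (fun i => match i with 0 => g | _ => h end)).
  cbn [fst snd eval] in S. unfold s in S. rewrite !eval_meet_orbit in S. cbn [eval] in S.
  change (mul (sigma n g) (sigma n h) = mul (sigma n h) (sigma n g)) in S.
  now rewrite !Sg in S.
Qed.

Definition power (C : algebra) (k : nat) (x : C) : C := Nat.iter k (mul x) one.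

Lemma power_central_of_equations n :
  0 < n -> periodic n A ->
  (forall x y : B, mul (power n (sigma n x)) y = mul y (power n (sigma n x))) ->
  forall g y : A, invertible g -> mul (power n g) y = mul y (power n g).
Proof.
  intros n_pos Hper Q g y Hg. pose proof lpregroup_of_equations as HA.
  assert (Sg : sigma n g = g).
  { apply (le_antisym HA); [apply (sigma_le HA)|].
    apply (le_sigma HA); [exact Hg | apply (le_refl HA)]. }
  set (s := Nat.iter n (Mul (meet_orbit_term n (Var 0))) One).
  assert (Es : forall (C : algebra) (v : nat -> C), eval v s = power n (sigma n (v 0))).
  { intros C v. unfold s. rewrite (@eval_iter C v _ (mul (sigma n (v 0)))); [reflexivity|].
    intros t; cbn [eval]. now rewrite eval_meet_orbit. }
  assert (S : satisfies A (Mul s (Var 1), Mul (Var 1) s)).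
  { apply HE; intros v; cbn [fst snd eval]. rewrite Es. apply Q. }
  specialize (S (fun i => match i with 0 => g | _ => y end)).
  cbn [fst snd eval] in S. now rewrite Es, Sg in S.
Qed.

End Equations.

(** * The skeleton of F_n(Z) *)

Section FnZFacts.

Variable n : nat.
Hypothesis n_pos : 0 < n.
Local Open Scope Z_scope.

Lemma FnZ_periodic : periodic n (FnZ n).
Proof.
  intros g.
  assert (E : forall (f : FnZ n -> FnZ n) (f' : FZ -> FZ),
    (forall h, proj1_sig (f h) = f' (proj1_sig h)) ->
    forall k, proj1_sig (Nat.iter k f g) = Nat.iter k f' (proj1_sig g)).
  { intros f f' Ef k; induction k as [|k IH]; [reflexivity|].
    change (proj1_sig (f (Nat.iter k f g)) = f' (Nat.iter k f' (proj1_sig g))).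
    now rewrite Ef, IH. }
  pose proof (E linv linv (fun _ => eq_refl) n) as El.
  pose proof (E rinv rinv (fun _ => eq_refl) n) as Er.
  apply fapp_inj; intros x.
  exact (f_equal (fun h => proj1_sig h x) (eq_trans (eq_trans El (proj2_sig g)) (eq_sym Er))).
Qed.

Lemma FnZ_invertible (g : FnZ n) : invertible g -> exists c, forall x, fapp g x = x + c.
Proof.
  intros Hg. apply (invertible_phi (FnZ_lpregroup n)) in Hg.
  assert (St : forall x, fapp g (x + 1) = fapp g x + 1).
  { intros x. rewrite <- Hg at 1. unfold fapp, phi; simpl.
    pose proof (FZ_linv2 (proj1_sig g) (x + 1)) as E. simpl in E. rewrite E.
    do 2 f_equal. lia. }
  exists (fapp g 0). induction x as [|x IH|x IH] using Z.peano_ind.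
  - lia.
  - unfold Z.succ. rewrite St. lia.
  - specialize (St (Z.pred x)). replace (Z.pred x + 1) with x in St by lia. lia.
Qed.

Lemma FnZ_translate (g : FnZ n) k x :
  fapp g (x + k * Z.of_nat n) = fapp g x + k * Z.of_nat n.
Proof.
  assert (St : forall x, fapp g (x + Z.of_nat n) = fapp g x + Z.of_nat n).
  { apply FnZ_translation. exact (proj2_sig g). }
  revert x; induction k as [|k IH|k IH] using Z.peano_ind; intros x.
  - rewrite !Z.add_0_r; lia.
  - replace (x + Z.succ k * Z.of_nat n) with (x + k * Z.of_nat n + Z.of_nat n) by lia.
    rewrite St, IH. lia.
  - specialize (St (x + Z.pred k * Z.of_nat n)).
    replace (x + Z.pred k * Z.of_nat n + Z.of_nat n) with (x + k * Z.of_nat n) in St by lia.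
    rewrite IH in St. lia.
Qed.

Lemma FnZ_sigma (g : FnZ n) : exists c, forall x, fapp (sigma n g) x = x + c.
Proof.
  apply FnZ_invertible, (sigma_invertible (FnZ_lpregroup n) n_pos FnZ_periodic).
Qed.

Lemma FnZ_sigma_comm (g h : FnZ n) :
  mul (sigma n g) (sigma n h) = mul (sigma n h) (sigma n g).
Proof.
  destruct (FnZ_sigma g) as [c Hc], (FnZ_sigma h) as [c' Hc'].
  apply fapp_inj; intros x.
  change (fapp (sigma n g) (fapp (sigma n h) x) = fapp (sigma n h) (fapp (sigma n g) x)).
  rewrite !Hc, !Hc'. lia.
Qed.

(** [sigma n g] is a translation by some [c]. Its [n]-th power translates by [c n] and so commutes
    with every n-periodic map, which the translation by [c] itself need not do. *)
Lemma FnZ_power_sigma_comm (g h : FnZ n) :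
  mul (power n (sigma n g)) h = mul h (power n (sigma n g)).
Proof.
  destruct (FnZ_sigma g) as [c Hc].
  assert (P : forall k x, fapp (power k (sigma n g)) x = x + c * Z.of_nat k).
  { induction k as [|k IH]; intros x; [simpl; rewrite Z.mul_0_r, Z.add_0_r; reflexivity|].
    change (fapp (sigma n g) (fapp (power k (sigma n g)) x) = x + c * Z.of_nat (S k)).
    rewrite Hc, IH. lia. }
  apply fapp_inj; intros x.
  change (fapp (power n (sigma n g)) (fapp h x) = fapp h (fapp (power n (sigma n g)) x)).
  rewrite !P. symmetry; apply FnZ_translate.
Qed.

End FnZFacts.

(** * Congruences of central invertible elements *)

Section Powers.

Variables (A : algebra) (HA : is_lpregroup A).
Implicit Types a b x y : A.
Local Open Scope alg_scope.

Lemma power_add k l a : power (k + l) a = power k a * power l a.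
Proof.
  induction k as [|k IH]; unfold power in *; simpl; [now rewrite (mul_one_l HA)|].
  now rewrite IH, (mul_assoc HA).
Qed.

Lemma power_ge1 k a : 1 <= a -> 1 <= power k a.
Proof.
  intros H; induction k as [|k IH]; [apply (le_refl HA)|].
  apply (le_trans HA) with a; [exact H | now apply (le_mul_r HA)].
Qed.

Lemma power_le k l a : 1 <= a -> (k <= l)%nat -> power k a <= power l a.
Proof.
  intros H L. replace l with (k + (l - k))%nat by lia.
  rewrite power_add. now apply (le_mul_r HA), power_ge1.
Qed.

Lemma power_invertible k a : invertible a -> invertible (power k a).
Proof.
  intros H; induction k as [|k IH]; [apply (invertible_one HA)|].
  now apply (invertible_mul HA).
Qed.

Lemma power_disjoint k a b : 1 <= a -> 1 <= b -> disjoint a b -> disjoint a (power k b).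
Proof.
  intros Ha Hb D; induction k as [|k IH].
  - unfold disjoint. now rewrite (meet_comm HA).
  - apply (disjoint_mul HA); auto. now apply power_ge1.
Qed.

Lemma power_disjoint2 k l a b :
  1 <= a -> 1 <= b -> disjoint a b -> disjoint (power k a) (power l b).
Proof.
  intros Ha Hb D. apply power_disjoint; [now apply power_ge1 | exact Hb|].
  apply (disjoint_sym HA), power_disjoint; auto. now apply (disjoint_sym HA).
Qed.

Lemma central_power k a : (forall x, a * x = x * a) -> forall x, power k a * x = x * power k a.
Proof.
  intros C; induction k as [|k IH]; intros x; unfold power in *; simpl.
  - now rewrite (mul_one_l HA), (mul_one_r HA).
  - now rewrite <- (mul_assoc HA), IH, (mul_assoc HA), C, (mul_assoc HA).
Qed.

(** For central invertible [a >= 1] this is the least congruence identifying [a] with 1. *)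
Definition close a x y : Prop := exists k, x <= power k a * y /\ y <= power k a * x.

(** Centrality moves powers of [a] past other factors; invertibility carries them back across an
    inequality that [linv] or [rinv] has reversed. *)
Lemma close_congruence a :
  invertible a -> 1 <= a -> (forall x, a * x = x * a) -> congruence (close a).
Proof.
  intros Ia Ha Ca.
  assert (W : forall k l x y, x <= power k a * y -> (k <= l)%nat -> x <= power l a * y).
  { intros k l x y H L. apply (le_trans HA) with (power k a * y); [exact H|].
    now apply (mul_mono_l HA), power_le. }
  assert (T : forall k l x y z, x <= power k a * y -> y <= power l a * z ->
    x <= power (k + l) a * z).
  { intros k l x y z H H'. apply (le_trans HA) with (power k a * y); [exact H|].
    rewrite power_add, <- (mul_assoc HA). now apply (mul_mono_r HA). }
  split.
  - split.
    + intros x; exists O. unfold power; simpl. rewrite (mul_one_l HA).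
      split; apply (le_refl HA).
    + intros x y (k & H1 & H2); now exists k.
    + intros x y z (k & H1 & H2) (l & H3 & H4). exists (k + l)%nat; split; [now apply (T k l x y)|].
      rewrite Nat.add_comm. now apply (T l k z y).
  - assert (M : forall k l x x' y y', x <= power k a * x' -> y <= power l a * y' ->
      x ⊓ y <= power (k + l) a * (x' ⊓ y')).
    { intros k l x x' y y' H H'. rewrite (mul_meet_l HA).
      apply (meet_mono HA); [apply (W k) | apply (W l)]; auto; lia. }
    intros x x' y y' (k & H1 & H2) (l & H3 & H4). exists (k + l)%nat; split; now apply M.
  - assert (M : forall k l x x' y y', x <= power k a * x' -> y <= power l a * y' ->
      x ⊔ y <= power (k + l) a * (x' ⊔ y')).
    { intros k l x x' y y' H H'. rewrite (mul_join_l HA). apply (join_lub HA).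
      - apply (le_join_trans_l HA), (W k); auto; lia.
      - apply (le_join_trans_r HA), (W l); auto; lia. }
    intros x x' y y' (k & H1 & H2) (l & H3 & H4). exists (k + l)%nat; split; now apply M.
  - assert (M : forall k l x x' y y', x <= power k a * x' -> y <= power l a * y' ->
      x * y <= power (k + l) a * (x' * y')).
    { intros k l x x' y y' H H'.
      apply (le_trans HA) with (power k a * x' * (power l a * y')); [now apply (mul_le HA)|].
      apply (eq_le HA). rewrite power_add, <- !(mul_assoc HA). f_equal.
      now rewrite !(mul_assoc HA), (central_power l Ca x'). }
    intros x x' y y' (k & H1 & H2) (l & H3 & H4). exists (k + l)%nat; split; now apply M.
  - assert (M : forall k x y, x <= power k a * y -> linv y <= power k a * linv x).
    { intros k x y H. rewrite (central_power k Ca).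
      apply (linv_anti HA) in H. rewrite (linv_mul HA) in H.
      pose proof (power_invertible k Ia) as Ik.
      apply (le_trans HA) with (linv y * linv (power k a) * power k a).
      - rewrite <- (mul_assoc HA), (Vmul HA Ik), (mul_one_r HA). apply (le_refl HA).
      - now apply (mul_mono_l HA). }
    intros x y (k & H1 & H2); exists k; split; now apply M.
  - assert (M : forall k x y, x <= power k a * y -> rinv y <= power k a * rinv x).
    { intros k x y H. rewrite (central_power k Ca) in H.
      apply (rinv_anti HA) in H. rewrite (rinv_mul HA) in H.
      pose proof (power_invertible k Ia) as Ik. rewrite <- Ik in H.
      apply (le_invertible_l HA) in H; [|now apply (invertible_linv HA)].
      now rewrite (linv_linv HA Ik) in H. }
    intros x y (k & H1 & H2); exists k; split; now apply M.
Qed.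

(** Two upper bounds [power k a * y] and [power l b * y] meet in [(power k a ⊓ power l b) * y], and
    powers of disjoint elements are disjoint. *)
Lemma close_disjoint a b x y :
  1 <= a -> 1 <= b -> disjoint a b -> close a x y -> close b x y -> x = y.
Proof.
  intros Ha Hb D (k & H1 & H2) (l & H3 & H4).
  assert (M : forall x y, x <= power k a * y -> x <= power l b * y -> x <= y).
  { intros x' y' L L'. rewrite <- (mul_one_l HA y').
    rewrite <- (power_disjoint2 k l Ha Hb D), (mul_meet_r HA). now apply (meet_glb HA). }
  apply (le_antisym HA); now apply M.
Qed.

Lemma close_one a : 1 <= a -> close a a 1.
Proof.
  intros Ha; exists 1%nat. unfold power; simpl. rewrite !(mul_one_r HA).
  split; [apply (le_refl HA)|]. apply (le_trans HA) with a; [exact Ha | now apply (le_mul_r HA)].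
Qed.

End Powers.

(** * Order of the skeleton and intersections of congruences *)

Section Skeleton.

Variables (A : algebra) (HA : is_lpregroup A) (n : nat).
Hypotheses (n_pos : 0 < n) (Hper : periodic n A).

Lemma skeleton_total_iff : totally_ordered (skeleton HA) <->
  forall g h : A, invertible g -> invertible h -> le g h \/ le h g.
Proof.
  split.
  - intros T g h Hg Hh.
    destruct (T (exist _ g Hg : skeleton HA) (exist _ h Hh : skeleton HA)) as [L|L]; [left|right];
      exact (f_equal (@proj1_sig _ _) L).
  - intros T [g Hg] [h Hh]. destruct (T g h Hg Hh) as [L|L]; [left|right];
      apply subset_eq_compat; exact L.
Qed.

Lemma skeleton_abelian_iff : abelian (skeleton HA) <->
  forall g h : A, invertible g -> invertible h -> mul g h = mul h g.
Proof.
  split.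
  - intros T g h Hg Hh.
    exact (f_equal (@proj1_sig _ _) (T (exist _ g Hg : skeleton HA) (exist _ h Hh : skeleton HA))).
  - intros T [g Hg] [h Hh]. apply subset_eq_compat. now apply T.
Qed.

Local Open Scope alg_scope.

(* [w ⊔ 1] and [w^-1 ⊔ 1] are disjoint; their central powers give two
   congruences with trivial intersection. *)
Lemma skeleton_total_of_fsi :
  meet_irreducible (@eq A) ->
  (forall g y : A, invertible g -> power n g * y = y * power n g) ->
  forall g h : A, invertible g -> invertible h -> le g h \/ le h g.
Proof.
  intros I Cen g h Hg Hh.
  set (w := linv h * g).
  assert (Hw : invertible w) by (apply (invertible_mul HA); [now apply (invertible_linv HA) | exact Hg]).
  assert (Hw' : invertible (linv w)) by now apply (invertible_linv HA).
  set (a := w ⊔ 1). set (b := linv w ⊔ 1).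
  assert (Ia : invertible a) by (apply (invertible_join HA); [exact Hw | apply (invertible_one HA)]).
  assert (Ib : invertible b) by (apply (invertible_join HA); [exact Hw' | apply (invertible_one HA)]).
  assert (a1 : 1 <= a) by apply (le_join_r HA).
  assert (b1 : 1 <= b) by apply (le_join_r HA).
  (* Both [b = linv w * a] and [linv a = 1 ⊓ linv w] hold, so
     [a ⊓ b = (1 ⊓ linv w) * a = linv a * a]. *)
  assert (D : disjoint a b).
  { unfold disjoint. assert (E : b = linv w * a).
    { unfold a, b. rewrite (mul_join_l HA), (Vmul HA Hw), (mul_one_r HA). apply (join_comm HA). }
    rewrite E. rewrite <- (mul_one_l HA a) at 1. rewrite <- (mul_meet_r HA).
    assert (E' : 1 ⊓ linv w = linv a).
    { unfold a. rewrite (linv_join HA), (linv_one HA). apply (meet_comm HA). }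
    rewrite E'. now apply (Vmul HA). }
  assert (Ca : congruence (close (power n a))).
  { apply (close_congruence HA); [now apply (power_invertible HA) | now apply (power_ge1 HA) |].
    intros; now apply Cen. }
  assert (Cb : congruence (close (power n b))).
  { apply (close_congruence HA); [now apply (power_invertible HA) | now apply (power_ge1 HA) |].
    intros; now apply Cen. }
  assert (One : forall c : A, 1 <= c -> same_relation A eq (close (power n c)) -> c = 1).
  { intros c c1 [_ E]. apply (le_antisym HA); [|exact c1].
    rewrite <- (E (power n c) 1); [|now apply (close_one HA), (power_ge1 HA)].
    apply (le_trans HA) with (power 1 c); [|apply (power_le HA); [exact c1 | lia]].
    unfold power; simpl. rewrite (mul_one_r HA). apply (le_refl HA). }
  destruct (I _ _ Ca Cb) as [E|E].
  - split.
    + intros x y ->; split; [apply (congr_equiv Ca) | apply (congr_equiv Cb)].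
    + intros x y [H1 H2]. apply (close_disjoint HA (a := power n a) (b := power n b));
        auto; try now apply (power_ge1 HA). now apply (power_disjoint2 HA).
  - left. apply One in E; [|exact a1].
    assert (L : w <= 1) by (rewrite <- E; apply (le_join_l HA)).
    unfold w in L. apply (le_invertible_l HA) in L; [|now apply (invertible_linv HA)].
    now rewrite (linv_linv HA Hh), (mul_one_r HA) in L.
  - right. apply One in E; [|exact b1].
    assert (L : linv w <= 1) by (rewrite <- E; apply (le_join_l HA)).
    unfold w in L. rewrite (linv_mul HA), (linv_linv HA Hh) in L.
    apply (le_invertible_l HA) in L; [|now apply (invertible_linv HA)].
    now rewrite (linv_linv HA Hg), (mul_one_r HA) in L.
Qed.

Lemma congruence_convex S (g h : A) :
  congruence S -> 1 <= g -> g <= h -> S h 1 -> S g 1.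
Proof.
  intros C g1 L Sh. destruct (congr_equiv C) as [Refl _ _].
  unfold le in g1, L. rewrite (meet_comm HA) in L.
  pose proof (congr_meet C Sh (Refl g)) as E. now rewrite L, g1 in E.
Qed.

(** Classes of 1 are convex, so the smaller of the two skeleton elements given by
    [congruence_contains] is identified with 1 by both congruences. *)
Lemma congruence_contains_comparable S T :
  (forall g h : A, invertible g -> invertible h -> le g h \/ le h g) ->
  congruence S -> congruence T -> ~ same_relation A eq S -> ~ same_relation A eq T ->
  exists h : A, h <> 1 /\ S h 1 /\ T h 1.
Proof.
  intros Tot CS CT NS NT.
  destruct (congruence_contains HA n_pos Hper CS NS) as (g & Hg & g1 & Ng & Sg).
  destruct (congruence_contains HA n_pos Hper CT NT) as (h & Hh & h1 & Nh & Th).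
  destruct (Tot g h Hg Hh) as [L|L].
  - exists g; repeat split; auto. now apply congruence_convex with h.
  - exists h; repeat split; auto. now apply congruence_convex with g.
Qed.

End Skeleton.

(** * Irreducible members of the variety *)

Lemma si_fsi A : subdirectly_irreducible A -> finitely_subdirectly_irreducible A.
Proof.
  intros [Nt M]; split; [exact Nt|]. intros S T CS CT [E1 E2].
  destruct (M (fun R => R = S \/ R = T)) as (R & [->| ->] & E); auto.
  - intros R [->| ->]; assumption.
  - split.
    + intros x y Hxy R [->| ->]; now apply E1.
    + intros x y H; apply E2; split; apply H; auto.
Qed.

(* The least element of the skeleton above [1] lies in every nontrivial
   congruence. *)
Lemma nongroup_si (A : algebra) (HA : is_lpregroup A) n :
  0 < n -> periodic n A -> nontrivial A ->
  (forall g h : A, invertible g -> invertible h -> le g h \/ le h g) ->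
  ~ (forall a : A, invertible a) -> subdirectly_irreducible A.
Proof.
  intros n_pos Hper Nt Tot N. split; [exact Nt|].
  apply not_all_ex_not in N as [a N].
  destruct (exists_atom HA n_pos Hper Tot N) as (e & He & De).
  intros K HK [_ E]. apply NNPP; intros C.
  apply (u_neq1 HA (n := n) He), E. intros S KS.
  assert (NS : ~ same_relation A eq S) by (intros ES; apply C; now exists S).
  destruct (congruence_contains HA n_pos Hper (HK S KS) NS) as (h & Hh & h1 & Nh & Sh).
  apply (congruence_convex HA) with h; auto.
  - apply (one_le_u HA n He).
  - now apply (u_le HA n_pos Hper Tot He De).
Qed.

Lemma fsi_characterization n A : 0 < n ->
  (var_FnZ n A /\ finitely_subdirectly_irreducible A) <->
  (exists HA : is_lpregroup A,
     nontrivial A /\ periodic n A /\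
     totally_ordered (skeleton HA) /\ abelian (skeleton HA)).
Proof.
  intros n_pos. split.
  - intros [V [Nt I]]. pose proof (proj1 (var_FnZ_iff n A) V) as HE.
    pose proof (lpregroup_of_equations (FnZ_lpregroup n) HE) as HA.
    pose proof (periodic_of_equations HE (@FnZ_periodic n)) as Hper.
    exists HA; split; [exact Nt | split; [exact Hper | split]].
    + apply skeleton_total_iff, (skeleton_total_of_fsi HA (n := n)); auto.
      intros g y. apply (power_central_of_equations (FnZ_lpregroup n) HE); auto.
      now apply FnZ_power_sigma_comm.
    + apply skeleton_abelian_iff, (invertible_comm_of_equations (FnZ_lpregroup n) HE n_pos Hper).
      now apply FnZ_sigma_comm.
  - intros (HA & Nt & Hper & Tot & Ab).
    pose proof (proj1 (skeleton_total_iff HA) Tot) as Tot'.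
    pose proof (proj1 (skeleton_abelian_iff HA) Ab) as Ab'.
    split; [|split; [exact Nt|]].
    + apply var_FnZ_iff. intros e.
      apply (totally_ordered_skeleton_satisfies HA n_pos Hper Tot' Ab').
    + intros S T CS CT [E1 E2]. apply NNPP; intros C. apply not_or_and in C as [NS NT].
      destruct (congruence_contains_comparable HA n_pos Hper Tot' CS CT NS NT) as (h & Nh & Sh & Th).
      now apply Nh, E2.
Qed.

Theorem corollary6p12 :
  forall n : nat, (0 < n)%nat ->
    (forall A : algebra,
       (var_FnZ n A /\ finitely_subdirectly_irreducible A) <->
       (exists HA : is_lpregroup A,
          nontrivial A /\ periodic n A /\
          totally_ordered (skeleton HA) /\ abelian (skeleton HA)))
    /\
    (forall A : algebra,
       var_FnZ n A -> finitely_subdirectly_irreducible A -> ~ is_lgroup A ->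
       subdirectly_irreducible A)
    /\
    (forall A : algebra,
       (var_FnZ n A /\ finitely_subdirectly_irreducible A) <->
       ((var_FnZ n A /\ subdirectly_irreducible A) \/
        (nontrivial A /\ is_lgroup A /\ totally_ordered A /\ abelian A))).
Proof.
  intros n n_pos.
  assert (SI : forall A : algebra, var_FnZ n A -> finitely_subdirectly_irreducible A ->
    ~ is_lgroup A -> subdirectly_irreducible A).
  { intros A V F NG.
    destruct (proj1 (fsi_characterization A n_pos) (conj V F)) as (HA & Nt & Hper & Tot & _).
    apply (nongroup_si HA n_pos Hper Nt); [now apply (skeleton_total_iff HA)|].
    intros Inv. apply NG. now split. }
  split; [intros A; now apply fsi_characterization | split; [exact SI|]].
  intros A. split.
  - intros [V F]. destruct (classic (is_lgroup A)) as [G|NG]; [right | left; auto].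
    destruct (proj1 (fsi_characterization A n_pos) (conj V F)) as (HA & Nt & _ & Tot & Ab).
    pose proof (proj2 G) as Inv. split; [exact Nt | split; [exact G | split]].
    + intros x y. apply (proj1 (skeleton_total_iff HA) Tot); apply Inv.
    + intros x y. apply (proj1 (skeleton_abelian_iff HA) Ab); apply Inv.
  - intros [[V S]|(Nt & [HA Inv] & Tot & Ab)]; [split; [exact V | now apply si_fsi]|].
    apply (fsi_characterization A n_pos).
    exists HA; split; [exact Nt | split; [|split]].
    + intros x. unfold periodic_elt. clear n_pos SI.
      induction n as [|k IH]; [reflexivity|]. simpl. now rewrite IH, Inv.
    + apply skeleton_total_iff; auto.
    + apply skeleton_abelian_iff; auto.
Qed.
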